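(* Let $F,f:\mathbb R^n\times\mathbb R^m\to\mathbb R$, $G:\mathbb R^n\times\mathbb R^m\to\mathbb R^q$, $g:\mathbb R^n\times\mathbb R^m\to\mathbb R^p$ be continuously differentiable such that for each fixed $x$, $f(x,\cdot)$ is weakly convex and each component of $g(x,\cdot)$ is quasi-convex. Let $\gamma>0$, let $(\bar x,\bar y)$ be a feasible solution of $$(\mathrm{VP})_\gamma\qquad\min_{x,y}F(x,y)\quad\text{s.t. } f(x,y)-v_\gamma(x,y)\le0,\ g(x,y)\le0,\ G(x,y)\le0,$$ and let $(u,v)\in\mathbb R^n\times\mathbb R^m$. For a set $A\subseteq\mathbb R^n\times\mathbb R^m$, say that condition $\mathrm{Q}(A)$ holds if there is no nonzero $(\alpha,\nu_g,\nu_G)\in\mathbb R_+^{1+p+q}$ satisfying $$0\in\alpha\nabla f(\bar x,\bar y)-\alpha A+\nabla g(\bar x,\bar y)^T\nu_g+\nabla G(\bar x,\bar y)^T\nu_G,$$ $$\nu_g\perp g(\bar x,\bar y),\ \nu_g\perp\nabla g(\bar x,\bar y)(u,v),\ \nu_G\perp G(\bar x,\bar y),\ \nu_G\perp\nabla G(\bar x,\bar y)(u,v),$$ $$\alpha\perp\xi\ \text{ for some }\ \xi\in\nabla f(\bar x,\bar y)(u,v)-Dv_\gamma(\bar x,\bar y)(u,v),$$ and for which there exist sequences $t_k\downarrow0$, $(u^k,v^k)\to(u,v)$ such that, with $(x^k,y^k):=(\bar x+t_ku^k,\bar y+t_kv^k)$, $$\alpha\big(f(x^k,y^k)-v_\gamma(x^k,y^k)\big)>0\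 \text{ if }\alpha>0,$$ $$g_i(x^k,y^k)>0\ \text{ if }(\nu_g)_i>0,\ i\in I_g(\bar x,\bar y),\qquad G_i(x^k,y^k)>0\ \text{ if }(\nu_G)_i>0,\ i\in I_G(\bar x,\bar y).$$ The directional quasi-normality for $(\mathrm{VP})_\gamma$ at $(\bar x,\bar y)$ in direction $(u,v)$ is the condition $\mathrm{Q}(\partial^cv_\gamma(\bar x,\bar y;u,v))$, with $v_\gamma$ directionally Lipschitz continuous at $(\bar x,\bar y)$ in direction $(u,v)$. It holds in each of the following cases. (i) $\gamma\in(0,\frac1{2\rho_f})$, where $f(x,\cdot)$ is $\rho_f$-weakly convex for each fixed $x$; either MFCQ holds for the system $g(\bar x,y)\le0$ at $\bar y$, or: the system $g(x,y)\le0$ satisfies MSCQ at $(\bar x,\bar y)$, $\mathcal F$ satisfies RS at $(\bar x,\bar y)$ in direction $u$, $\mathbb L(\bar x,\bar y;\pm u)$ is nonempty and FOSCMS holds at $\bar y$ in direction $\nabla g(\bar x,\bar y)(\pm u,v')$ for any $v'\in\mathbb L(\bar x,\bar y;\pm u)$; and condition $\mathrm{Q}(A)$ holds with $$A=\operatorname{co}\Big(\bigcup_{d\in\widetilde{\mathcal C}(\bar x,\bar y;u)\cup(\widetilde{\mathcal C}(\bar x,\bar y;0)\cap\mathbb S)}\ \bigcup_{\lambda\in\Lambda(\bar x,\bar y;u,d)}\{\nabla_xf(\bar x,\bar y)+\nabla_xg(\bar x,\bar y)^T\lambda\}\times\{0\}\Big).$$ Moreover, if $S_\gamma$ is inner calm*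 at $(\bar x,\bar y)$ in direction $(u,v)$, then $A$ may be replaced here by $$A=\operatorname{co}\Big(\bigcup_{d\in\widetilde{\mathcal C}(\bar x,\bar y;u)}\ \bigcup_{\lambda\in\Lambda(\bar x,\bar y;u,d)}\{\nabla_xf(\bar x,\bar y)+\nabla_xg(\bar x,\bar y)^T\lambda\}\times\{0\}\Big).$$ (ii) $f$ is $\rho_f$-weakly convex on $\operatorname{gph}\mathcal F$ with $\rho_f>0$, $\gamma\in(0,1/\rho_f)$; $\mathcal F(x)\ne\emptyset$ for all $x$ in a neighborhood of $\bar x$; MSCQ for the system $g(x,y)\le0$ holds at $(\bar x,\bar y)$; and condition $\mathrm{Q}(A)$ holds with $$A=\bigcup_{\lambda_g\in\Lambda(\bar x,\bar y;u,v)}\{(\nabla_xf(\bar x,\bar y)+\nabla_xg(\bar x,\bar y)^T\lambda_g,\,0)\}.$$ (iii) $\gamma\in(0,\frac1{2\rho_f})$, where $f(x,\cdot)$ is $\rho_f$-weakly convex for each fixed $x$; $\bar y\in S(\bar x)$; $\mathcal F$ is RCR-regular at $(\bar x,\bar y)$ and satisfies RS at $(\bar x,\bar y)$ in direction $u$; and condition $\mathrm{Q}(A)$ holds with $$A=\bigcup_{\lambda_g\in\Lambda(\bar x,\bar y;u,d)}\{(\nabla_xf(\bar x,\bar y)+\nabla_xg(\bar x,\bar y)^T\lambda_g,\,0)\}$$ for some $d\in\mathcal C(\bar x,\bar y;u)$.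
   Context: Definitions. $S(x)$ is the solution set of $\min_y\{f(x,y)\mid g(x,y)\le0\}$; $\mathcal F(x):=\{y\in\mathbb R^m\mid g(x,y)\le0\}$; $v_\gamma(x,y):=\inf_w\{f(x,w)+\frac1{2\gamma}\|w-y\|^2\mid g(x,w)\le0\}$ (Moreau envelope function) and $S_\gamma(x,y)$ is the set of its minimizers $w$. A function $h$ is $\rho$-weakly convex ($\rho\ge0$) if $h+\frac\rho2\|\cdot\|^2$ is convex, and $\rho$-weakly convex on a set $D$ if $h+\frac\rho2\|\cdot\|^2+\delta_D$ is convex, $\delta_D$ being the indicator function of $D$; if $\rho_f=0$, $1/(2\rho_f)$ is read as $+\infty$. Quasi-convex: all sublevel sets are convex. $I_g(x,y):=\{i\mid g_i(x,y)=0\}$, similarly $I_G$; $\nabla g(x,y)(u,v)=\nabla_xg(x,y)u+\nabla_yg(x,y)v$; $a\perp b$ means $\langle a,b\rangle=0$; $\operatorname{co}$ is the convex hull; $\mathbb S$ is the unit sphere, $\mathbb B$ the open unit ball, $\mathbb B_\epsilon(\bar z)$ the open ball of radius $\epsilon$; $a_+$ is the componentwise positive part. $\mathcal L(x,y;\lambda):=f(x,y)+g(x,y)^T\lambda$; $\Lambda(x,y):=\{\lambda\in\mathbb R^p_+\mid\nabla_y\mathcal L(x,y;\lambda)=0,\ g(x,y)^T\lambda=0\}$; $\Lambda(x,y;u,d):=\{\lambda\in\Lambda(x,y)\mid\lambda^T\nabla g(x,y)(u,d)=0\}$. With $\psi'_+(z;d):=\limsup_{t\downarrow0}\frac{\psi(z+td)-\psi(z)}t$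 and $\psi'_-$ the corresponding $\liminf$, $$\mathcal C(\bar x,\bar y;u):=\{d\mid(v_\gamma)'_-(\bar x,\bar y;u,d)\le\nabla f(\bar x,\bar y)(u,d)\le(v_\gamma)'_+(\bar x,\bar y;u,d),\ \nabla g_i(\bar x,\bar y)(u,d)\le0\ \forall i\in I_g(\bar x,\bar y)\},$$ $$\widetilde{\mathcal C}(\bar x,\bar y;u):=\Big\{d\ \Big|\ \min_{\lambda\in\Lambda(\bar x,\bar y)}\nabla_x\mathcal L(\bar x,\bar y;\lambda)u\le\nabla f(\bar x,\bar y)(u,d)\le\max_{\lambda\in\Lambda(\bar x,\bar y)}\nabla_x\mathcal L(\bar x,\bar y;\lambda)u,\ \nabla g_i(\bar x,\bar y)(u,d)\le0\ \forall i\in I_g(\bar x,\bar y)\Big\}.$$ $\mathbb L(\bar x,\bar y;\tilde u):=\{v'\in\mathbb R^m\mid\nabla g_i(\bar x,\bar y)(\tilde u,v')\le0,\ i\in I_g(\bar x,\bar y)\}$. Graphical derivative: $D\psi(\bar z)(d):=\{\eta\mid\exists t_k\downarrow0,\ d_k\to d,\ \eta=\lim_k\frac{\psi(\bar z+t_kd_k)-\psi(\bar z)}{t_k}\}$. Directional limiting subdifferential: $\partial\psi(\bar z;d)$ is the set of limits of $\xi^k\in\widehat\partial\psi(\bar z+t_kd^k)$ with $t_k\downarrow0$, $d^k\to d$, $\psi(\bar z+t_kd^k)\to\psi(\bar z)$, where $\widehat\partial\psi(z):=\{\xi\mid\psi(z')\ge\psi(z)+\langle\xi,z'-z\rangle+o(\|z'-z\|)\}$;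 $\partial^c\psi(\bar z;d):=\operatorname{co}\partial\psi(\bar z;d)$. Directional neighborhood: $\mathcal V_{\epsilon,\delta}(d):=\{z\in\epsilon\mathbb B\mid\big\|\|d\|z-\|z\|d\big\|\le\delta\|z\|\|d\|\}$. Directionally Lipschitz at $\bar z$ in direction $d$: Lipschitz on $\bar z+\mathcal V_{\epsilon,\delta}(d)$ for some $\epsilon,\delta>0$. MSCQ for $g(x,y)\le0$ at $(\bar x,\bar y)$: there are $\epsilon,\kappa>0$ with $\operatorname{dist}((x,y),\{g\le0\})\le\kappa\|g_+(x,y)\|$ for all $(x,y)\in\mathbb B_\epsilon(\bar x,\bar y)$. Robinson stability (RS) of $\mathcal F$ at $(\bar x,\bar y)$ in direction $u$: there are $\kappa,\epsilon,\delta>0$ with $\operatorname{dist}(y,\mathcal F(x))\le\kappa\|g_+(x,y)\|$ for all $x\in\bar x+\mathcal V_{\epsilon,\delta}(u)$, $y\in\mathbb B_\epsilon(\bar y)$. RCR-regularity of $\mathcal F$ at $(\bar x,\bar y)$: there is $\delta>0$ such that for every $K\subseteq I_g(\bar x,\bar y)$ the family $\nabla_yg_j(x,y)$, $j\in K$, has the same rank at all $(x,y)\in\mathbb B_\delta(\bar x,\bar y)$. MFCQ for $g(\bar x,y)\le0$ at $\bar y$: $\nabla_yg(\bar x,\bar y)^T\lambda=0$, $0\le\lambda\perp g(\bar x,\bar y)$ imply $\lambda=0$. FOSCMS at $\bar y$ (for $g(\bar x,y)\le0$) in direction $\xi\in\mathbb R^p$: $\nabla_yg(\bar x,\bar y)^T\lambda=0$,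 $0\le\lambda\perp g(\bar x,\bar y)$, $\lambda\perp\xi$ imply $\lambda=0$. Inner calmness*: $S_\gamma$ is inner calm* at $(\bar x,\bar y)$ (i.e. at $(\bar x,\bar y,\bar w)$ with $\bar w=\bar y$) in direction $(u,v)$ if there is $\kappa>0$ such that for every sequence $(x^k,y^k)=(\bar x,\bar y)+t_k(u^k,v^k)$ with $t_k\downarrow0$, $(u^k,v^k)\to(u,v)$, there are an infinite index set $K\subseteq\mathbb N$ and $w^k\in S_\gamma(x^k,y^k)$, $k\in K$, with $\|w^k-\bar y\|\le\kappa\|(x^k,y^k)-(\bar x,\bar y)\|$ for $k\in K$.
   Formalization: In condition Q(A) the set αA is read as {0} when α = 0, also for empty A; with 0·∅ = ∅ the claim fails, e.g. in case (ii) with f = y, g = −y, G = x² at (0,0) in direction (1,1). *)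

(* Defs.v *)
From HB Require Import structures.
From mathcomp Require Import all_boot all_order all_algebra.
From mathcomp Require Import interval_inference.
From mathcomp Require Import boolp classical_sets cardinality reals ereal.
From mathcomp Require Import topology normedtype sequences derive realfun convex.

Set Implicit Arguments.
Unset Strict Implicit.
Unset Printing Implicit Defensive.

Import Order.TTheory GRing.Theory Num.Theory.
Import numFieldNormedType.Exports.

Local Open Scope classical_set_scope.
Local Open Scope convex_scope.
Local Open Scope ring_scope.

(** Vectors are row vectors, and R^n x R^m is the product type
    ['rV_n * 'rV_m]. The norm [`|_|] of the library on these types is the
    sup norm; the Euclidean structure is given by [dot], [pdot], [enorm]
    and [pnorm] below. Topological notions (limits, neighborhoods,
    differentiability) do not depend on this choice. *)

Section Euclidean.
Context {R : realType}.

Definition dot {k} (a b : 'rV[R]_k) : R := \sum_i a 0 i * b 0 i.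
Definition enorm {k} (a : 'rV[R]_k) : R := Num.sqrt (dot a a).

Definition pdot {n m} (z w : 'rV[R]_n * 'rV[R]_m) : R :=
  dot z.1 w.1 + dot z.2 w.2.
Definition pnorm {n m} (z : 'rV[R]_n * 'rV[R]_m) : R := Num.sqrt (pdot z z).

Definition nonneg {k} (a : 'rV[R]_k) : Prop := forall i, 0 <= a 0 i.
Definition nonpos {k} (a : 'rV[R]_k) : Prop := forall i, a 0 i <= 0.
Definition pospart {k} (a : 'rV[R]_k) : 'rV[R]_k := \row_i Num.max (a 0 i) 0.

(* Distances are extended reals: the distance to the empty set is +oo. *)
Definition dist {k} (y : 'rV[R]_k) (D : set 'rV[R]_k) : \bar R :=
  ereal_inf [set (enorm (y - w))%:E | w in D].
Definition pdist {n m} (z : 'rV[R]_n * 'rV[R]_m)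
    (D : set ('rV[R]_n * 'rV[R]_m)) : \bar R :=
  ereal_inf [set (pnorm (z - w))%:E | w in D].

End Euclidean.

Section Calculus.
Context {R : realType}.

(* In finite dimension, continuity of the derivative as an operator-valued
   map is continuity of z |-> 'd h z d for every direction d. *)
Definition C1 (V W : normedModType R) (h : V -> W) : Prop :=
  (forall z, differentiable h z) /\ (forall d, continuous (fun z => 'd h z d)).

Context {n m : nat}.
Local Notation Z := ('rV[R]_n * 'rV[R]_m)%type.

Definition gradx (h : Z -> R) (z : Z) : 'rV[R]_n :=
  \row_j 'd h z (delta_mx 0 j, 0).
Definition grady (h : Z -> R) (z : Z) : 'rV[R]_m :=
  \row_j 'd h z (0, delta_mx 0 j).
Definition grad (h : Z -> R) (z : Z) : Z := (gradx h z, grady h z).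

Definition component {k} (h : Z -> 'rV[R]_k) (i : 'I_k) : Z -> R :=
  fun z => h z 0 i.

(* Transposed (partial) Jacobians applied to a vector. *)
Definition jacTx {k} (h : Z -> 'rV[R]_k) (z : Z) (nu : 'rV[R]_k) : 'rV[R]_n :=
  \sum_i nu 0 i *: gradx (component h i) z.
Definition jacTy {k} (h : Z -> 'rV[R]_k) (z : Z) (nu : 'rV[R]_k) : 'rV[R]_m :=
  \sum_i nu 0 i *: grady (component h i) z.
Definition jacT {k} (h : Z -> 'rV[R]_k) (z : Z) (nu : 'rV[R]_k) : Z :=
  \sum_i nu 0 i *: grad (component h i) z.

Definition active {k} (h : Z -> 'rV[R]_k) (z : Z) (i : 'I_k) : Prop :=
  h z 0 i = 0.

End Calculus.

Section Convexity.
Context {R : realType}.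

Definition econvex {V : lmodType R} (phi : V -> \bar R) : Prop :=
  forall (x y : convex_lmodType V) (t : {i01 R}),
    (phi (x <| t |> y) <=
       (t%:num)%:E * phi x + (1 - t%:num)%:E * phi y)%E.

Definition indicator_fun {V : Type} (D : set V) (z : V) : \bar R :=
  if z \in D then 0%E else +oo%E.

Definition weakly_convex {k} (rho : R) (h : 'rV[R]_k -> R) : Prop :=
  convex_function setT (fun y => h y + rho / 2 * enorm y ^+ 2).

Definition pweakly_convex_on {n m} (rho : R) (D : set ('rV[R]_n * 'rV[R]_m))
    (h : 'rV[R]_n * 'rV[R]_m -> R) : Prop :=
  econvex (fun z =>
    ((h z + rho / 2 * pnorm z ^+ 2)%:E + indicator_fun D z)%E).

Definition quasi_convex {k} (h : 'rV[R]_k -> R) : Prop :=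
  forall c : R, convex_set [set y | h y <= c].

Definition co {V : lmodType R} (A : set V) : set V := smallest (@convex_set R V) A.

End Convexity.

Section Variational.
Context {R : realType}.

Definition argmin {T : Type} (h : T -> R) (D : set T) : set T :=
  [set w | D w /\ forall w', D w' -> h w <= h w'].

Definition tends0 (t : nat -> R) : Prop :=
  (forall k, 0 < t k) /\ t @ \oo --> (0 : R).

Section normed.
Context {V : normedModType R}.
Implicit Types (psi : V -> \bar R) (z d : V).

Definition diff_quot psi z d (t : R) : \bar R :=
  ((psi (z + t *: d)%R - psi z) * (t^-1)%:E)%E.

Definition upper_dd psi z d : \bar R := limf_esup (diff_quot psi z d) 0^'+.
Definition lower_dd psi z d : \bar R := limf_einf (diff_quot psi z d) 0^'+.

Definition graph_deriv psi z d : set R :=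
  [set eta | exists (t : nat -> R) (d_ : nat -> V),
    [/\ tends0 t, d_ @ \oo --> d &
        (fun k => diff_quot psi z (d_ k) (t k)) @ \oo --> eta%:E]].

(* [N] is the Euclidean norm of [V]. *)
Definition dir_nbhd (N : V -> R) (eps delta : R) d : set V :=
  [set z | N z < eps /\ N (N d *: z - N z *: d) <= delta * N z * N d].

End normed.

Context {n m : nat}.
Local Notation Z := ('rV[R]_n * 'rV[R]_m)%type.
Implicit Types (psi : Z -> \bar R) (z d : Z).

Definition frechet_subdiff psi z : set Z :=
  [set xi | psi z \is a fin_num /\
    forall e : R, 0 < e -> \forall z' \near z,
      (psi z + (pdot xi (z' - z) - e * pnorm (z' - z))%:E <= psi z')%E].

Definition dir_subdiff psi z d : set Z :=
  [set xi | exists (t : nat -> R) (d_ xi_ : nat -> Z),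
    [/\ tends0 t, d_ @ \oo --> d,
        (fun k => psi (z + t k *: d_ k)) @ \oo --> psi z,
        xi_ @ \oo --> xi &
        forall k, frechet_subdiff psi (z + t k *: d_ k) (xi_ k)]].

Definition dir_subdiffc psi z d : set Z := co (dir_subdiff psi z d).

(* For an extended-real-valued function, being Lipschitz on a set includes
   being finite there. *)
Definition dir_lipschitz psi z d : Prop :=
  exists eps delta L : R, [/\ 0 < eps, 0 < delta, 0 < L &
    let D := [set z + h | h in dir_nbhd pnorm eps delta d] in
    (forall a, D a -> psi a \is a fin_num) /\
    (forall a b, D a -> D b ->
       `|fine (psi a) - fine (psi b)| <= L * pnorm (a - b))].

End Variational.

Section LowerLevel.
Context {R : realType} {n m p : nat}.
Local Notation Z := ('rV[R]_n * 'rV[R]_m)%type.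
Variables (f : Z -> R) (g : Z -> 'rV[R]_p).
Implicit Types (x u : 'rV[R]_n) (y w d : 'rV[R]_m) (z : Z).

Definition feas x : set 'rV[R]_m := [set y | nonpos (g (x, y))].
Definition gph_feas : set Z := [set z | nonpos (g z)].
Definition sol x : set 'rV[R]_m := argmin (fun y => f (x, y)) (feas x).

Definition moreau_obj (gamma : R) z w : R :=
  f (z.1, w) + (2 * gamma)^-1 * enorm (w - z.2) ^+ 2.

(* +oo when the lower-level feasible set is empty. *)
Definition moreau (gamma : R) z : \bar R :=
  ereal_inf [set (moreau_obj gamma z w)%:E | w in feas z.1].

Definition Sgamma (gamma : R) z : set 'rV[R]_m :=
  argmin (moreau_obj gamma z) (feas z.1).

Definition lagrangian (lambda : 'rV[R]_p) z : R := f z + dot (g z) lambda.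

Definition multipliers z : set 'rV[R]_p :=
  [set lambda | [/\ nonneg lambda, grady (lagrangian lambda) z = 0 &
                    dot (g z) lambda = 0]].

Definition dir_multipliers z u d : set 'rV[R]_p :=
  [set lambda | multipliers z lambda /\ dot lambda ('d g z (u, d)) = 0].

Definition lin_dirs z u : set 'rV[R]_m :=
  [set d | forall i, active g z i -> 'd g z (u, d) 0 i <= 0].

Definition crit (gamma : R) z u : set 'rV[R]_m :=
  [set d | [/\ (lower_dd (moreau gamma) z (u, d) <= ('d f z (u, d))%:E)%E,
               (('d f z (u, d))%:E <= upper_dd (moreau gamma) z (u, d))%E &
               lin_dirs z u d]].

(* Min and max over the (possibly empty or unbounded) multiplier set are taken
   in the extended reals. *)
Definition tcrit z u : set 'rV[R]_m :=
  [set d |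
    [/\ (ereal_inf [set (dot (gradx (lagrangian lambda) z) u)%:E
                    | lambda in multipliers z] <= ('d f z (u, d))%:E)%E,
        (('d f z (u, d))%:E <=
           ereal_sup [set (dot (gradx (lagrangian lambda) z) u)%:E
                      | lambda in multipliers z])%E &
        lin_dirs z u d]].

Definition mult_grads z u d : set Z :=
  [set (gradx f z + jacTx g z lambda, 0) | lambda in dir_multipliers z u d].

Definition MSCQ z : Prop :=
  exists eps kappa : R, [/\ 0 < eps, 0 < kappa &
    forall z', pnorm (z' - z) < eps ->
      (pdist z' gph_feas <= (kappa * enorm (pospart (g z')))%:E)%E].

Definition robinson_stable z u : Prop :=
  exists kappa eps delta : R, [/\ 0 < kappa, 0 < eps, 0 < delta &
    forall h y, dir_nbhd enorm eps delta u h -> enorm (y - z.2) < eps ->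
      (dist y (feas (z.1 + h)) <=
         (kappa * enorm (pospart (g (z.1 + h, y))))%:E)%E].

Definition RCR z : Prop :=
  exists2 delta : R, 0 < delta &
    forall K : {set 'I_p}, (forall j, j \in K -> active g z j) ->
    forall z1 z2, pnorm (z1 - z) < delta -> pnorm (z2 - z) < delta ->
      \dim <<[seq grady (component g j) z1 | j in K]>>%VS =
      \dim <<[seq grady (component g j) z2 | j in K]>>%VS.

Definition MFCQ z : Prop :=
  forall lambda, jacTy g z lambda = 0 -> nonneg lambda ->
    dot lambda (g z) = 0 -> lambda = 0.

Definition FOSCMS z (xi : 'rV[R]_p) : Prop :=
  forall lambda, jacTy g z lambda = 0 -> nonneg lambda ->
    dot lambda (g z) = 0 -> dot lambda xi = 0 -> lambda = 0.

(* Inner calmness* at the point ((x, y), y). *)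
Definition inner_calm_star (gamma : R) z (dz : Z) : Prop :=
  exists2 kappa : R, 0 < kappa &
    forall (t : nat -> R) (d_ : nat -> Z), tends0 t -> d_ @ \oo --> dz ->
    exists (K : set nat) (w : nat -> 'rV[R]_m), infinite_set K /\
      forall k, K k ->
        Sgamma gamma (z + t k *: d_ k) (w k) /\
        enorm (w k - z.2) <= kappa * pnorm (z + t k *: d_ k - z).

End LowerLevel.

Section QuasiNormality.
Context {R : realType} {n m p q : nat}.
Local Notation Z := ('rV[R]_n * 'rV[R]_m)%type.
Variables (f : Z -> R) (g : Z -> 'rV[R]_p) (G : Z -> 'rV[R]_q) (gamma : R).
Implicit Types (z dz : Z) (A : set Z).

Definition VP_feasible z : Prop :=
  [/\ ((f z)%:E - moreau f g gamma z <= 0)%E, nonpos (g z) & nonpos (G z)].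

(* The scaled set alpha A is read as {0} for alpha = 0, also when A is empty:
   the condition on multipliers with alpha = 0 does not involve A. *)
Definition scale_set (alpha : R) A : set Z :=
  if alpha == 0 then [set 0] else [set alpha *: a | a in A].

Definition condQ z dz A : Prop :=
  ~ exists (alpha : R) (nug : 'rV[R]_p) (nuG : 'rV[R]_q),
    [/\ [/\ (alpha, nug, nuG) != 0, 0 <= alpha, nonneg nug & nonneg nuG],
        exists2 a, scale_set alpha A a &
          0 = alpha *: grad f z - a + jacT g z nug + jacT G z nuG,
        [/\ dot nug (g z) = 0, dot nug ('d g z dz) = 0,
            dot nuG (G z) = 0 & dot nuG ('d G z dz) = 0],
        exists2 eta, graph_deriv (moreau f g gamma) z dz eta &
          alpha * ('d f z dz - eta) = 0 &
        exists (t : nat -> R) (d_ : nat -> Z),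
          [/\ tends0 t, d_ @ \oo --> dz &
            forall k, let zk := z + t k *: d_ k in
            [/\ 0 < alpha ->
                  (0 < alpha%:E * ((f zk)%:E - moreau f g gamma zk))%E,
                forall i, 0 < nug 0 i -> active g z i -> 0 < g zk 0 i &
                forall i, 0 < nuG 0 i -> active G z i -> 0 < G zk 0 i]]].

Definition dir_quasi_normality z dz : Prop :=
  condQ z dz (dir_subdiffc (moreau f g gamma) z dz) /\
  dir_lipschitz (moreau f g gamma) z dz.

End QuasiNormality.

(* Main.v *)
Require Import Defs.
From HB Require Import structures.
From mathcomp Require Import all_boot all_order all_algebra.
From mathcomp Require Import interval_inference.
From mathcomp Require Import boolp classical_sets cardinality reals ereal prodnormedzmodule.
From mathcomp Require Import topology normedtype sequences derive landau realfun convex.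
From mathcomp Require Import ring lra.

Set Implicit Arguments.
Unset Strict Implicit.
Unset Printing Implicit Defensive.

Import Order.TTheory GRing.Theory Num.Theory.
Import numFieldNormedType.Exports.

Local Open Scope classical_set_scope.
Local Open Scope ring_scope.


(** Writing z for the reference point and v for the Moreau envelope, each case
    amounts to two facts: v is Lipschitz on a directional neighborhood, and every
    element of the directional subdifferential of v lies in the set A of the
    hypothesis. A larger set makes the multiplier condition stronger
    ([condQ_sub]), and the convex hull is harmless because A is convex or is
    itself a convex hull.

    In the cases (i) and (iii) the lower level is weakly convex in y, with
    1 / gamma above its modulus. Feasibility of z says that y itself is the
    minimizer in the definition of v at z; by strong convexity the minimizers at
    nearby points of the cone around u are unique and close to y
    ([Sgamma_localized]). An error bound for the constraints in the direction u,
    which follows from Robinson stability or from MFCQ, makes v Lipschitz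
    ([env_dir_lipschitz]) and gives bounded multipliers for the regular
    subgradients at nearby points ([frechet_subdiff_multipliers]). Their limits
    are multipliers lam of the reference problem which represent the subgradient.
    It remains to find a direction d with lam complementary to the derivative of
    g along (u, d). Each active constraint has a nonvanishing partial gradient in
    y at z or a partial gradient that vanishes around z. In both situations
    quasi-convexity gives the first-order comparison of values that joint
    convexity would give ([comparable_from_nearby],
    [comparable_from_reference]). Hence the value along the sequence is, to first
    order, at most the slope of the Lagrangian in u for lam and at least the slope
    for every other multiplier. So lam maximizes this slope, and linear
    programming duality yields d ([dir_subdiff_multiplier]). This d satisfies the
    inequalities defining the extended critical set for u, which settles (i). The
    second alternative in (i) implies MFCQ: the slope of a multiplier along
    (u, v') does not depend on v', and it is nonpositive and nonnegative, so that
    the directional condition applies ([FOSCMS_MFCQ]). In (iii) the given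
    critical d is compared with the direction just found: v grows along (u, d) at
    most as fast as f along that direction ([upper_dd_le]), which forces
    complementarity of lam with d as well.

    In the case (ii) the function f is jointly weakly convex on the convex graph
    of the feasible set mapping. The envelope is then semiconvex near z
    ([env_semiconvex]), hence Lipschitz, and a limiting subgradient xi gives a
    quadratic minorant of v. As f majorizes v on the graph and equals it at z, the
    function f - <xi, .> is stationary at z on the graph, and MSCQ provides
    multipliers ([env_subgradient_multiplier]). For alpha > 0 the derivative of f
    along (u, v) is an element eta of the graphical derivative of the envelope,
    and semiconvexity gives <xi, (u, v)> = eta
    ([semiconvex_graph_deriv]): the multipliers are complementary to the
    derivative of g along (u, v). *)

(** * Farkas lemma and multipliers of exact penalties *)

Section Farkas.
Context {R : realFieldType}.

Lemma scalar_fun0 (V : lmodType R) (h : V -> R) : scalar h -> h 0 = 0.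
Proof. by move=> lh; have := lh 1 0 0; rewrite scaler0 addr0 /=; lra. Qed.

Lemma scalar_funZ (V : lmodType R) (h : V -> R) : scalar h ->
  forall a x, h (a *: x) = a * h x.
Proof. by move=> lh a x; rewrite -[a *: x]addr0 (lh a) /= scalar_fun0 // addr0. Qed.

(** Induction on the number of functionals. If the last functional [b] matters,
    some [x1] has [b x1 = 1] and [c x1 > 0] while all the others are nonpositive;
    projecting along [x1] onto the kernel of [b] removes it, and its multiplier
    is what is left to pay at [x1]. *)
Lemma farkas (V : lmodType R) (k : nat) (al : 'I_k -> V -> R) (c : V -> R) :
  (forall i, scalar (al i)) -> scalar c ->
  (forall x, (forall i, al i x <= 0) -> c x <= 0) ->
  exists2 lam : 'I_k -> R, (forall i, 0 <= lam i) &
    forall x, c x = \sum_i lam i * al i x.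
Proof.
elim: k => [|k IH] in al c *.
  move=> _ lc cle; have c0 x : c x <= 0 by apply: cle => -[].
  exists (fun=> 0) => // x; rewrite big_ord0.
  by have := c0 x; have := c0 (- 1 *: x); rewrite scalar_funZ //; lra.
move=> lal lc cle.
pose al' i := al (lift ord_max i); pose b := al ord_max.
have [H|] := pselect (forall x, (forall i, al' i x <= 0) -> c x <= 0).
  have [lam l0 lE] := IH al' c (fun i => lal _) lc H.
  exists (fun i => if unlift ord_max i is Some j then lam j else 0).
    by move=> i; case: unlift.
  move=> x; rewrite lE big_ord_recr /= unlift_none mul0r addr0.
  apply: eq_bigr => i _; have -> : widen_ord (leqnSn k) i = lift ord_max i.
    by apply/val_inj; rewrite /= /bump leqNgt ltn_ord.
  by rewrite liftK.
move=> /existsNP [x0 /not_implyP [ax0 /negP]]; rewrite -ltNge => cx0.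
have bx0 : 0 < b x0.
  rewrite ltNge; apply/negP => bx0; have : c x0 <= 0; last by lra.
  apply: cle => i; case: (unliftP ord_max i) => [j ->|->] //; exact: ax0.
pose x1 := (b x0)^-1 *: x0.
have bx1 : b x1 = 1 by rewrite /x1 scalar_funZ ?mulVf ?gt_eqF //; exact: lal.
have ax1 i : al' i x1 <= 0.
  by rewrite /x1 scalar_funZ ?pmulr_rle0 ?invr_gt0 //; exact: lal.
have cx1 : 0 < c x1 by rewrite /x1 scalar_funZ // mulr_gt0 ?invr_gt0.
pose al2 i x := al' i x - al' i x1 * b x.
pose c2 x := c x - c x1 * b x.
have l2 i : scalar (al2 i).
  by move=> a x y; rewrite /al2 /al' /b !(lal _ a) /=; ring.
have lc2 : scalar c2.
  by move=> a x y; rewrite /c2 /b (lc a) (lal _ a) /=; ring.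
have [|lam l0 lE] := IH al2 c2 l2 lc2.
  move=> x ax; pose y := x - b x *: x1.
  have yE h : scalar h -> h y = h x - b x * h x1.
    by move=> lh; rewrite /y [x - _]addrC -scaleNr (lh (- b x)) /=; ring.
  have by0 : b y = 0 by rewrite yE ?bx1 ?mulr1 ?subrr //; exact: lal.
  have : c y <= 0.
    apply: cle => i; case: (unliftP ord_max i) => [j ->|->]; last by rewrite -/b by0.
    have := ax j; rewrite /al2 /al' => H.
    by rewrite yE; [lra | exact: lal].
  by rewrite yE // /c2; lra.
exists (fun i => if unlift ord_max i is Some j then lam j else
    c x1 - \sum_j lam j * al' j x1).
  move=> i; case: unlift => // ; rewrite subr_ge0.
  apply: le_trans (ltW cx1); apply: sumr_le0 => j _.
  by rewrite mulr_ge0_le0.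
move=> x; rewrite big_ord_recr /= unlift_none.
under eq_bigr => i _.
  have -> : widen_ord (leqnSn k) i = lift ord_max i.
    by apply/val_inj; rewrite /= /bump leqNgt ltn_ord.
  rewrite liftK -/(al' i); over.
have -> : c x = c2 x + c x1 * b x by rewrite /c2 subrK.
rewrite lE (eq_bigr (fun i => lam i * al' i x - lam i * al' i x1 * b x)).
  by rewrite sumrB -mulr_suml -/b; ring.
by move=> i _; rewrite /al2; ring.
Qed.

(** The multiplier rule for an exact penalty: slack variables turn the positive
    parts into linear constraints, and the multipliers of [a <= s] and [0 <= s]
    add up to the penalty constant, which bounds them. *)
Lemma penalty_multipliers (V : lmodType R) (k : nat) (al : 'I_k -> V -> R)
    (c : V -> R) (M : R) :
  (forall i, scalar (al i)) -> scalar c -> 0 <= M ->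
  (forall x, 0 <= c x + M * \sum_i Num.max (al i x) 0) ->
  exists2 lam : 'I_k -> R, (forall i, 0 <= lam i <= M) &
    forall x, c x + \sum_i lam i * al i x = 0.
Proof.
move=> lal lc M0 H.
pose be (i : 'I_(k + k)) (z : V * 'rV[R]_k) :=
  match split i with inl j => al j z.1 - z.2 0 j | inr j => - z.2 0 j end.
pose c' (z : V * 'rV[R]_k) := - c z.1 - M * \sum_i z.2 0 i.
have [||x xle|nu nu0 nuE] := @farkas _ _ be c'.
- move=> i a x y; rewrite /be; case: split => j /=; rewrite !mxE ?(lal _ a) /=; ring.
- move=> a x y; rewrite /c' /= (lc a) /=.
  under eq_bigr do rewrite !mxE.
  by rewrite big_split /= -mulr_sumr; ring.
- have le_s : \sum_i Num.max (al i x.1) 0 <= \sum_i x.2 0 i.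
    apply: ler_sum => i _.
    have := xle (lshift _ i); have := xle (rshift _ i).
    rewrite /be (unsplitK (inr i)) (unsplitK (inl i)) => h1 h2.
    by rewrite ge_max; apply/andP; split; lra.
  by have := H x.1; have := ler_wpM2l M0 le_s; rewrite /c'; lra.
have nuE' x (s : 'rV[R]_k) : - c x - M * \sum_i s 0 i =
    \sum_i (nu (lshift k i) * al i x) -
    \sum_i (nu (lshift k i) + nu (rshift k i)) * s 0 i.
  have := nuE (x, s); rewrite /c' /= big_split_ord /= => ->.
  under eq_bigr => i _ do rewrite /be (unsplitK (inl i)) /= mulrBr.
  under [X in _ + X = _]eq_bigr => i _ do rewrite /be (unsplitK (inr i)) /= mulrN.
  rewrite sumrB sumrN; under [in RHS]eq_bigr => i _ do over.
  under [X in _ = _ - X]eq_bigr => i _ do rewrite mulrDl.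
  by rewrite big_split /=; ring.
have nuM i : nu (lshift k i) + nu (rshift k i) = M.
  have := nuE' 0 (delta_mx 0 i); rewrite (scalar_fun0 lc).
  have -> : \sum_j nu (lshift k j) * al j 0 = 0.
    by apply: big1 => j _; rewrite (scalar_fun0 (lal j)) mulr0.
  have sumE (a : 'I_k -> R) : \sum_j a j * (delta_mx 0 i : 'rV[R]_k) 0 j = a i.
    rewrite (bigD1 i) //= mxE !eqxx big1 ?addr0 ?mulr1 // => j ji.
    by rewrite mxE (negbTE ji) andbF mulr0.
  rewrite sumE; have := sumE (fun=> 1); under eq_bigr do rewrite mul1r.
  by move=> ->; lra.
exists (fun i => nu (lshift k i)).
  by move=> i; rewrite nu0 /= -(nuM i) lerDl.
move=> x; have := nuE' x 0.
rewrite big1 => [|i _]; last by rewrite mxE.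
rewrite [X in _ = _ - X]big1 => [|i _]; last by rewrite mxE mulr0.
by lra.
Qed.

End Farkas.

(** * Euclidean norms *)

Section EuclideanNorms.
Context {R : realType}.

Lemma dot_scalarl k (b : 'rV[R]_k) : scalar (fun a => dot a b).
Proof.
move=> c x y /=; rewrite /dot mulr_sumr -big_split /=.
by apply: eq_bigr => i _; rewrite !mxE; ring.
Qed.

Lemma dotC k (a b : 'rV[R]_k) : dot a b = dot b a.
Proof. by apply: eq_bigr => i _; rewrite mulrC. Qed.

Lemma dotDl k (a b c : 'rV[R]_k) : dot (a + b) c = dot a c + dot b c.
Proof. by rewrite -[a]scale1r (dot_scalarl c 1) /= mul1r scale1r. Qed.

Lemma dotZl k x (a b : 'rV[R]_k) : dot (x *: a) b = x * dot a b.
Proof. exact: (scalar_funZ (dot_scalarl b) x a). Qed.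

Lemma dotNl k (a b : 'rV[R]_k) : dot (- a) b = - dot a b.
Proof. by rewrite -scaleN1r dotZl mulN1r. Qed.

Lemma dotBl k (a b c : 'rV[R]_k) : dot (a - b) c = dot a c - dot b c.
Proof. by rewrite dotDl dotNl. Qed.

Lemma dotDr k (a b c : 'rV[R]_k) : dot c (a + b) = dot c a + dot c b.
Proof. by rewrite dotC dotDl !(dotC c). Qed.

Lemma dotZr k x (a b : 'rV[R]_k) : dot b (x *: a) = x * dot b a.
Proof. by rewrite dotC dotZl (dotC b). Qed.

Lemma dotNr k (a b : 'rV[R]_k) : dot a (- b) = - dot a b.
Proof. by rewrite dotC dotNl (dotC a). Qed.

Lemma dotBr k (a b c : 'rV[R]_k) : dot c (a - b) = dot c a - dot c b.
Proof. by rewrite dotDr dotNr. Qed.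

Lemma dot0l k (b : 'rV[R]_k) : dot 0 b = 0.
Proof. by rewrite -(scale0r 0) dotZl mul0r. Qed.

Lemma dot0r k (b : 'rV[R]_k) : dot b 0 = 0.
Proof. by rewrite dotC dot0l. Qed.

Lemma dot_delta k (a : 'rV[R]_k) i : dot a (delta_mx 0 i) = a 0 i.
Proof.
rewrite /dot (bigD1 i) //= mxE !eqxx mulr1 big1 ?addr0 // => j ji.
by rewrite mxE (negbTE ji) andbF mulr0.
Qed.

Lemma dot_suml (I : Type) (r : seq I) k (a : I -> 'rV[R]_k) b :
  dot (\sum_(i <- r) a i) b = \sum_(i <- r) dot (a i) b.
Proof.
elim: r => [|i r IH]; first by rewrite !big_nil dot0l.
by rewrite !big_cons dotDl IH.
Qed.

Lemma dotaa_ge0 k (a : 'rV[R]_k) : 0 <= dot a a.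
Proof. by apply: sumr_ge0 => i _; rewrite -expr2 sqr_ge0. Qed.

Lemma enorm_sqr k (a : 'rV[R]_k) : enorm a ^+ 2 = dot a a.
Proof. by rewrite sqr_sqrtr // dotaa_ge0. Qed.

Lemma enorm_ge0 k (a : 'rV[R]_k) : 0 <= enorm a.
Proof. exact: sqrtr_ge0. Qed.

Lemma enormZ k c (a : 'rV[R]_k) : enorm (c *: a) = `|c| * enorm a.
Proof.
by rewrite /enorm dotZl dotZr mulrA -expr2 sqrtrM ?sqr_ge0 // sqrtr_sqr.
Qed.

Lemma enormN k (a : 'rV[R]_k) : enorm (- a) = enorm a.
Proof. by rewrite -scaleN1r enormZ normrN1 mul1r. Qed.

Lemma coord_le_norm k (a : 'rV[R]_k) i : `|a 0 i| <= `|a|.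
Proof.
rewrite [leRHS]/Num.Def.normr /= mx_normrE.
by apply/bigmax_geP; right => /=; exists (0, i).
Qed.

Lemma norm_leP k (a : 'rV[R]_k) r : 0 <= r ->
  (forall i, `|a 0 i| <= r) -> `|a| <= r.
Proof.
move=> r0 ar; rewrite [leLHS]/Num.Def.normr /= mx_normrE.
by apply/bigmax_leP; split => // -[i j] _; rewrite ord1.
Qed.

Lemma sqr_enorm_gt0 k (a : 'rV[R]_k) : a != 0 -> 0 < dot a a.
Proof.
move=> a0; rewrite lt_neqAle dotaa_ge0 andbT eq_sym; apply: contraNneq a0 => /eqP H.
apply/eqP/rowP => i; rewrite mxE; apply/eqP; rewrite -sqrf_eq0 expr2.
move: H; rewrite psumr_eq0 => [/allP /(_ i)|j _]; last by rewrite -expr2 sqr_ge0.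
by apply; rewrite mem_index_enum.
Qed.

Lemma dot_le k (a b : 'rV[R]_k) : `|dot a b| <= k%:R * `|a| * `|b|.
Proof.
apply: le_trans (ler_norm_sum _ _ _) _.
apply: le_trans (_ : \sum_(i < k) `|a| * `|b| <= _).
  by apply: ler_sum => i _; rewrite normrM ler_pM // coord_le_norm.
by rewrite sumr_const card_ord -mulrA mulr_natl.
Qed.

Lemma norm_le_enorm k (a : 'rV[R]_k) : `|a| <= enorm a.
Proof.
apply: norm_leP => [|i]; first exact: enorm_ge0.
rewrite -sqrtr_sqr ler_wsqrtr // /dot (bigD1 i) //= -expr2 lerDl.
by apply: sumr_ge0 => j _; rewrite -expr2 sqr_ge0.
Qed.

Lemma enorm_le_norm k (a : 'rV[R]_k) : enorm a <= k.+1%:R * `|a|.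
Proof.
rewrite -[leRHS]ger0_norm ?mulr_ge0 // -sqrtr_sqr ler_wsqrtr //.
apply: le_trans (ler_norm _) _; apply: le_trans (dot_le _ _) _.
rewrite exprMn -mulrA -expr2 ler_wpM2r ?sqr_ge0 // -natr1 sqrrD.
by rewrite !expr2; have := ler0n R k; nra.
Qed.

Lemma cauchy_schwarz k (a b : 'rV[R]_k) : dot a b <= enorm a * enorm b.
Proof.
have [->|b0] := eqVneq b 0; first by rewrite dot0r mulr_ge0 // enorm_ge0.
have bb := sqr_enorm_gt0 b0.
apply: le_trans (ler_norm _) _.
rewrite -sqrtrM ?dotaa_ge0 // -[leLHS]sqrtr_sqr ler_wsqrtr //.
have := dotaa_ge0 (dot b b *: a - dot a b *: b).
rewrite !(dotBl, dotBr, dotZl, dotZr) (dotC b a) => H.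
rewrite -(ler_pM2l bb); rewrite -subr_ge0; apply: le_trans H _.
by rewrite le_eqVlt; apply/orP; left; apply/eqP; ring.
Qed.

Lemma enormD k (a b : 'rV[R]_k) : enorm (a + b) <= enorm a + enorm b.
Proof.
rewrite -(ler_pXn2r (isT : (0 < 2)%N)) ?nnegrE ?addr_ge0 ?enorm_ge0 //.
rewrite enorm_sqr sqrrD !enorm_sqr !(dotDl, dotDr) (dotC b a).
by have := cauchy_schwarz a b; lra.
Qed.

Lemma enormB_dist k (a b : 'rV[R]_k) : `|enorm a - enorm b| <= enorm (a - b).
Proof.
rewrite ler_norml; apply/andP; split.
  by have := enormD a (b - a); rewrite addrC subrK -(enormN (b - a)) opprB; lra.
by have := enormD b (a - b); rewrite addrC subrK; lra.
Qed.

Lemma dot_le_enorm k (a b : 'rV[R]_k) : `|dot a b| <= enorm a * enorm b.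
Proof.
rewrite ler_norml cauchy_schwarz andbT lerNl -dotNl -(enormN a).
exact: cauchy_schwarz.
Qed.

Lemma enorm_row_eq0 k (a : 'rV[R]_k) : enorm a = 0 -> a = 0.
Proof. by move=> a0; apply/eqP; rewrite -normr_le0 -a0 norm_le_enorm. Qed.

Section pair.
Context {n m : nat}.
Implicit Types (z w : 'rV[R]_n * 'rV[R]_m).

Lemma pdotE z w : pdot z w = dot (row_mx z.1 z.2) (row_mx w.1 w.2).
Proof.
rewrite /dot big_split_ord /=; congr (_ + _); apply: eq_bigr => i _.
  by rewrite !row_mxEl.
by rewrite !row_mxEr.
Qed.

Lemma pnormE z : pnorm z = enorm (row_mx z.1 z.2).
Proof. by rewrite /pnorm pdotE. Qed.

Lemma pdotC z w : pdot z w = pdot w z.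
Proof. by rewrite /pdot dotC (dotC z.2). Qed.

Lemma pdotDr z w w' : pdot z (w + w') = pdot z w + pdot z w'.
Proof. by rewrite /pdot !dotDr; ring. Qed.

Lemma pdotZr c z w : pdot z (c *: w) = c * pdot z w.
Proof. by rewrite /pdot !dotZr; ring. Qed.

Lemma pdotNr z w : pdot z (- w) = - pdot z w.
Proof. by rewrite /pdot !dotNr; ring. Qed.

Lemma pdotBr z w w' : pdot z (w - w') = pdot z w - pdot z w'.
Proof. by rewrite pdotDr pdotNr. Qed.

Lemma pdotBl z w w' : pdot (w - w') z = pdot w z - pdot w' z.
Proof. by rewrite pdotC pdotBr !(pdotC z). Qed.

Lemma pdot0r z : pdot z 0 = 0.
Proof. by rewrite /pdot !dot0r addr0. Qed.

Lemma pdot_scalar w : scalar (pdot w).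
Proof. by move=> c x y /=; rewrite pdotDr pdotZr. Qed.

Lemma pdot_le z w : `|pdot z w| <= pnorm z * pnorm w.
Proof. by rewrite pdotE !pnormE dot_le_enorm. Qed.

Lemma pnorm_ge0 z : 0 <= pnorm z.
Proof. exact: sqrtr_ge0. Qed.

Lemma pnorm_sqr z : pnorm z ^+ 2 = enorm z.1 ^+ 2 + enorm z.2 ^+ 2.
Proof. by rewrite sqr_sqrtr ?enorm_sqr // addr_ge0 // dotaa_ge0. Qed.

Lemma enorm_fst z : enorm z.1 <= pnorm z.
Proof. by rewrite ler_wsqrtr // lerDl dotaa_ge0. Qed.

Lemma enorm_snd z : enorm z.2 <= pnorm z.
Proof. by rewrite ler_wsqrtr // lerDr dotaa_ge0. Qed.

Lemma pnorm_le_add z : pnorm z <= enorm z.1 + enorm z.2.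
Proof.
rewrite -(ler_pXn2r (isT : (0 < 2)%N)) ?nnegrE ?addr_ge0 ?enorm_ge0 ?pnorm_ge0 //.
by rewrite pnorm_sqr sqrrD lerD2r lerDl mulrn_wge0 // mulr_ge0 ?enorm_ge0.
Qed.

Lemma pnormZ c z : pnorm (c *: z) = `|c| * pnorm z.
Proof. by rewrite !pnormE -enormZ -scale_row_mx. Qed.

Lemma pnormN z : pnorm (- z) = pnorm z.
Proof. by rewrite -scaleN1r pnormZ normrN1 mul1r. Qed.

Lemma pnormB z w : pnorm (z - w) = pnorm (w - z).
Proof. by rewrite -pnormN opprB. Qed.

Lemma pnormD z w : pnorm (z + w) <= pnorm z + pnorm w.
Proof. by rewrite !pnormE -add_row_mx enormD. Qed.

Lemma pnorm0 : pnorm (0 : 'rV[R]_n * 'rV[R]_m) = 0.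
Proof. by rewrite -(scale0r 0) pnormZ normr0 mul0r. Qed.

Lemma pnorm_fst0 (a : 'rV[R]_n) : pnorm (a, 0 : 'rV[R]_m) = enorm a.
Proof. by rewrite /pnorm /pdot /= dot0l addr0. Qed.

Lemma pnorm_snd0 (b : 'rV[R]_m) : pnorm (0 : 'rV[R]_n, b) = enorm b.
Proof. by rewrite /pnorm /pdot /= dot0l add0r. Qed.

End pair.

Lemma enormB k (a b : 'rV[R]_k) : enorm (a - b) = enorm (b - a).
Proof. by rewrite -enormN opprB. Qed.

Lemma enorm0 k : enorm (0 : 'rV[R]_k) = 0.
Proof. by rewrite -(scale0r 0) enormZ normr0 mul0r. Qed.

Lemma near_enormP k (y : 'rV[R]_k) (P : set 'rV[R]_k) :
  (\forall w \near y, P w) <->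
  exists2 r : R, 0 < r & forall w, enorm (w - y) < r -> P w.
Proof.
split.
  move=> /nbhs_ballP [r r0 H]; exists r => // w wr; apply: H.
  by rewrite -ball_normE /= distrC (le_lt_trans (norm_le_enorm _)).
move=> [r r0 H]; apply/nbhs_ballP; exists (r / k.+1%:R); first by rewrite /= divr_gt0.
move=> w; rewrite -ball_normE /= ltr_pdivlMr // mulrC distrC => wr.
by apply: H; rewrite (le_lt_trans (enorm_le_norm _)).
Qed.

Lemma near_pnormP n m (z : 'rV[R]_n * 'rV[R]_m) (P : set ('rV[R]_n * 'rV[R]_m)) :
  (\forall w \near z, P w) <->
  exists2 r : R, 0 < r & forall w, pnorm (w - z) < r -> P w.
Proof.
split.
  case=> -[A B] /= [/near_enormP [r r0 Ar] /near_enormP [s s0 Bs]] AB.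
  exists (Num.min r s); first by rewrite lt_min r0.
  move=> w; rewrite lt_min => /andP[wr ws]; apply: AB; split.
    by apply: Ar; apply: le_lt_trans wr; exact: (enorm_fst (w - z)).
  by apply: Bs; apply: le_lt_trans ws; exact: (enorm_snd (w - z)).
move=> [r r0 H]; have r20 : 0 < r / 2 by rewrite divr_gt0.
exists ([set a | enorm (a - z.1) < r / 2], [set b | enorm (b - z.2) < r / 2]).
  by split => /=; apply/near_enormP; exists (r / 2).
move=> [a b] /= [ar br]; apply: H; apply: le_lt_trans (pnorm_le_add _) _.
by rewrite [ltRHS]splitr ltrD.
Qed.

Lemma near_pnorm_lt n m (z : 'rV[R]_n * 'rV[R]_m) (r : R) : 0 < r ->
  \forall w \near z, pnorm (w - z) < r.
Proof. by move=> r0; apply/near_pnormP; exists r. Qed.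

Lemma near_enorm_lt k (z : 'rV[R]_k) (r : R) : 0 < r ->
  \forall w \near z, enorm (w - z) < r.
Proof. by move=> r0; apply/near_enormP; exists r. Qed.

End EuclideanNorms.

(** * Continuous differentiability *)

Section Differentiability.
Context {R : realType} {n m : nat}.
Local Notation Z := ('rV[R]_n * 'rV[R]_m)%type.
Implicit Types (h : Z -> R) (z w a b : Z) (e r : R).

Lemma diff_grad h z w : 'd h z w = pdot (grad h z) w.
Proof.
have wE : w = \sum_j w.1 0 j *: ((delta_mx 0 j, 0) : Z) +
              \sum_j w.2 0 j *: ((0, delta_mx 0 j) : Z).
  have fstE k (F : 'I_k -> Z) : (\sum_j F j).1 = \sum_j (F j).1.
    exact: (big_morph (fun x : Z => x.1)).
  have sndE k (F : 'I_k -> Z) : (\sum_j F j).2 = \sum_j (F j).2.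
    exact: (big_morph (fun x : Z => x.2)).
  case: w => a b /=; congr (_, _).
    rewrite fstE [X in _ = X](_ : _ = \sum_j a 0 j *: delta_mx 0 j + 0).
      by rewrite addr0 -row_sum_delta.
    congr (_ + _); rewrite fstE big1 // => j _ /=; exact: scaler0.
  rewrite sndE [X in _ = X](_ : _ = 0 + \sum_j b 0 j *: delta_mx 0 j).
    by rewrite add0r -row_sum_delta.
  congr (_ + _); last by rewrite sndE.
  by rewrite big1 // => j _ /=; exact: scaler0.
rewrite {1}wE linearD !linear_sum /pdot /dot /=; congr (_ + _).
  by apply: eq_bigr => j _; rewrite linearZ /= mxE mulrC.
by apply: eq_bigr => j _; rewrite linearZ /= mxE mulrC.
Qed.

Lemma norm_le_pnorm (z : (Z : normedModType R)) : `|z| <= pnorm z.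
Proof.
rewrite prod_normE ge_max !(le_trans (norm_le_enorm _)) //.
  exact: enorm_snd.
exact: enorm_fst.
Qed.

Lemma diff_eps h z : differentiable h z -> forall e, 0 < e ->
  exists2 r : R, 0 < r & forall w, pnorm (w - z) < r ->
    `|h w - h z - pdot (grad h z) (w - z)| <= e * pnorm (w - z).
Proof.
move=> /diff_locally /eqaddoP dh e e0.
have /near_pnormP [r r0 H] := dh e e0; exists r => // w wr.
have := H (w - z); rewrite subr0 => /(_ wr).
rewrite [X in `|X|](_ : _ = h (w - z + z) - (h z + 'd h z (w - z))) //.
rewrite subrK opprD addrA diff_grad => /le_trans; apply.
by apply: ler_wpM2l; [exact: ltW | exact: (norm_le_pnorm (w - z))].
Qed.

Lemma gradxE h w j : gradx h w 0 j = 'd h w (delta_mx 0 j, 0).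
Proof. by rewrite mxE. Qed.

Lemma gradyE h w j : grady h w 0 j = 'd h w (0, delta_mx 0 j).
Proof. by rewrite mxE. Qed.

Lemma fstB z w : (z - w).1 = z.1 - w.1.
Proof. by []. Qed.

Lemma sndB z w : (z - w).2 = z.2 - w.2.
Proof. by []. Qed.

(** The gradient has finitely many components, so that its continuity follows
    from the continuity of the derivative in each fixed direction. *)
Lemma grad_map_cont (D : Z -> Z -> R) (gr : Z -> Z) z :
  (forall w j, (gr w).1 0 j = D w (delta_mx 0 j, 0)) ->
  (forall w j, (gr w).2 0 j = D w (0, delta_mx 0 j)) ->
  (forall d, {for z, continuous (fun w => D w d)}) -> forall e, 0 < e ->
  exists2 r : R, 0 < r & forall w, pnorm (w - z) < r -> pnorm (gr w - gr z) < e.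
Proof.
move=> grx gry Dc e e0.
have e20 : 0 < e / 4 by rewrite divr_gt0.
pose ex := e / 4 / n.+1%:R; pose ey := e / 4 / m.+1%:R.
have ex0 : 0 < ex by rewrite divr_gt0.
have ey0 : 0 < ey by rewrite divr_gt0.
have near_dir (I : finType) (d : I -> Z) (eps : R) : 0 < eps ->
    \forall w \near z, forall j : I, `|D z (d j) - D w (d j)| < eps.
  move=> eps0; apply: (@filter_forall _ I
    (fun j w => `|D z (d j) - D w (d j)| < eps) _ (nbhs_filter _)) => j.
  by have /cvgrPdist_lt := Dc (d j); apply.
have Hx := near_dir 'I_n (fun j => (delta_mx 0 j, 0)) _ ex0.
have Hy := near_dir 'I_m (fun j => (0, delta_mx 0 j)) _ ey0.
have [r1 r10 H1] := (near_pnormP _ _).1 Hx.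
have [r2 r20 H2] := (near_pnormP _ _).1 Hy.
exists (Num.min r1 r2); first by rewrite lt_min r10.
move=> w; rewrite lt_min => /andP[/H1 wx /H2 wy].
apply: le_lt_trans (pnorm_le_add _) _.
apply: le_lt_trans (_ : e / 4 + e / 4 < e); last by lra.
have bound k (a : 'rV[R]_k) : (forall j, `|a 0 j| < e / 4 / k.+1%:R) ->
    enorm a <= e / 4.
  move=> H'; apply: le_trans (enorm_le_norm _) _.
  rewrite mulrC -ler_pdivlMr //; apply: norm_leP => [|j]; last exact: ltW.
  by rewrite divr_ge0 // divr_ge0 // ltW.
have subE k (a b : 'rV[R]_k) j : (a - b) 0 j = a 0 j - b 0 j by rewrite !mxE.
rewrite fstB sndB.
by apply: lerD; apply: bound => j; rewrite subE ?grx ?gry distrC.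
Qed.

Lemma is_derive_line h (z d : Z) (s : R) : (forall w, differentiable h w) ->
  is_derive s 1 (fun t : R => h (z + t *: d)) (pdot (grad h (z + s *: d)) d).
Proof.
move=> dh.
have dl : is_diff s (fun t : R => (z + t *: d : (Z : normedModType R))) ( *:%R^~ d).
  apply: is_diff_eq (is_diffD (is_diff_cst z s) (is_diff_scalel s _)) _.
  by apply/funext => t; exact: add0r.
have dc : is_diff s (fun t : R => h (z + t *: d))
    ('d h (z + s *: d) \o ( *:%R^~ d)).
  exact: is_diff_comp dl (differentiableP (dh _)).
apply: DeriveDef; first by apply: diff_derivable.
by rewrite deriveE // diff_val /= scale1r diff_grad.
Qed.

(** Continuous differentiability with the gradient as a separate map [D], and
    with the derivative along lines that the mean value theorem uses. All the
    analysis below refers to [D] only. *)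
Definition smooth h (D : Z -> Z) : Prop :=
  [/\ forall z e, 0 < e -> exists2 r : R, 0 < r &
        forall w, pnorm (w - z) < r -> pnorm (D w - D z) < e,
      forall z e, 0 < e -> exists2 r : R, 0 < r &
        forall w, pnorm (w - z) < r ->
          `|h w - h z - pdot (D z) (w - z)| <= e * pnorm (w - z) &
      forall (z d : Z) (s : R),
        is_derive s 1 (fun t : R => h (z + t *: d)) (pdot (D (z + s *: d)) d)].

Lemma C1_smooth h : C1 h -> smooth h (grad h).
Proof.
move=> [dh hc]; split.
- move=> z; apply: (@grad_map_cont (fun w d => 'd h w d)) => [w j|w j|d].
  + exact: gradxE.
  + exact: gradyE.
  + exact: hc.
- by move=> z; exact: diff_eps.
- by move=> z d s; exact: is_derive_line.
Qed.

Section smooth.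
Variables (h : Z -> R) (D : Z -> Z).
Hypothesis hD : smooth h D.

Lemma smooth_grad z e : 0 < e -> exists2 r : R, 0 < r &
  forall w, pnorm (w - z) < r -> pnorm (D w - D z) < e.
Proof. by case: hD => H _ _; exact: H. Qed.

Lemma smooth_diff z e : 0 < e -> exists2 r : R, 0 < r &
  forall w, pnorm (w - z) < r ->
    `|h w - h z - pdot (D z) (w - z)| <= e * pnorm (w - z).
Proof. by case: hD => _ H _; exact: H. Qed.

Lemma smooth_line (z d : Z) (s : R) :
  is_derive s 1 (fun t : R => h (z + t *: d)) (pdot (D (z + s *: d)) d).
Proof. by case: hD. Qed.

Lemma smooth_mean_value (z d : Z) :
  exists2 s : R, 0 <= s <= 1 & h (z + d) - h z = pdot (D (z + s *: d)) d.
Proof.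
pose c := fun t : R => h (z + t *: d).
have cd (s : R) : is_derive s 1 c (pdot (D (z + s *: d)) d) by exact: smooth_line.
have [|s s01] := @MVT_segment R c (fun s => pdot (D (z + s *: d)) d) 0 1 ler01.
- apply: continuous_subspaceT => s.
  by apply: differentiable_continuous; apply/derivable1_diffP; have := cd s.
- rewrite /c scale1r scale0r addr0 subr0 mulr1 => ->; exists s => //.
Qed.

Lemma smooth_strict z e : 0 < e ->
  exists2 r : R, 0 < r & forall a b, pnorm (a - z) < r -> pnorm (b - z) < r ->
    `|h a - h b - pdot (D z) (a - b)| <= e * pnorm (a - b).
Proof.
move=> e0; have [r r0 H] := smooth_grad z e0.
exists r => // a b ar br.
have [s /andP[s0 s1]] := smooth_mean_value b (a - b).
rewrite [b + _]addrC subrK => ->; rewrite -pdotBl.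
apply: le_trans (pdot_le _ _) _; rewrite ler_wpM2r ?pnorm_ge0 // ltW //.
apply: H; have -> : b + s *: (a - b) - z = (1 - s) *: (b - z) + s *: (a - z).
  have -> : a - z = (a - b) + (b - z) by rewrite addrA subrK.
  rewrite addrAC; move: (a - b) (b - z) => c c'.
  by rewrite scalerBl scale1r scalerDr [s *: c + _]addrC addrA subrK.
apply: le_lt_trans (pnormD _ _) _; rewrite !pnormZ !ger0_norm ?subr_ge0 //.
have [->|s0'] := eqVneq s 0; first by rewrite mul0r addr0 subr0 mul1r.
have sp : 0 < s by rewrite lt_neqAle eq_sym s0'.
by nra.
Qed.

Lemma smooth_lipschitz z : exists2 r : R, 0 < r &
  exists2 L : R, 0 < L & forall a b, pnorm (a - z) < r -> pnorm (b - z) < r ->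
    `|h a - h b| <= L * pnorm (a - b).
Proof.
have [r r0 H] := smooth_strict z ltr01.
exists r => //; exists (1 + pnorm (D z)); first by rewrite ltr_pwDl ?pnorm_ge0.
move=> a b ar br; have Hab := H a b ar br; rewrite mulrDl.
have -> : h a - h b = h a - h b - pdot (D z) (a - b) + pdot (D z) (a - b).
  by rewrite subrK.
by apply: le_trans (ler_normD _ _) _; rewrite lerD // pdot_le.
Qed.

Lemma smooth_cont z e : 0 < e -> exists2 r : R, 0 < r &
  forall w, pnorm (w - z) < r -> `|h w - h z| < e.
Proof.
move=> e0; have [r r0 [L L0 H]] := smooth_lipschitz z.
exists (Num.min r (e / L)); first by rewrite lt_min r0 divr_gt0.
move=> w; rewrite lt_min => /andP[wr we].
apply: le_lt_trans (H _ _ wr _) _; first by rewrite subrr pnorm0.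
by rewrite mulrC -ltr_pdivlMr.
Qed.

End smooth.

Lemma component_diff p (g : Z -> 'rV[R]_p) i z : differentiable g z ->
  is_diff z (component g i) (fun d => ('d g z d : 'rV[R]_p) 0 i).
Proof.
move=> dg.
have @f : {linear 'rV[R]_p -> R}.
  by exists (fun N : 'rV[R]_p => N 0 i); do 2![eexists]; do ?[constructor];
     rewrite ?mxE// => ? *; rewrite ?mxE//; move=> ?; rewrite !mxE.
have fc : continuous f by exact: coord_continuous.
have df x : is_diff x f f.
  by apply: DiffDef; [exact: linear_differentiable | exact: diff_lin].
exact: is_diff_comp (differentiableP dg) (df _).
Qed.

Lemma component_diffE p (g : Z -> 'rV[R]_p) i d z : differentiable g z ->
  'd (component g i) z d = ('d g z d : 'rV[R]_p) 0 i.
Proof. by move=> dg; have [_ ->] := component_diff i dg. Qed.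

Lemma coord_cont p (Dg : Z -> 'rV[R]_p) i (Dc : Z -> R) :
  (forall w, Dc w = Dg w 0 i) -> continuous Dg -> continuous Dc.
Proof.
move=> E cg z; rewrite /continuous_at E (funext E).
exact: (cvg_comp _ _ (cg z) (@coord_continuous _ _ _ 0 i _)).
Qed.

Lemma component_C1 p (g : Z -> 'rV[R]_p) i : C1 g -> C1 (component g i).
Proof.
move=> [dg cg]; split=> [z|d]; first by have [] := component_diff i (dg z).
exact: (coord_cont (fun w => component_diffE i d (dg w)) (cg d)).
Qed.

End Differentiability.

(** * Finite families of constraints *)

Section FiniteFamilies.
Context {R : realType} {n m p : nat}.
Local Notation Z := ('rV[R]_n * 'rV[R]_m)%type.
Implicit Types (z w a b : Z) (e r : R).

Lemma common_radius k (P : 'I_k -> R -> Prop) :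
  (forall i r r', r' <= r -> P i r -> P i r') ->
  (forall i, exists2 r : R, 0 < r & P i r) ->
  exists2 r : R, 0 < r & forall i, P i r.
Proof.
elim: k P => [|k IH] P mono HP; first by exists 1 => // -[].
have [i r r' rr'|i|r r0 Hr] := IH (fun i => P (lift ord_max i)).
- exact: mono.
- exact: HP.
have [s s0 Hs] := HP ord_max.
exists (Num.min r s) => [|i]; first by rewrite lt_min r0.
case: (unliftP ord_max i) => [j ->|->].
  by apply: mono (Hr j); rewrite ge_min lexx.
by apply: mono Hs; rewrite ge_min lexx orbT.
Qed.

Variables (g : Z -> 'rV[R]_p) (Dg : 'I_p -> Z -> Z).
Hypothesis gD : forall i, smooth (component g i) (Dg i).

Lemma family_strict z e : 0 < e -> exists2 r : R, 0 < r & forall i a b,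
  pnorm (a - z) < r -> pnorm (b - z) < r ->
  `|g a 0 i - g b 0 i - pdot (Dg i z) (a - b)| <= e * pnorm (a - b).
Proof.
move=> e0; apply: (@common_radius _ (fun i r => forall a b,
  pnorm (a - z) < r -> pnorm (b - z) < r ->
  `|g a 0 i - g b 0 i - pdot (Dg i z) (a - b)| <= e * pnorm (a - b))).
  by move=> i r r' rr H a b /lt_le_trans /(_ rr) ? /lt_le_trans /(_ rr) ?; apply: H.
by move=> i; exact: (smooth_strict (gD i) z e0).
Qed.

Lemma family_lipschitz z : exists2 r : R, 0 < r &
  exists2 L : R, 0 < L & forall i a b, pnorm (a - z) < r -> pnorm (b - z) < r ->
    `|g a 0 i - g b 0 i| <= L * pnorm (a - b).
Proof.
have [r r0 H] := family_strict z ltr01; exists r => //.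
exists (1 + \sum_i pnorm (Dg i z)).
  by rewrite ltr_pwDl // sumr_ge0 // => i _; exact: pnorm_ge0.
move=> i a b ar br; have Hab := H i a b ar br; rewrite mulrDl.
have -> : g a 0 i - g b 0 i =
    g a 0 i - g b 0 i - pdot (Dg i z) (a - b) + pdot (Dg i z) (a - b).
  by rewrite subrK.
apply: le_trans (ler_normD _ _) _; apply: lerD => //.
apply: le_trans (pdot_le _ _) _; rewrite ler_wpM2r ?pnorm_ge0 //.
by rewrite (bigD1 i) //= lerDl sumr_ge0 // => j _; exact: pnorm_ge0.
Qed.

Lemma family_diff z e : 0 < e -> exists2 r : R, 0 < r & forall i w,
  pnorm (w - z) < r ->
  `|g w 0 i - g z 0 i - pdot (Dg i z) (w - z)| <= e * pnorm (w - z).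
Proof.
move=> e0; have [r r0 H] := family_strict z e0; exists r => // i w wr.
by apply: H => //; rewrite subrr pnorm0.
Qed.

Lemma inactive_near z : exists2 r : R, 0 < r &
  forall i w, pnorm (w - z) < r -> g z 0 i < 0 -> g w 0 i < 0.
Proof.
apply: (@common_radius _ (fun i r => forall w,
  pnorm (w - z) < r -> g z 0 i < 0 -> g w 0 i < 0)).
  by move=> i r r' rr H a /lt_le_trans /(_ rr) ?; apply: H.
move=> i; have [gz|gz] := ltP (g z 0 i) 0; last by exists 1.
have gz' : 0 < - g z 0 i by rewrite oppr_gt0.
have [r r0 H] := smooth_cont (gD i) z gz'; exists r => // w /H.
by rewrite /component ltr_norml => /andP[_]; lra.
Qed.

(** The violation is measured by the [l1] norm of the positive part: as a sum it
    is the exact penalty to which the multiplier rule for positive parts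
    applies, and it dominates the Euclidean norm. *)
Definition gplus (z : Z) : R := \sum_i Num.max (g z 0 i) 0.

Lemma gplus_ge0 z : 0 <= gplus z.
Proof. by apply: sumr_ge0 => i _; rewrite le_max lexx orbT. Qed.

Lemma le_gplus z i : g z 0 i <= gplus z.
Proof.
rewrite /gplus (bigD1 i) //=; apply: le_trans (_ : Num.max (g z 0 i) 0 <= _).
  by rewrite le_max lexx.
by rewrite lerDl sumr_ge0 // => j _; rewrite le_max lexx orbT.
Qed.

Lemma gplus_lipschitz z : exists2 r : R, 0 < r & exists2 L : R, 0 < L &
  forall a b, pnorm (a - z) < r -> pnorm (b - z) < r -> nonpos (g b) ->
    gplus a <= L * pnorm (a - b).
Proof.
have [r r0 [L L0 H]] := family_lipschitz z; exists r => //.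
exists (p.+1%:R * L); first by rewrite mulr_gt0.
move=> a b ar br gb.
apply: le_trans (_ : \sum_(i < p) L * pnorm (a - b) <= _).
  apply: ler_sum => i _; rewrite ge_max mulr_ge0 ?pnorm_ge0 ?(ltW L0) // andbT.
  have := H i a b ar br; rewrite ler_norml => /andP[_]; have := gb i; lra.
rewrite sumr_const card_ord -mulrA -[X in X <= _]mulr_natl.
by rewrite ler_wpM2r ?mulr_ge0 ?pnorm_ge0 ?(ltW L0) // ler_nat.
Qed.

(** Inactive constraints are satisfied nearby and do not contribute to the
    first-order expansion. *)
Lemma gplus_expand z e : nonpos (g z) -> 0 < e ->
  exists2 r : R, 0 < r & forall w, pnorm (w - z) < r ->
  gplus w <= \sum_i Num.max (if g z 0 i == 0 then pdot (Dg i z) (w - z) else 0) 0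
             + e * pnorm (w - z).
Proof.
move=> gz e0; have [c e1 cE] : exists2 c : R, 0 < c & p%:R * c <= e.
  exists (e / p.+1%:R); first by rewrite divr_gt0.
  by rewrite mulrCA ler_piMr ?(ltW e0) // ler_pdivrMr // mul1r ler_nat.
have [r r0 H] := family_diff z e1; have [s s0 Hs] := inactive_near z.
exists (Num.min r s) => [|w]; first by rewrite lt_min r0.
rewrite lt_min => /andP[wr ws].
have pn := pnorm_ge0 (w - z).
apply: le_trans (_ : \sum_i (Num.max (if g z 0 i == 0
    then pdot (Dg i z) (w - z) else 0) 0 + c * pnorm (w - z)) <= _).
  apply: ler_sum => i _; have := H i w wr; have := Hs i w ws.
  have := mulr_ge0 (ltW e1) pn.
  have := gz i; case: eqVneq => [gi|gi].
    rewrite gi subr0 => _ h0 _; rewrite ler_norml => /andP[_ h1].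
    rewrite ge_max; apply/andP; split.
      apply: le_trans (_ : pdot (Dg i z) (w - z) + c * pnorm (w - z) <= _); first by lra.
      by rewrite lerD2r le_max lexx.
    by rewrite addr_ge0 // le_max lexx orbT.
  move=> gi' h0 /(_ _) h1 _; rewrite maxxx add0r.
  have : g w 0 i < 0 by apply: h1; rewrite lt_neqAle gi.
  by move=> h2; rewrite ge_max h0 andbT; lra.
rewrite big_split /= lerD2l sumr_const card_ord -[X in X <= _]mulr_natl.
by rewrite mulrA ler_wpM2r.
Qed.

End FiniteFamilies.

(** * Error bounds *)

Section ErrorBounds.
Context {R : realType} {n m p : nat}.
Local Notation Z := ('rV[R]_n * 'rV[R]_m)%type.
Implicit Types (z w : Z) (e r s : R) (x a u : 'rV[R]_n) (y b h : 'rV[R]_m).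
Variable (g : Z -> 'rV[R]_p).

Lemma enorm_le_sum k (a : 'rV[R]_k) : enorm a <= \sum_i `|a 0 i|.
Proof.
rewrite {1}(row_sum_delta a).
elim/big_ind2: _ => [|x1 x2 y1 y2 h1 h2|i _].
- by rewrite enorm0.
- by apply: le_trans (enormD _ _) _; exact: lerD.
- rewrite enormZ ler_piMr // /enorm dot_delta mxE !eqxx.
  by rewrite sqrtr1.
Qed.

Lemma enorm_pospart_le z : enorm (pospart (g z)) <= gplus g z.
Proof.
apply: le_trans (enorm_le_sum _) _; apply: ler_sum => i _.
by rewrite mxE ger0_norm // le_max lexx orbT.
Qed.

(** The factor [2] leaves room below the infimum when the violation is positive;
    otherwise the point itself is feasible and at distance [0]. *)
Lemma near_projection (V : zmodType) (N : V -> R) (D : set V) (v : V) z k :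
  N 0 = 0 -> 0 < k -> (nonpos (g z) -> D v) ->
  (ereal_inf [set (N (v - w))%:E | w in D] <=
     (k * enorm (pospart (g z)))%:E)%E ->
  exists2 w, D w & N (v - w) <= 2 * k * gplus g z.
Proof.
move=> N0 k0 gD H; have [g0|g0] := eqVneq (gplus g z) 0.
  exists v; last by rewrite subrr N0 g0 mulr0.
  by apply: gD => i; rewrite -g0 le_gplus.
have gp : 0 < gplus g z by rewrite lt_neqAle eq_sym g0 gplus_ge0.
have : (ereal_inf [set (N (v - w))%:E | w in D] < (2 * k * gplus g z)%:E)%E.
  apply: le_lt_trans H _; rewrite lte_fin.
  apply: le_lt_trans (_ : k * gplus g z < _).
    by rewrite ler_wpM2l ?(ltW k0) // enorm_pospart_le.
  by rewrite -mulrA ltr_pMl ?mulr_gt0 // ltr1n.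
move=> /ereal_inf_lt [_ [w Dw <-]]; rewrite lte_fin => /ltW Hw.
by exists w.
Qed.

(** The estimate that Robinson stability provides, on a cone of directions
    around [u] written as the points close to some nonnegative multiple. *)
Definition error_bound x y u : Prop :=
  exists k e d : R, [/\ 0 < k, 0 < e, 0 < d &
    forall a s b, enorm a < e -> 0 <= s -> enorm (a - s *: u) <= d * s ->
      enorm (b - y) < e ->
      exists2 w, feas g (x + a) w & enorm (w - b) <= k * gplus g (x + a, b)].

(** Closeness to the multiple [s u] controls [s] by the norm of [a]; this turns
    the cone into a directional neighborhood. *)
Lemma dir_nbhd_cone u e d : 0 < d -> exists2 d' : R, 0 < d' &
  forall a s, 0 <= s -> enorm (a - s *: u) <= d' * s -> enorm a < e ->
    dir_nbhd enorm e d u a.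
Proof.
move=> d0; have [u0|u0] := eqVneq u 0.
  exists 1 => // a s s0 _ ae; split => //.
  by rewrite u0 enorm0 scale0r scaler0 subrr enorm0 mulr0.
have un : 0 < enorm u by rewrite sqrtr_gt0 sqr_enorm_gt0.
exists (Num.min (enorm u / 2) (d * enorm u / 4)).
  by rewrite lt_min !divr_gt0 // mulr_gt0.
move=> a s s0 H ae; split => //.
have h1 : enorm (a - s *: u) <= enorm u / 2 * s.
  by apply: le_trans H _; rewrite ler_wpM2r // ge_min lexx.
have h2 : enorm (a - s *: u) <= d * enorm u / 4 * s.
  by apply: le_trans H _; rewrite ler_wpM2r // ge_min lexx orbT.
have h3 := enormB_dist a (s *: u).
rewrite enormZ (ger0_norm s0) ler_norml in h3; case/andP: h3 => h3 h4.
have -> : enorm u *: a - enorm a *: u =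
    enorm u *: (a - s *: u) + (s * enorm u - enorm a) *: u.
  by rewrite scalerBr scalerBl scalerA [enorm u * s]mulrC addrA subrK.
apply: le_trans (enormD _ _) _; rewrite !enormZ (ger0_norm (enorm_ge0 u)).
have h5 : `|s * enorm u - enorm a| <= enorm (a - s *: u).
  by rewrite ler_norml; apply/andP; split; lra.
have h6 : 2 * enorm u * enorm (a - s *: u) <= d * enorm a * enorm u.
  have h7 : s * enorm u / 2 <= enorm a by lra.
  have h8 : 2 * enorm (a - s *: u) <= d * enorm a.
    apply: le_trans (_ : d * (s * enorm u / 2) <= _); first by lra.
    by rewrite ler_wpM2l // ltW.
  by rewrite [2 * _ * _]mulrAC ler_wpM2r // ltW.
apply: le_trans h6.
have := ler_wpM2r (ltW un) h5; lra.
Qed.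

Lemma robinson_error_bound x y u : robinson_stable g (x, y) u -> error_bound x y u.
Proof.
move=> [k [e [d [k0 e0 d0 H]]]].
have [d' d'0 Hd] := dir_nbhd_cone u e d0.
exists (2 * k), e, d'; split => //; first by rewrite mulr_gt0.
move=> a s b ae s0 aus be.
have ab := H a b (Hd a s s0 aus ae) be.
have [w Fw Hw] := @near_projection _ (@enorm R m) (feas g (x + a)) b (x + a, b) k
  (enorm0 _) k0 id ab.
exists w => //.
by rewrite enormB.
Qed.

Lemma MSCQ_error_bound z : MSCQ g z ->
  exists2 k : R, 0 < k & exists2 r : R, 0 < r & forall w, pnorm (w - z) < r ->
    exists2 w', nonpos (g w') & pnorm (w' - w) <= k * gplus g w.
Proof.
move=> [e [k [e0 k0 H]]]; exists (2 * k); first by rewrite mulr_gt0.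
exists e => // w /H we.
have [w' gw' Hw] := @near_projection _ (@pnorm R n m) (gph_feas g) w w k
  pnorm0 k0 id we.
by exists w' => //; rewrite pnormB.
Qed.

Variable (Dg : 'I_p -> Z -> Z).
Hypothesis gD : forall i, smooth (component g i) (Dg i).

(** Gordan's alternative, from the Farkas lemma with one more variable that
    bounds the slopes of the active constraints from above. *)
Lemma MFCQ_descent_direction z :
  (forall lam : 'I_p -> R, (forall i, 0 <= lam i) ->
     (forall i, g z 0 i != 0 -> lam i = 0) ->
     (forall b, \sum_i lam i * dot (Dg i z).2 b = 0) ->
     forall i, lam i = 0) ->
  exists h, exists2 s : R, 0 < s &
    forall i, g z 0 i = 0 -> dot (Dg i z).2 h <= - s.
Proof.
move=> mfcq; pose V := ('rV[R]_m * R^o)%type.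
pose al i (v : V) : R := if g z 0 i == 0 then dot (Dg i z).2 v.1 + v.2 else 0.
have lal i : scalar (al i).
  move=> c v w; rewrite /al; case: ifP => _ /=; last by rewrite mulr0 addr0.
  by rewrite dotDr dotZr /GRing.scale /=; ring.
have lc : scalar (fun v : V => v.2 : R) by move=> c v w.
have [H|] := pselect (forall v : V, (forall i, al i v <= 0) -> v.2 <= 0).
  have [lam l0 lE] := farkas lal lc H.
  pose mu i := if g z 0 i == 0 then lam i else 0.
  have muE b (s : R) : s = \sum_i mu i * dot (Dg i z).2 b + s * \sum_i mu i.
    rewrite {1}(lE (b, s : R^o) : s = _) mulr_sumr -big_split /=.
    apply: eq_bigr => i _; rewrite /mu /al; case: ifP => _ /=; ring.
  have mu0 i : mu i = 0.
    apply: mfcq => [j|j|b]; rewrite ?/mu.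
    - by case: ifP.
    - by move=> /negbTE ->.
    - by have := muE b 0; rewrite mul0r addr0.
  have := muE 0 1; rewrite !big1 => [|i _|i _]; rewrite ?mu0 ?mul0r //.
  by move=> /eqP; rewrite mulr0 addr0 oner_eq0.
move=> /existsNP [[h s] /not_implyP [Hv /negP]]; rewrite -ltNge /= => s0.
exists h, s => // i gi; have := Hv i; rewrite /al gi eqxx /=; lra.
Qed.

(** Moving along a common descent direction by a multiple of the violation
    restores feasibility, for all parameters near the reference one. *)
Lemma MFCQ_error_bound x y u : nonpos (g (x, y)) ->
  (forall lam : 'I_p -> R, (forall i, 0 <= lam i) ->
     (forall i, g (x, y) 0 i != 0 -> lam i = 0) ->
     (forall b, \sum_i lam i * dot (Dg i (x, y)).2 b = 0) ->
     forall i, lam i = 0) ->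
  error_bound x y u.
Proof.
move=> gz /MFCQ_descent_direction [h [s s0 hs]].
have h1 : 0 < enorm h + 1 by rewrite ltr_wpDl ?enorm_ge0.
have [c c0 cE] : exists2 c : R, 0 < c & c * enorm h <= s / 2.
  exists (s / 2 / (enorm h + 1)); first by rewrite !divr_gt0.
  rewrite mulrAC ler_pdivrMr // ler_wpM2l ?divr_ge0 ?(ltW s0) //.
  by rewrite lerDl.
have [r1 r10 H1] := family_strict gD (x, y) c0.
have [r2 r20 H2] := inactive_near gD (x, y).
have [r3 r30 [L L0 H3]] := gplus_lipschitz gD (x, y).
pose r := Num.min r1 (Num.min r2 r3).
have r0 : 0 < r by rewrite !lt_min r10 r20.
have k0 : 0 < 2 / s by rewrite divr_gt0.
set q := 2 / s * L * (enorm h + 1).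
have q0 : 0 < q by rewrite !mulr_gt0 ?invr_gt0.
pose K := 2 + q * 2.
have K2 : 2 <= K by rewrite lerDl mulr_ge0 // ltW.
have K0 : 0 < K by apply: lt_le_trans K2.
exists (2 / s * (enorm h + 1)), (r / (2 * K)), 1.
split => //; first exact: mulr_gt0.
  by rewrite divr_gt0 // mulr_gt0.
move=> a t b ae _ _ be.
set z := (x + a, b); set t' := 2 / s * gplus g z.
have t0 : 0 <= t' by rewrite mulr_ge0 ?gplus_ge0 // ltW.
have zd : pnorm (z - (x, y)) <= r / K.
  apply: le_trans (pnorm_le_add _) _; rewrite /= addrAC subrr add0r.
  have -> : r / K = r / (2 * K) + r / (2 * K).
    by field; rewrite gt_eqF.
  by rewrite lerD // ltW.
have rK : r / K <= r / 2.
  by rewrite ler_wpM2l ?(ltW r0) // lef_pV2 ?posrE.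
have zr : pnorm (z - (x, y)) < r.
  apply: le_lt_trans zd _; apply: le_lt_trans rK _.
  by rewrite ltr_pdivrMr // ltr_pMr // ltr1n.
have gle : gplus g z <= L * pnorm (z - (x, y)).
  apply: H3 => //; last by rewrite subrr pnorm0.
  by apply: lt_le_trans zr _; rewrite !ge_min lexx !orbT.
pose z' : Z := (x + a, b + t' *: h).
have z'z : z' - z = (0, t' *: h).
  by rewrite /z' /z; congr (_, _) => /=; rewrite ?subrr // addrAC subrr add0r.
have z'r : pnorm (z' - (x, y)) < r.
  rewrite -(subrK z z') -addrA z'z.
  apply: le_lt_trans (pnormD _ _) _; rewrite pnorm_snd0 enormZ (ger0_norm t0).
  have tK : t' * enorm h <= q * (r / K).
    rewrite /t' /q -[leLHS]mulrA -[leRHS]mulrA -[leRHS]mulrA.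
    rewrite ler_wpM2l ?(ltW k0) //.
    apply: le_trans (_ : L * pnorm (z - (x, y)) * (enorm h + 1) <= _).
      by rewrite ler_pM ?gplus_ge0 ?enorm_ge0 // lerDl.
    rewrite -mulrA ler_wpM2l ?(ltW L0) // mulrC ler_wpM2l //.
    exact: ltW.
  have KE : K * (r / K) = r by rewrite mulrC divfK // gt_eqF.
  have rK0 : 0 < r / K by rewrite divr_gt0.
  move: KE; rewrite {1}/K mulrDl => KE.
  have : q * 2 * (r / K) = 2 * (q * (r / K)) by ring.
  have := mulr_ge0 t0 (enorm_ge0 h).
  lra.
exists (b + t' *: h); last first.
  rewrite addrAC subrr add0r enormZ (ger0_norm t0) /t'.
  by rewrite mulrAC ler_wpM2r ?gplus_ge0 // ler_wpM2l ?(ltW k0) // lerDl.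
move=> i; have [gi|gi] := eqVneq (g (x, y) 0 i) 0; last first.
  apply: ltW; apply: (H2 i z').
    by apply: lt_le_trans z'r _; rewrite !ge_min lexx !orbT.
  by rewrite lt_neqAle gi; exact: gz.
have := H1 i z' z; rewrite z'z pnorm_snd0 enormZ (ger0_norm t0).
have rr1 : r <= r1 by rewrite ge_min lexx.
move=> /(_ (lt_le_trans z'r rr1) (lt_le_trans zr rr1)).
rewrite /pdot dot0r add0r dotZr ler_norml => /andP[_ Hi].
have := ler_wpM2l t0 (hs i gi); have := ler_wpM2l t0 cE.
have tE : t' * (s / 2) = gplus g z.
  by rewrite /t'; field; rewrite gt_eqF.
have := le_gplus g z i; rewrite -/z'; lra.
Qed.

End ErrorBounds.

(** * Multiplier rule and Moreau envelope *)

Section MultiplierRule.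
Context {R : realType} {n m p : nat}.
Local Notation Z := ('rV[R]_n * 'rV[R]_m)%type.
Implicit Types (z w h : Z) (e r t : R).

Lemma small_step (r B : R) : 0 < r -> 0 <= B ->
  exists2 t : R, 0 < t <= 1 & t * B < r.
Proof.
move=> r0 B0; have B1 : 0 < B + 1 by rewrite ltr_wpDl.
have q0 : 0 < r / (B + 1) by rewrite divr_gt0.
exists (Num.min 1 (r / (B + 1))).
  by rewrite lt_min ltr01 q0 ge_min lexx.
apply: le_lt_trans (_ : r / (B + 1) * B < r).
  by rewrite ler_wpM2r // ge_min lexx orbT.
by rewrite mulrAC ltr_pdivrMr // ltr_pM2l // ltrDl.
Qed.

Lemma ge0_of_eps (A C : R) : 0 <= C ->
  (forall e, 0 < e <= 1 -> 0 <= A + e * C) -> 0 <= A.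
Proof.
move=> C0 H; rewrite leNgt; apply/negP => A0.
have A0' : 0 < - A by rewrite oppr_gt0.
by have [e e01 eC] := small_step A0' C0; have := H e e01; lra.
Qed.

Variables (g : Z -> 'rV[R]_p) (Dg : 'I_p -> Z -> Z).
Hypothesis gD : forall i, smooth (component g i) (Dg i).

(** Exact penalization: under an error bound with constant [k], a stationary
    point of an [L]-Lipschitz function over the constraint set is stationary
    for the function plus [L * k] times the violation, whence multipliers
    bounded by [L * k]. *)
Lemma bounded_multiplier_rule (Psi : Z -> R) (z q : Z) (L k : R) :
  0 <= L -> 0 <= k -> nonpos (g z) ->
  (forall e, 0 < e -> exists2 r : R, 0 < r & forall w, pnorm (w - z) < r ->
     `|Psi w - Psi z - pdot q (w - z)| <= e * pnorm (w - z)) ->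
  (exists2 r : R, 0 < r & forall a b : Z, pnorm (a - z) < r -> pnorm (b - z) < r ->
     `|Psi a - Psi b| <= L * pnorm (a - b)) ->
  (forall e, 0 < e -> exists2 r : R, 0 < r & forall w, nonpos (g w) ->
     pnorm (w - z) < r -> Psi z - e * pnorm (w - z) <= Psi w) ->
  (exists2 r : R, 0 < r & forall w, pnorm (w - z) < r ->
     exists2 w', nonpos (g w') & pnorm (w' - w) <= k * gplus g w) ->
  exists lam : 'I_p -> R, [/\ forall i, 0 <= lam i <= L * k,
    forall i, g z 0 i != 0 -> lam i = 0 &
    forall h, pdot q h + \sum_i lam i * pdot (Dg i z) h = 0].
Proof.
move=> L0 k0 gz dPsi [r1 r10 lipPsi] stat [r2 r20 eb].
pose al i h := if g z 0 i == 0 then pdot (Dg i z) h else 0.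
have lal i : scalar (al i).
  by move=> c a b; rewrite /al; case: ifP => _ /=; rewrite ?pdot_scalar ?mulr0 ?addr0.
have [h|lam lam0 lamE] := penalty_multipliers lal (pdot_scalar q) (mulr_ge0 L0 k0).
  set S := \sum_i Num.max (al i h) 0.
  have S0 : 0 <= S by apply: sumr_ge0 => i _; rewrite le_max lexx orbT.
  have N0 := pnorm_ge0 h; set N := pnorm h in N0.
  apply: (@ge0_of_eps _ (2 * N + L * k * N + k * S + k * N)).
    by rewrite !addr_ge0 ?mulr_ge0.
  move=> e /andP[e0 e1].
  have [s1 s10 H1] := dPsi e e0.
  have [s2 s20 H2] := stat e e0.
  have [s3 s30 H3] := gplus_expand gD gz e0.
  pose r := Num.min (Num.min r1 r2) (Num.min s1 (Num.min s2 s3)).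
  have r0 : 0 < r by rewrite !lt_min r10 r20 s10 s20.
  pose B := N + k * (S + N).
  have B0 : 0 <= B by rewrite !(addr_ge0, mulr_ge0).
  have [t /andP[t0 t1] tB] := small_step r0 B0.
  have NB : t * N <= t * B by rewrite ler_wpM2l ?(ltW t0) // lerDl mulr_ge0 ?addr_ge0.
  have rlt (x : R) : x < r -> [/\ x < r1, x < r2, x < s1, x < s2 & x < s3].
    by rewrite !lt_min => /andP[/andP[? ?] /and3P[? ? ?]].
  pose w := z + t *: h.
  have wz : w - z = t *: h by rewrite /w addrAC subrr add0r.
  have wn : pnorm (w - z) = t * N by rewrite wz pnormZ ger0_norm // ltW.
  have [wr1 wr2 ws1 ws2 ws3] := rlt _ (le_lt_trans NB tB); rewrite -wn in wr1 wr2 ws1 ws2 ws3.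
  have [w' gw' w'w] := eb w wr2.
  have gw : gplus g w <= t * (S + e * N).
    apply: le_trans (H3 w ws3) _; rewrite wn mulrDr mulrCA lerD2r mulr_sumr.
    apply: ler_sum => i _; rewrite wz /al; case: ifP => _.
      by rewrite pdotZr -{1}(mulr0 t) -maxr_pMr // ltW.
    by rewrite maxxx mulr0.
  have w'w2 : pnorm (w' - w) <= k * (t * (S + e * N)).
    by apply: le_trans w'w _; rewrite ler_wpM2l.
  have w'z : pnorm (w' - z) <= t * N + k * (t * (S + e * N)).
    by have := pnormD (w' - w) (w - z); rewrite addrA subrK wn; lra.
  have w'B : pnorm (w' - z) <= t * B.
    apply: le_trans w'z _; rewrite /B [t * (N + _)]mulrDr lerD2l mulrCA ler_wpM2l ?(ltW t0) //.
    by rewrite ler_wpM2l // lerD2l ler_piMl.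
  have [vr1 vr2 vs1 vs2 vs3] := rlt _ (le_lt_trans w'B tB).
  have := H2 w' gw' vs2; have := lipPsi w' w vr1 wr1; have := H1 w ws1.
  rewrite !ler_norml => /andP[_ K1] /andP[_ K2] K3.
  rewrite wz pdotZr -wz wn in K1.
  have K4 := ler_wpM2l L0 w'w2; have K5 := ler_wpM2l (ltW e0) w'z.
  have K6 : e * (k * (t * (S + e * N))) <= e * (k * (t * (S + N))).
    rewrite ler_wpM2l ?(ltW e0) // ler_wpM2l // ler_wpM2l ?(ltW t0) //.
    by rewrite lerD2l ler_piMl.
  rewrite -(pmulr_rge0 _ t0); lra.
exists (fun i => if g z 0 i == 0 then lam i else 0); split.
- by move=> i; case: ifP => // _; rewrite lexx mulr_ge0.
- by move=> i /negbTE ->.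
- move=> h; rewrite -[RHS](lamE h); congr (_ + _); apply: eq_bigr => i _.
  by rewrite /al; case: ifP => _; rewrite ?mul0r ?mulr0.
Qed.

End MultiplierRule.

Section Envelope.
Context {R : realType} {n m p : nat}.
Local Notation Z := ('rV[R]_n * 'rV[R]_m)%type.
Implicit Types (z : Z) (e r t : R) (x : 'rV[R]_n) (y w b : 'rV[R]_m).
Variables (f : Z -> R) (g : Z -> 'rV[R]_p) (gamma : R).
Local Notation phi := (moreau_obj f gamma).

Lemma enorm_sqrD k (a b : 'rV[R]_k) :
  enorm (a + b) ^+ 2 = enorm a ^+ 2 + 2 * dot a b + enorm b ^+ 2.
Proof. by rewrite !enorm_sqr !(dotDl, dotDr) (dotC b a); ring. Qed.

Lemma enorm_conv k (a b : 'rV[R]_k) (t : R) :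
  enorm (t *: a + (1 - t) *: b) ^+ 2 =
  t * enorm a ^+ 2 + (1 - t) * enorm b ^+ 2 - t * (1 - t) * enorm (a - b) ^+ 2.
Proof.
rewrite !enorm_sqr !(dotDl, dotDr, dotNl, dotNr, dotZl, dotZr) (dotC b a); ring.
Qed.

Lemma moreau_le z w : feas g z.1 w -> (moreau f g gamma z <= (phi z w)%:E)%E.
Proof. by move=> Fw; apply: ereal_inf_lbound; exists w. Qed.

Lemma moreau_argmin z w : Sgamma f g gamma z w -> moreau f g gamma z = (phi z w)%:E.
Proof.
move=> [Fw Hw]; apply/eqP; rewrite eq_le moreau_le //=.
by apply: le_ereal_inf_tmp => _ [w' Fw' <-]; rewrite lee_fin; exact: Hw.
Qed.

Variable Df : Z -> Z.
Hypothesis fD : smooth f Df.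
Hypothesis gamma0 : 0 < gamma.

Lemma moreau_obj_lipschitz z0 w0 : exists2 r : R, 0 < r & exists2 L : R, 0 < L &
  forall z z' w w', pnorm (z - z0) < r -> pnorm (z' - z0) < r ->
    enorm (w - w0) < r -> enorm (w' - w0) < r ->
    `|phi z w - phi z' w'| <= L * (pnorm (z - z') + enorm (w - w')).
Proof.
have [r r0 [L L0 H]] := smooth_lipschitz fD (z0.1, w0).
pose C := enorm (w0 - z0.2) + r.
have C0 : 0 < C by rewrite ltr_wpDl ?enorm_ge0.
pose c := (2 * gamma)^-1; have c0 : 0 < c by rewrite invr_gt0 mulr_gt0.
exists (r / 2); first by rewrite divr_gt0.
exists (L + c * (2 * C)); first by rewrite addr_gt0 // !mulr_gt0.
move=> z z' w w' zr z'r wr w'r.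
have near z1 w1 : pnorm (z1 - z0) < r / 2 -> enorm (w1 - w0) < r / 2 ->
    pnorm ((z1.1, w1) - (z0.1, w0)) < r.
  move=> h1 h2; apply: le_lt_trans (pnorm_le_add _) _ => /=.
  by rewrite [ltRHS]splitr ltrD // (le_lt_trans (enorm_fst (z1 - z0))).
have nearC z1 w1 : pnorm (z1 - z0) < r / 2 -> enorm (w1 - w0) < r / 2 ->
    enorm (w1 - z1.2) <= C.
  move=> h1 h2.
  have -> : w1 - z1.2 = (w0 - z0.2) + ((w1 - w0) - (z1.2 - z0.2)).
    by apply/rowP => j; rewrite !mxE; ring.
  apply: le_trans (enormD _ _) _; rewrite lerD2l.
  apply: le_trans (enormD _ _) _; rewrite enormN [leRHS]splitr lerD ?ltW //.
  exact: le_lt_trans (enorm_snd (z1 - z0)) h1.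
have P0 := pnorm_ge0 (z - z'); have E0 := enorm_ge0 (w - w').
have Hf := H _ _ (near _ _ zr wr) (near _ _ z'r w'r).
have Hf' : `|f (z.1, w) - f (z'.1, w')| <= L * (pnorm (z - z') + enorm (w - w')).
  apply: le_trans Hf _; rewrite ler_wpM2l ?(ltW L0) //.
  apply: le_trans (pnorm_le_add _) _ => /=.
  by rewrite lerD2r; exact: (enorm_fst (z - z')).
have K1 := nearC _ _ zr wr; have K2 := nearC _ _ z'r w'r.
set a := w - z.2 in K1; set a' := w' - z'.2 in K2.
have K3 : `|enorm a - enorm a'| <= pnorm (z - z') + enorm (w - w').
  apply: le_trans (enormB_dist _ _) _.
  have -> : a - a' = (w - w') - (z.2 - z'.2).
    by apply/rowP => j; rewrite !mxE; ring.
  apply: le_trans (enormD _ _) _; rewrite enormN addrC lerD2r.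
  exact: (enorm_snd (z - z')).
rewrite /moreau_obj -/a -/a' -/c.
have -> : f (z.1, w) + c * enorm a ^+ 2 - (f (z'.1, w') + c * enorm a' ^+ 2) =
  (f (z.1, w) - f (z'.1, w')) + c * ((enorm a - enorm a') * (enorm a + enorm a')).
  by ring.
apply: le_trans (ler_normD _ _) _; rewrite [leRHS]mulrDl; apply: lerD => //.
rewrite normrM (ger0_norm (ltW c0)) -mulrA ler_wpM2l ?(ltW c0) // normrM mulrC.
rewrite ler_pM // ger0_norm ?addr_ge0 ?enorm_ge0 //; lra.
Qed.

Lemma moreau_obj_cont z0 w0 e : 0 < e -> exists2 r : R, 0 < r &
  forall z w, pnorm (z - z0) < r -> enorm (w - w0) < r ->
    `|phi z w - phi z0 w0| < e.
Proof.
move=> e0; have [r r0 [L L0 H]] := moreau_obj_lipschitz z0 w0.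
have q0 : 0 < e / (2 * L) by rewrite divr_gt0 // mulr_gt0.
exists (Num.min r (e / (2 * L))); first by rewrite lt_min r0.
move=> z w; rewrite !lt_min => /andP[zr zq] /andP[wr wq].
apply: le_lt_trans (H z z0 w w0 zr _ wr _) _; rewrite ?subrr ?pnorm0 ?enorm0 //.
have E : L * (e / (2 * L)) = e / 2 by field; rewrite gt_eqF.
have := ltr_pM2l L0 (pnorm (z - z0)) (e / (2 * L)); rewrite zq E => h1.
have := ltr_pM2l L0 (enorm (w - w0)) (e / (2 * L)); rewrite wq E => h2.
rewrite mulrDr [ltRHS]splitr; exact: ltrD.
Qed.

Variable rho : R.
Hypothesis rho_gamma : rho < 1 / gamma.
Hypothesis feas_convex : forall x w1 w2 t, 0 <= t <= 1 ->
  feas g x w1 -> feas g x w2 -> feas g x (t *: w1 + (1 - t) *: w2).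
Hypothesis f_semiconvex : forall x w1 w2 t, 0 <= t <= 1 ->
  feas g x w1 -> feas g x w2 ->
  f (x, t *: w1 + (1 - t) *: w2) <= t * f (x, w1) + (1 - t) * f (x, w2)
     + rho / 2 * (t * (1 - t) * enorm (w1 - w2) ^+ 2).

Let sigma := 1 / gamma - rho.
Let sigma0 : 0 < sigma. Proof. by rewrite subr_gt0. Qed.

(** The regularizing term outweighs the negative curvature of [f]. *)
Lemma moreau_obj_strongly_convex z w1 w2 t : 0 <= t <= 1 ->
  feas g z.1 w1 -> feas g z.1 w2 ->
  phi z (t *: w1 + (1 - t) *: w2) <= t * phi z w1 + (1 - t) * phi z w2
    - sigma / 2 * (t * (1 - t) * enorm (w1 - w2) ^+ 2).
Proof.
move=> t01 F1 F2; have := f_semiconvex t01 F1 F2; rewrite /moreau_obj.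
have -> : t *: w1 + (1 - t) *: w2 - z.2 = t *: (w1 - z.2) + (1 - t) *: (w2 - z.2).
  by rewrite !scalerBr addrACA -opprD -scalerDl [t + _]addrC subrK scale1r.
rewrite enorm_conv.
have -> : w1 - z.2 - (w2 - z.2) = w1 - w2 by rewrite opprB addrA subrK.
have -> : sigma = 2 * (2 * gamma)^-1 - rho.
  by rewrite /sigma; field; rewrite gt_eqF.
lra.
Qed.

(** Quadratic growth, from strong convexity at the midpoint. *)
Lemma Sgamma_growth z w w' : Sgamma f g gamma z w -> feas g z.1 w' ->
  phi z w + sigma / 4 * enorm (w' - w) ^+ 2 <= phi z w'.
Proof.
move=> [Fw Hw] Fw'.
have t01 : 0 <= (1 / 2 : R) <= 1 by apply/andP; split; lra.
have := Hw _ (feas_convex t01 Fw' Fw); have := moreau_obj_strongly_convex t01 Fw' Fw.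
lra.
Qed.

Lemma Sgamma_unique z w w' : Sgamma f g gamma z w -> Sgamma f g gamma z w' -> w = w'.
Proof.
move=> Sw Sw'; have := Sgamma_growth Sw Sw'.1; have := Sw'.2 _ Sw.1.
move=> h1 h2; apply/eqP; rewrite -subr_eq0; apply/eqP/enorm_row_eq0.
have : enorm (w' - w) ^+ 2 <= 0.
  by rewrite -(pmulr_rle0 _ (_ : 0 < sigma / 4)) ?divr_gt0 //; lra.
rewrite enormB => h; apply/eqP; rewrite -sqrf_eq0; apply/eqP.
by apply/le_anti; rewrite h sqr_ge0.
Qed.

End Envelope.

(** * Localization of the minimizers *)

Section Compactness.
Context {R : realType} {k : nat}.
Implicit Types (A : set 'rV[R]_k) (w y : 'rV[R]_k) (r : R).

Lemma closed_enorm A :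
  (forall w, ~ A w -> exists2 r, 0 < r & forall w', enorm (w' - w) < r -> ~ A w') ->
  closed A.
Proof.
move=> H; rewrite -[A]setCK; apply: open_closedC.
by rewrite openE => w /H; rewrite /interior => rw; apply/near_enormP.
Qed.

Lemma compact_enorm A y r : closed A -> (forall w, A w -> enorm (w - y) <= r) ->
  compact A.
Proof.
move=> cA Ar; apply: bounded_closed_compact => //.
exists (r + enorm y); split; first exact: num_real.
move=> M rM w /Ar wr; apply: ltW; apply: le_lt_trans rM.
apply: le_trans (norm_le_enorm w) _.
by have := enormD (w - y) y; rewrite subrK; lra.
Qed.

Lemma closed_ball_enorm y r : closed [set w | enorm (w - y) <= r].
Proof.
apply: closed_enorm => w /= /negP; rewrite -ltNge => rw.
exists (enorm (w - y) - r) => [|w' w'w]; first by rewrite subr_gt0.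
apply/negP; rewrite -ltNge.
have := enormD (w - w') (w' - y); rewrite addrA subrK (enormB w w'); lra.
Qed.

Lemma closed_sphere_enorm y r : closed [set w | enorm (w - y) = r].
Proof.
apply: closed_enorm => w /= rw.
exists `|enorm (w - y) - r| => [|w' w'w E]; first by rewrite normr_gt0 subr_eq0; apply/eqP.
move: w'w; rewrite -E ltNge => /negP; apply.
by have := enormB_dist (w - y) (w' - y); rewrite opprB addrA subrK (enormB w w').
Qed.

End Compactness.

Section Localization.
Context {R : realType} {n m p : nat}.
Local Notation Z := ('rV[R]_n * 'rV[R]_m)%type.
Implicit Types (z : Z) (e r t : R) (x : 'rV[R]_n) (y w b : 'rV[R]_m).
Variables (f : Z -> R) (g : Z -> 'rV[R]_p) (gamma rho : R).
Variables (Df : Z -> Z) (Dg : 'I_p -> Z -> Z).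
Hypotheses (fD : smooth f Df) (gD : forall i, smooth (component g i) (Dg i)).
Local Notation phi := (moreau_obj f gamma).
Hypotheses (gamma0 : 0 < gamma) (rho_gamma : rho < 1 / gamma).
Hypothesis feas_convex : forall x w1 w2 t, 0 <= t <= 1 ->
  feas g x w1 -> feas g x w2 -> feas g x (t *: w1 + (1 - t) *: w2).
Hypothesis f_semiconvex : forall x w1 w2 t, 0 <= t <= 1 ->
  feas g x w1 -> feas g x w2 ->
  f (x, t *: w1 + (1 - t) *: w2) <= t * f (x, w1) + (1 - t) * f (x, w2)
     + rho / 2 * (t * (1 - t) * enorm (w1 - w2) ^+ 2).

Lemma infeas_near z : ~ nonpos (g z) -> exists2 r : R, 0 < r &
  forall z', pnorm (z' - z) < r -> ~ nonpos (g z').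
Proof.
move=> /existsNP [i /negP]; rewrite -ltNge => gi.
have [r r0 H] := smooth_cont (gD i) z gi; exists r => // z' /H.
rewrite /component ltr_norml => /andP[gi' _] /(_ i); lra.
Qed.

Lemma closed_feas x : closed (feas g x).
Proof.
apply: closed_enorm => w /infeas_near [r r0 H]; exists r => // w' w'w.
apply: H; apply: le_lt_trans (pnorm_le_add _) _ => /=.
by rewrite subrr enorm0 add0r.
Qed.

Variables (zb : Z).
Hypothesis S_zb : Sgamma f g gamma zb zb.2.

(** Strong convexity separates the values on a sphere around the solution at
    the reference parameter; by compactness this persists for nearby
    parameters, which traps the minimizers in the sphere. *)
Lemma Sgamma_localized (X : set 'rV[R]_n) :
  (forall r, 0 < r -> exists2 e : R, 0 < e & forall x, X x -> enorm (x - zb.1) < e ->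
     exists2 y, feas g x y & enorm (y - zb.2) < r) ->
  forall r, 0 < r -> exists2 e : R, 0 < e & forall z, X z.1 -> pnorm (z - zb) < e ->
     exists2 w, Sgamma f g gamma z w & enorm (w - zb.2) < r.
Proof.
move=> FX r r0; pose sigma := 1 / gamma - rho.
have sigma0 : 0 < sigma by rewrite subr_gt0.
pose eta := sigma / 8 * r ^+ 2.
have eta0 : 0 < eta by rewrite mulr_gt0 ?exprn_gt0 // divr_gt0.
pose vb := phi zb zb.2.
pose sphere := [set w : 'rV[R]_m | enorm (w - zb.2) = r].
have csphere : compact sphere.
  by apply: (@compact_enorm _ _ _ zb.2 r) => [|w ->//]; exact: closed_sphere_enorm.
pose P z w := ~ feas g z.1 w \/ vb + eta < phi z w.
have FF := nbhs_filter (zb : (Z : normedModType R)).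
have [e1 e10 He1] : exists2 e1 : R, 0 < e1 &
    forall z, pnorm (z - zb) < e1 -> sphere `<=` P z.
  apply/near_pnormP.
  have cov := (compact_near_coveringP sphere).1 csphere.
  apply: (cov _ _ P FF) => w0 w0r.
  suff [d d0 Hd] : exists2 d : R, 0 < d & forall z w, pnorm (z - zb) < d ->
      enorm (w - w0) < d -> P z w.
    exists ([set w | enorm (w - w0) < d], [set z | pnorm (z - zb) < d]).
      by split; [exact: near_enorm_lt | exact: near_pnorm_lt].
    by move=> [w z] [/= wd zd]; exact: Hd.
  have [Fw0|/infeas_near [d d0 Hd]] := pselect (feas g zb.1 w0); last first.
    exists (d / 2); first by rewrite divr_gt0.
    move=> z w zd wd; left; apply: Hd; apply: le_lt_trans (pnorm_le_add _) _ => /=.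
    by rewrite [ltRHS]splitr ltrD // (le_lt_trans (enorm_fst (z - zb))).
  have [d d0 Hd] := moreau_obj_cont fD gamma0 zb w0 eta0.
  exists d => // z w zd wd; right; have := Hd z w zd wd.
  have := Sgamma_growth gamma0 feas_convex f_semiconvex S_zb Fw0.
  rewrite w0r -/vb -/sigma ltr_norml => h1 /andP[h2 _].
  have : sigma / 4 * r ^+ 2 = 2 * eta by rewrite /eta; field.
  lra.
have [d d0 Hd] := moreau_obj_cont fD gamma0 zb zb.2 eta0.
have q0 : 0 < Num.min d r by rewrite lt_min d0.
have [e2 e20 He2] := FX _ q0.
exists (Num.min e1 (Num.min e2 d)); first by rewrite !lt_min e10 e20.
move=> z Xz; rewrite !lt_min => /and3P[ze1 ze2 zd].
have [y Fy] := He2 _ Xz (le_lt_trans (enorm_fst (z - zb)) ze2).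
rewrite lt_min => /andP[yd yr].
pose A := feas g z.1 `&` [set w | enorm (w - zb.2) <= r].
have cA : compact A.
  apply: (@compact_enorm _ _ _ zb.2 r) => [|w [_]//].
  by apply: closedI; [exact: closed_feas | exact: closed_ball_enorm].
have contphi : continuous (phi z).
  move=> w; have FW := nbhs_filter w; apply: (cvgrPdist_lt _ _).2 => e e0.
  have [s s0 Hs] := moreau_obj_cont fD gamma0 z w e0.
  apply/near_enormP; exists s => // w' w's; rewrite distrC; apply: Hs => //.
  by rewrite subrr pnorm0.
have Ay : A y by split => //; exact: ltW.
have [w wA Hw] := EVT_min_rV (ex_intro _ y Ay) cA (continuous_subspaceT contphi).
have [Fw wr] : A w by rewrite inE in wA.
have wy : phi z w <= phi z y by apply: Hw; rewrite inE.
have wr' : enorm (w - zb.2) < r.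
  rewrite lt_neqAle wr andbT; apply/eqP => E.
  have [//|] := He1 z ze1 w E.
  by have := Hd z y zd yd; rewrite ltr_norml -/vb => /andP[_]; lra.
exists w => //; split => // w' Fw'.
have r1 : 0 < r - enorm (w - zb.2) by rewrite subr_gt0.
have [t /andP[t0 t1] tw] := small_step r1 (enorm_ge0 (w' - w)).
have t01 : 0 <= t <= 1 by rewrite ltW.
have Fc := feas_convex t01 Fw' Fw.
have /Hw : t *: w' + (1 - t) *: w \in A.
  rewrite inE; split => //=.
  have -> : t *: w' + (1 - t) *: w - zb.2 = t *: (w' - w) + (w - zb.2).
    by apply/rowP => j; rewrite !mxE; ring.
  apply: le_trans (enormD _ _) _; rewrite enormZ (gtr0_norm t0); lra.
have := moreau_obj_strongly_convex gamma0 f_semiconvex t01 Fw' Fw.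
have : 0 <= sigma / 2 * (t * (1 - t) * enorm (w' - w) ^+ 2).
  by rewrite mulr_ge0 ?divr_ge0 ?(ltW sigma0) // mulr_ge0 ?sqr_ge0 // mulr_ge0 ?subr_ge0 // ltW.
rewrite -/sigma => h1 h2 h3.
have : t * phi z w <= t * phi z w' by lra.
by rewrite ler_pM2l.
Qed.

End Localization.

(** * First-order comparison for quasi-convex constraints *)

Section FirstOrderComparison.
Context {R : realType} {n m : nat}.
Local Notation Z := ('rV[R]_n * 'rV[R]_m)%type.
Implicit Types (z : Z) (e r t : R) (x a u : 'rV[R]_n) (y w b : 'rV[R]_m).

Lemma slope_le (h : Z -> R) (D : Z -> Z) z (d : Z) (c : R) : smooth h D ->
  (forall t, 0 < t <= 1 -> h (z + t *: d) - h z <= t * c) -> pdot (D z) d <= c.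
Proof.
move=> hD H; rewrite -subr_ge0; apply: (ge0_of_eps (pnorm_ge0 d)) => e /andP[e0 e1].
have [r r0 Hr] := smooth_diff hD z e0.
have [t /andP[t0 t1] tr] := small_step r0 (pnorm_ge0 d).
have E : z + t *: d - z = t *: d by rewrite addrAC subrr add0r.
have := Hr (z + t *: d); rewrite E pnormZ (gtr0_norm t0) pdotZr => /(_ tr).
have := H t; rewrite t0 t1 => /(_ isT) h1; rewrite ler_norml => /andP[h2 _].
rewrite -(pmulr_rge0 _ t0); lra.
Qed.

(** Strict differentiability lets the base point [w] and the direction [a] move
    while the derivative is taken at the reference point. *)
Lemma smooth_expand (h : Z -> R) (D : Z -> Z) x y u b e : smooth h D -> 0 < e ->
  exists2 r : R, 0 < r & forall t a w, 0 < t < r -> enorm (a - u) < r ->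
    enorm (w - y) < r ->
    `|h (x + t *: a, w + t *: b) - h (x, w) - t * pdot (D (x, y)) (u, b)| <= t * e.
Proof.
move=> hD e0.
have [N N0 Nub] : exists2 N : R, 0 < N & pnorm (u, b) + 1 <= N.
  by exists (pnorm (u, b) + 1); rewrite // ltr_wpDl ?pnorm_ge0.
have [M M0 MD] : exists2 M : R, 0 < M & pnorm (D (x, y)) + 1 <= M.
  by exists (pnorm (D (x, y)) + 1); rewrite // ltr_wpDl ?pnorm_ge0.
have [c c0 cN] : exists2 c : R, 0 < c & c * N <= e / 2.
  by exists (e / 2 / N); rewrite ?divr_gt0 // divfK // gt_eqF.
have [s s0 Hs] := smooth_strict hD (x, y) c0.
have [c' /andP[c'0 c'1] c'M] : exists2 c' : R, 0 < c' <= 1 & c' * M < e / 2.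
  by apply: small_step; rewrite ?divr_gt0 // ltW.
have [c'' /andP[c''0 c''1] c''N] : exists2 c'' : R, 0 < c'' <= 1 & c'' * N < s / 2.
  by apply: small_step; rewrite ?divr_gt0 // ltW.
exists (Num.min (s / 2) (Num.min c' c'')).
  by rewrite !lt_min c'0 c''0 divr_gt0.
move=> t a w /andP[t0]; rewrite !lt_min.
move=> /and3P[ts tc' tc''] /and3P[au_s au_c' _] /and3P[wy _ _].
have ab : pnorm (a, b) <= N.
  have -> : (a, b) = (u, b) + (a - u, 0) :> Z.
    by congr (_, _) => /=; rewrite ?addr0 // addrC subrK.
  apply: le_trans (pnormD _ _) _; rewrite pnorm_fst0; lra.
have E : (x + t *: a, w + t *: b) - (x, w) = t *: (a, b) :> Z.
  by congr (_, _); rewrite /= addrAC subrr add0r.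
have n1 : pnorm ((x, w) - (x, y)) < s / 2.
  by apply: le_lt_trans (pnorm_le_add _) _; rewrite /= subrr enorm0 add0r.
have tN : t * pnorm (a, b) < s / 2.
  apply: le_lt_trans (_ : c'' * N < _) => //.
  by rewrite ler_pM ?pnorm_ge0 // ltW.
have n2 : pnorm ((x + t *: a, w + t *: b) - (x, y)) < s.
  have -> : (x + t *: a, w + t *: b) - (x, y) =
     ((x + t *: a, w + t *: b) - (x, w)) + ((x, w) - (x, y)) :> Z.
    by rewrite addrA subrK.
  apply: le_lt_trans (pnormD _ _) _; rewrite E pnormZ (gtr0_norm t0); lra.
have n1' : pnorm ((x, w) - (x, y)) < s by lra.
have := Hs _ _ n2 n1'; rewrite E pnormZ (gtr0_norm t0) pdotZr.
have pE : pdot (D (x, y)) (a, b) =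
    pdot (D (x, y)) (u, b) + pdot (D (x, y)) (a - u, 0).
  rewrite -pdotDr; congr pdot.
  by congr (_, _) => /=; rewrite ?addr0 // addrC subrK.
have h1 : `|pdot (D (x, y)) (a - u, 0)| <= e / 2.
  apply: le_trans (pdot_le _ _) _; rewrite pnorm_fst0 mulrC.
  apply: le_trans (ltW c'M); rewrite ler_pM ?enorm_ge0 ?pnorm_ge0 ?ltW //; lra.
have h2 : c * (t * pnorm (a, b)) <= t * (e / 2).
  by rewrite mulrCA ler_wpM2l ?(ltW t0) //; apply: le_trans cN; rewrite ler_wpM2l ?(ltW c0).
move: h1; rewrite pE !ler_norml mulrDr => /andP[h3 h4] /andP[h5 h6].
have h7 := ler_wpM2l (ltW t0) h3; have h8 := ler_wpM2l (ltW t0) h4.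
by apply/andP; split; lra.
Qed.

Section Constraint.
Variables (h : Z -> R) (D : Z -> Z) (x : 'rV[R]_n) (y : 'rV[R]_m) (u : 'rV[R]_n).
Hypothesis hD : smooth h D.
Hypothesis hxy : h (x, y) = 0.

(** For a quasi-convex constraint active at [(x, y)]: the first-order estimate
    that convexity of [h] in both variables would give when a nearby point
    [(x + t a, w)] of the constraint surface is compared with [(x, y)]. *)
Definition comparable_from_nearby : Prop := forall e, 0 < e ->
  exists2 r : R, 0 < r & forall t a w, 0 < t < r -> enorm (a - u) < r ->
    enorm (w - y) < r -> 0 <= h (x + t *: a, w) ->
    dot (D (x + t *: a, w)).2 (y - w) <= t * (dot (D (x, y)).1 u + e).

Definition comparable_from_reference : Prop := forall e, 0 < e ->
  exists2 r : R, 0 < r & forall t a w, 0 < t < r -> enorm (a - u) < r ->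
    enorm (w - y) < r -> h (x + t *: a, w) <= 0 ->
    dot (D (x, y)).2 (w - y) <= t * (e - dot (D (x, y)).1 u).

Hypothesis h_qc : forall x w w' t, 0 <= t <= 1 -> h (x, w') <= h (x, w) ->
  h (x, w + t *: (w' - w)) <= h (x, w).

(** The gradient of a quasi-convex function makes an obtuse angle with the
    directions into its sublevel set. *)
Lemma quasiconvex_gradient x' w w' : h (x', w') <= h (x', w) ->
  dot (D (x', w)).2 (w' - w) <= 0.
Proof.
move=> ww'; have := @slope_le h D (x', w) (0, w' - w) 0 hD.
rewrite {1}/pdot dot0r add0r /=; apply => t /andP[t0 t1].
have t01 : 0 <= t <= 1 by rewrite ltW.
have := h_qc t01 ww'.
have -> : (x', w) + t *: (0, w' - w) = (x', w + t *: (w' - w)) :> Z.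
  by congr (_, _) => /=; rewrite scaler0 addr0.
by rewrite mulr0; lra.
Qed.

Section NonvanishingGradient.
Hypothesis D0 : (D (x, y)).2 != 0.

Lemma direction_with_slope (c : R) : exists b, dot (D (x, y)).2 b = c.
Proof.
have := sqr_enorm_gt0 D0 => q0.
exists ((c / dot (D (x, y)).2 (D (x, y)).2) *: (D (x, y)).2).
by rewrite dotZr divfK // gt_eqF.
Qed.

(** The comparison point [y] is shifted by [t b], with [b] chosen so that the
    constraint decreases there by the missing first-order amount; the shifted
    point satisfies the inequality to which quasi-convexity applies. *)
Lemma nonvanishing_from_nearby : comparable_from_nearby.
Proof.
move=> e e0; have e20 : 0 < e / 2 by rewrite divr_gt0.
have e40 : 0 < e / 4 by rewrite divr_gt0.
have [b bE] := direction_with_slope (- dot (D (x, y)).1 u - e / 2).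
have [r1 r10 H1] := smooth_expand x y u b hD e40.
have N0 : 0 < enorm b + 1 by rewrite ltr_wpDl ?enorm_ge0.
have [c /andP[c0 c1] cN] := small_step e20 (ltW N0).
have [r2 r20 H2] := smooth_grad hD (x, y) c0.
have U0 : 0 < enorm u + 1 by rewrite ltr_wpDl ?enorm_ge0.
have r220 : 0 < r2 / 2 by rewrite divr_gt0.
have [c' /andP[c'0 c'1] c'N] := small_step r220 (ltW U0).
exists (Num.min r1 (Num.min (r2 / 2) c')).
  by rewrite !lt_min r10 r220.
move=> t a w /andP[t0]; rewrite !lt_min.
move=> /and3P[t1 t2 t3] /and3P[a1 _ a3] /and3P[w1 w2 _] hw.
have ty : y + t *: b - y = t *: b by rewrite addrAC subrr add0r.
have := H1 t a y; rewrite t0 t1 subrr enorm0 hxy subr0 => /(_ isT a1 r10).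
rewrite ler_norml /pdot /= bE => /andP[_ h1].
have h2 : h (x + t *: a, y + t *: b) <= h (x + t *: a, w).
  apply: le_trans hw; have : t * (e / 4) <= t * (e / 2) by rewrite ler_wpM2l ?(ltW t0) //; lra.
  lra.
have := quasiconvex_gradient h2.
have -> : y + t *: b - w = (y - w) + t *: b by rewrite addrAC.
rewrite dotDr dotZr => h3.
have near : pnorm ((x + t *: a, w) - (x, y)) < r2.
  apply: le_lt_trans (pnorm_le_add _) _ => /=.
  rewrite [x + _]addrC addrK enormZ (gtr0_norm t0) [ltRHS]splitr ltrD //.
  apply: le_lt_trans c'N; rewrite ler_pM ?enorm_ge0 ?ltW //.
  by have := enormD (a - u) u; rewrite subrK; lra.
have h4 : `|dot ((D (x + t *: a, w)).2 - (D (x, y)).2) b| <= e / 2.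
  apply: le_trans (dot_le_enorm _ _) _; apply: le_trans (ltW cN).
  rewrite ler_pM ?enorm_ge0 //; last by rewrite lerDl.
  apply: le_trans (ltW (H2 _ near)); exact: (enorm_snd (_ - _)).
move: h4; rewrite dotBl bE ler_norml => /andP[h4 _].
have := ler_wpM2l (ltW t0) h4; lra.
Qed.

Lemma nonvanishing_from_reference : comparable_from_reference.
Proof.
move=> e e0; have e20 : 0 < e / 2 by rewrite divr_gt0.
have [b bE] := direction_with_slope (e - dot (D (x, y)).1 u).
have [r1 r10 H1] := smooth_expand x y u b hD e20.
have r120 : 0 < r1 / 2 by rewrite divr_gt0.
have [c /andP[c0 c1] cN] := small_step r120 (enorm_ge0 b).
exists (Num.min (r1 / 2) c); first by rewrite lt_min r120.
move=> t a w /andP[t0]; rewrite !lt_min => /andP[t1 t2] /andP[a1 _] /andP[w1 _] hw.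
have t1' : t < r1 by lra.
have wn : enorm (w - t *: b - y) < r1.
  have -> : w - t *: b - y = (w - y) - t *: b by rewrite addrAC.
  apply: le_lt_trans (enormD _ _) _; rewrite enormN enormZ (gtr0_norm t0) [ltRHS]splitr.
  rewrite ltrD //; apply: le_lt_trans cN; by rewrite ler_wpM2r ?enorm_ge0 // ltW.
have a1' : enorm (a - u) < r1 by lra.
have := H1 t a (w - t *: b); rewrite t0 t1' subrK => /(_ isT a1' wn).
rewrite ler_norml /pdot /= bE => /andP[h1 _].
have h2 : h (x, w - t *: b) <= h (x, y).
  rewrite hxy; have : t * (e / 2) <= t * e by rewrite ler_wpM2l ?(ltW t0) //; lra.
  lra.
have := quasiconvex_gradient h2.
have -> : w - t *: b - y = (w - y) - t *: b by rewrite addrAC.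
rewrite [dot _ (_ - t *: b)]dotBr dotZr bE; lra.
Qed.

End NonvanishingGradient.

Section VanishingGradient.
(* Constant rank [0] of the partial gradient. *)
Hypothesis D0 : exists2 r : R, 0 < r &
  forall z, pnorm (z - (x, y)) < r -> (D z).2 = 0.

Lemma vanishing_indep : exists2 r : R, 0 < r & forall x' w,
  enorm (x' - x) < r -> enorm (w - y) < r ->
  h (x', w) = h (x', y) /\ (D (x', w)).2 = 0.
Proof.
have [r r0 Hr] := D0; exists (r / 2); first by rewrite divr_gt0.
move=> x' w x'r wr.
have near w' : enorm (w' - y) < r / 2 -> pnorm ((x', w') - (x, y)) < r.
  by move=> w'r; apply: le_lt_trans (pnorm_le_add _) _; rewrite [ltRHS]splitr ltrD.
split; last exact: Hr (near _ wr).
have [s /andP[s0 s1]] := smooth_mean_value hD (x', y) (0, w - y).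
have -> : (x', y) + (0, w - y) = (x', w) :> Z.
  by congr (_, _) => /=; rewrite ?addr0 // addrC subrK.
have -> : (x', y) + s *: (0, w - y) = (x', y + s *: (w - y)) :> Z.
  by congr (_, _) => /=; rewrite scaler0 addr0.
rewrite /pdot Hr ?dot0l ?dot0r ?addr0; first by move/eqP; rewrite subr_eq0 => /eqP.
apply: near; rewrite addrAC subrr add0r enormZ (ger0_norm s0).
by apply: le_lt_trans wr; rewrite ler_piMl ?enorm_ge0.
Qed.

Lemma vanishing_expand e : 0 < e ->
  exists2 r : R, 0 < r & forall t a w, 0 < t < r -> enorm (a - u) < r ->
    enorm (w - y) < r -> (D (x + t *: a, w)).2 = 0 /\
    `|h (x + t *: a, w) - t * dot (D (x, y)).1 u| <= t * e.
Proof.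
move=> e0; have [r1 r10 H1] := smooth_expand x y u 0 hD e0.
have [r2 r20 H2] := vanishing_indep.
have U0 : 0 < enorm u + r1 by rewrite ltr_wpDl ?enorm_ge0.
have [c /andP[c0 c1] cN] := small_step r20 (ltW U0).
exists (Num.min r1 (Num.min r2 c)); first by rewrite !lt_min r10 r20.
move=> t a w /andP[t0]; rewrite !lt_min.
move=> /and3P[t1 _ t3] /and3P[a1 _ _] /and3P[_ w2 _].
have ax : enorm (x + t *: a - x) < r2.
  rewrite addrAC subrr add0r enormZ (gtr0_norm t0); apply: le_lt_trans cN.
  rewrite ler_pM ?enorm_ge0 ?ltW //.
  by have := enormD (a - u) u; rewrite subrK; lra.
have [-> ->] := H2 _ _ ax w2; split => //.
have := H1 t a y; rewrite t0 t1 subrr enorm0 => /(_ isT a1 r10).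
by rewrite scaler0 addr0 hxy subr0 /pdot /= dot0r addr0.
Qed.

Lemma vanishing_from_nearby : comparable_from_nearby.
Proof.
move=> e e0; have [r r0 H] := vanishing_expand e0; exists r => // t a w t0r ar wr h0.
have [-> ] := H t a w t0r ar wr; rewrite dot0l ler_norml mulrDr => /andP[h1 h2].
lra.
Qed.

Lemma vanishing_from_reference : comparable_from_reference.
Proof.
have [r' r'0 Hr'] := D0.
have D00 : (D (x, y)).2 = 0 by apply: Hr'; rewrite subrr pnorm0.
move=> e e0; have [r r0 H] := vanishing_expand e0; exists r => // t a w t0r ar wr h0.
have [_ ] := H t a w t0r ar wr; rewrite D00 dot0l ler_norml => /andP[h1 h2].
lra.
Qed.

End VanishingGradient.
End Constraint.
End FirstOrderComparison.

(** * Limits along ultrafilters *)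

Section Limits.
Context {R : realType}.

Lemma cvg_eps (T : Type) (U : set_system T) (FU : ProperFilter U) (a : T -> R) (l : R) :
  (forall e : R, 0 < e -> \forall k \near U, `|a k - l| < e) -> a @ U --> l.
Proof.
by move=> H; apply: (cvgrPdist_lt _ _).2 => e e0; apply: filterS (H e e0) => k; rewrite distrC.
Qed.

Lemma cvg_eq_near (T : Type) (U : set_system T) (FU : ProperFilter U) (a : T -> R)
    (l c : R) : a @ U --> l -> (\forall k \near U, a k = c) -> l = c.
Proof.
move=> al ac; apply/le_anti/andP; split.
  by apply: (cvgr_to_le al); apply: filterS ac => k ->.
by apply: (cvgr_to_ge al); apply: filterS ac => k ->.
Qed.

Lemma cvg_sumr (T : Type) (U : set_system T) (FU : ProperFilter U) p
    (a : 'I_p -> T -> R) (l : 'I_p -> R) :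
  (forall i, a i @ U --> l i) ->
  (fun k => \sum_i a i k) @ U --> \sum_i l i.
Proof.
move=> H; elim: p a l H => [|p IH] a l H.
  by rewrite big_ord0; under eq_fun do rewrite big_ord0; exact: cvg_cst.
rewrite big_ord_recl; under eq_fun do rewrite big_ord_recl.
by apply: cvgD; [exact: H | apply: IH => i; exact: H].
Qed.

(** A bounded sequence of vectors converges along some ultrafilter finer than
    the filter of cofinite sets of indices, which replaces the extraction of a
    subsequence. *)
Lemma bounded_ultra p (a : nat -> 'rV[R]_p) (M : R) :
  (\forall k \near \oo, enorm (a k) <= M) ->
  exists (U : set_system nat) (l : 'rV[R]_p),
    [/\ ProperFilter U, \oo `<=` U & forall e : R, 0 < e ->
        \forall k \near U, enorm (a k - l) < e].
Proof.
move=> aM; have [U [UU sU]] := ultraFilterLemma (F := \oo) eventually_filter.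
have PU : ProperFilter U by exact: ultra_proper.
have cA : compact [set w : 'rV[R]_p | enorm (w - 0) <= M].
  by apply: (@compact_enorm _ _ _ 0 M) => //; exact: closed_ball_enorm.
have [|l [_ cl]] := cA (a @ U) _.
  by apply: sU; apply: filterS aM => k; rewrite /= subr0.
exists U, l; split => // e e0.
have [//|nU] := in_ultra_setVsetC [set k | enorm (a k - l) < e] UU.
have := cl (a @` ~` [set k | enorm (a k - l) < e]) [set w | enorm (w - l) < e].
move=> /(_ _ (near_enorm_lt _ e0)) [|w [[k /= ak <-]] //].
by apply: (@filterS _ U _ _ _ _ nU) => k nk; exists k.
Qed.

Lemma smooth_cvg n m (h : 'rV[R]_n * 'rV[R]_m -> R) D (T : Type)
    (U : set_system T) (FU : ProperFilter U) (q : T -> 'rV[R]_n * 'rV[R]_m) z d :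
  smooth h D -> (forall e : R, 0 < e -> \forall k \near U, pnorm (q k - z) < e) ->
  (fun k => pdot (D (q k)) d) @ U --> pdot (D z) d.
Proof.
move=> hD qz; apply: cvg_eps => e e0.
have [c /andP[c0 _] cN] := small_step e0 (pnorm_ge0 d).
have [r r0 Hr] := smooth_grad hD z c0.
apply: filterS (qz r r0) => k /Hr qk; rewrite -pdotBl.
apply: le_lt_trans (pdot_le _ _) _; apply: le_lt_trans cN.
by rewrite ler_wpM2r ?pnorm_ge0 // ltW.
Qed.

End Limits.

(** * Envelope along a cone of parameters *)

Section DirectionalEnvelope.
Context {R : realType} {n m p : nat}.
Local Notation Z := ('rV[R]_n * 'rV[R]_m)%type.
Implicit Types (z : Z) (e r t s : R) (x a : 'rV[R]_n) (y w b : 'rV[R]_m).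
Variables (f : Z -> R) (g : Z -> 'rV[R]_p) (gamma rho : R).
Variables (Df : Z -> Z) (Dg : 'I_p -> Z -> Z).
Hypotheses (fD : smooth f Df) (gD : forall i, smooth (component g i) (Dg i)).
Local Notation phi := (moreau_obj f gamma).
Local Notation env := (moreau f g gamma).
Hypotheses (gamma0 : 0 < gamma) (rho_gamma : rho < 1 / gamma).
Hypothesis feas_convex : forall x w1 w2 t, 0 <= t <= 1 ->
  feas g x w1 -> feas g x w2 -> feas g x (t *: w1 + (1 - t) *: w2).
Hypothesis f_semiconvex : forall x w1 w2 t, 0 <= t <= 1 ->
  feas g x w1 -> feas g x w2 ->
  f (x, t *: w1 + (1 - t) *: w2) <= t * f (x, w1) + (1 - t) * f (x, w2)
     + rho / 2 * (t * (1 - t) * enorm (w1 - w2) ^+ 2).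
Variables (xb : 'rV[R]_n) (yb : 'rV[R]_m).
Let zb : Z := (xb, yb).
Hypothesis S_zb : Sgamma f g gamma zb yb.
Variables (u : 'rV[R]_n) (kap eps del : R).
Hypotheses (kap0 : 0 < kap) (eps0 : 0 < eps) (del0 : 0 < del).

Definition cone : set 'rV[R]_n :=
  [set x | exists2 s : R, 0 <= s & enorm (x - xb - s *: u) <= del * s].

Hypothesis EB : forall x b, cone x -> enorm (x - xb) < eps ->
  enorm (b - yb) < eps ->
  exists2 w, feas g x w & enorm (w - b) <= kap * gplus g (x, b).

Let g_zb : nonpos (g zb). Proof. by case: S_zb. Qed.

Lemma pair_near x w r : enorm (x - xb) < r / 2 -> enorm (w - yb) < r / 2 ->
  pnorm ((x, w) - zb) < r.
Proof.
by move=> h1 h2; apply: le_lt_trans (pnorm_le_add _) _; rewrite [ltRHS]splitr ltrD.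
Qed.

Lemma cone_feas r : 0 < r -> exists2 e : R, 0 < e & forall x, cone x ->
  enorm (x - xb) < e -> exists2 y, feas g x y & enorm (y - yb) < r.
Proof.
move=> r0; have [s s0 [L L0 HL]] := gplus_lipschitz gD zb.
have [t /andP[t0 t1] tr] := small_step r0 (mulr_ge0 (ltW kap0) (ltW L0)).
exists (Num.min eps (Num.min s t)); first by rewrite !lt_min eps0 s0.
move=> x Cx; rewrite !lt_min => /and3P[xe xs xt].
have := EB Cx xe; move=> /(_ yb); rewrite subrr enorm0 => /(_ eps0) [y Fy Hy].
exists y => //; apply: le_lt_trans Hy _; apply: le_lt_trans tr.
rewrite [t * _]mulrC -mulrA ler_wpM2l ?(ltW kap0) //.
have E : pnorm ((x, yb) - zb) = enorm (x - xb).
  by rewrite -(pnorm_fst0 (m := m)); congr pnorm; congr (_, _) => /=; rewrite subrr.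
have xz : pnorm ((x, yb) - zb) < s by rewrite E.
apply: le_trans (HL _ _ xz _ g_zb) _; first by rewrite subrr pnorm0.
by rewrite E ler_wpM2l ?(ltW L0) // ltW.
Qed.

Lemma cone_solution r : 0 < r -> exists2 e : R, 0 < e & forall z, cone z.1 ->
  pnorm (z - zb) < e -> exists2 w, Sgamma f g gamma z w & enorm (w - yb) < r.
Proof.
exact: (Sgamma_localized fD gD gamma0 rho_gamma feas_convex f_semiconvex S_zb cone_feas).
Qed.

(** A minimizer at one parameter can be moved to a feasible point for another
    parameter at a cost proportional to the distance of the parameters. *)
Lemma cone_lipschitz : exists2 e : R, 0 < e & exists2 L : R, 0 < L &
  (forall z, cone z.1 -> pnorm (z - zb) < e -> env z \is a fin_num) /\
  (forall z z', cone z.1 -> cone z'.1 -> pnorm (z - zb) < e -> pnorm (z' - zb) < e ->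
     fine (env z') <= fine (env z) + L * pnorm (z' - z)).
Proof.
have [r1 r10 [L1 L10 H1]] := moreau_obj_lipschitz fD gamma0 zb yb.
have [r2 r20 [L2 L20 H2]] := gplus_lipschitz gD zb.
pose r := Num.min eps (Num.min r1 r2).
have r0 : 0 < r by rewrite !lt_min eps0 r10.
have r20' : 0 < r / 2 by rewrite divr_gt0.
have [c /andP[c0 c1] cN] := small_step r20' (mulr_ge0 (ltW kap0) (ltW L20)).
have c30 : 0 < Num.min (c / 2) (r / 2) by rewrite lt_min divr_gt0.
have [e e0 He] := cone_solution c30.
exists (Num.min e (Num.min (c / 2) (r / 2))).
  by rewrite lt_min e0.
exists (L1 * (1 + kap * L2)).
  by rewrite mulr_gt0 // ltr_pwDl // mulr_ge0 // ltW.
split=> [z Cz|z z' Cz Cz'].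
  rewrite lt_min => /andP[ze _]; have [w Sw _] := He z Cz ze.
  by rewrite (moreau_argmin Sw).
rewrite !lt_min => /and3P[ze zc zr] /and3P[z'e z'c z'r].
have [w Sw] := He z Cz ze; have [w' Sw' _] := He z' Cz' z'e.
rewrite lt_min => /andP[wc wr].
have reps : r <= eps by rewrite ge_min lexx.
have rr1 : r <= r1 by rewrite !ge_min lexx orbT.
have rr2 : r <= r2 by rewrite !ge_min lexx !orbT.
have x'e : enorm (z'.1 - xb) < r / 2 by apply: le_lt_trans z'r; exact: (enorm_fst (z' - zb)).
have xe : enorm (z.1 - xb) < r / 2 by apply: le_lt_trans zr; exact: (enorm_fst (z - zb)).
have [y Fy Hy] : exists2 y, feas g z'.1 y & enorm (y - w) <= kap * gplus g (z'.1, w).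
  by apply: EB => //; lra.
have n1 : pnorm ((z'.1, w) - zb) < r2 by apply: lt_le_trans rr2; exact: pair_near.
have n2 : pnorm ((z.1, w) - zb) < r2 by apply: lt_le_trans rr2; exact: pair_near.
have E : pnorm ((z'.1, w) - (z.1, w)) <= pnorm (z' - z).
  have -> : (z'.1, w) - (z.1, w) = (z'.1 - z.1, 0) :> Z.
    by congr (_, _) => /=; rewrite subrr.
  rewrite pnorm_fst0; exact: (enorm_fst (z' - z)).
have gw : gplus g (z'.1, w) <= L2 * pnorm (z' - z).
  apply: le_trans (H2 _ _ n1 n2 Sw.1) _.
  by rewrite ler_wpM2l ?(ltW L20).
have yw : enorm (y - w) <= kap * L2 * pnorm (z' - z).
  by apply: le_trans Hy _; rewrite -mulrA ler_wpM2l ?(ltW kap0).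
have zz' : pnorm (z' - z) <= c.
  have -> : z' - z = (z' - zb) - (z - zb) by rewrite opprB addrA subrK.
  apply: le_trans (pnormD _ _) _; rewrite pnormN; lra.
have yr : enorm (y - yb) < r.
  have -> : y - yb = (y - w) + (w - yb) by rewrite addrA subrK.
  apply: le_lt_trans (enormD _ _) _; rewrite [ltRHS]splitr ltrD //.
  apply: le_lt_trans yw _; apply: le_lt_trans cN.
  by rewrite mulrC ler_wpM2r // mulr_ge0 // ltW.
have := @H1 z' z y w; rewrite ler_norml.
have z'r1 : pnorm (z' - zb) < r1 by lra.
have zr1 : pnorm (z - zb) < r1 by lra.
have yr1 : enorm (y - yb) < r1 by lra.
have wr1 : enorm (w - yb) < r1 by lra.
move=> /(_ z'r1 zr1 yr1 wr1) /andP[_ K].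
rewrite (moreau_argmin Sw) (moreau_argmin Sw') /=.
have := Sw'.2 _ Fy; have := ler_wpM2l (ltW L10) yw; lra.
Qed.

(** A directional neighborhood of [(u, v)] projects into a cone around [u]:
    compare first components in its defining inequality, rescaled. *)
Lemma cone_of_pair v : exists2 d : R, 0 < d &
  forall e (h : Z), dir_nbhd pnorm e d (u, v) h -> cone (xb + h.1).
Proof.
have [N0|N0] := eqVneq (pnorm (u, v)) 0.
  exists 1 => // e h _; exists (enorm h.1 / del).
    by rewrite divr_ge0 ?enorm_ge0 // ltW.
  have -> : u = 0.
    by apply: enorm_row_eq0; apply/le_anti; rewrite enorm_ge0 -N0 (enorm_fst (u, v)).
  by rewrite scaler0 subr0 addrAC subrr add0r mulrC divfK // gt_eqF.
have Np : 0 < pnorm (u, v) by rewrite lt_neqAle eq_sym N0 pnorm_ge0.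
exists (del / pnorm (u, v)); first by rewrite divr_gt0.
move=> e h [_ H]; exists (pnorm h / pnorm (u, v)).
  by rewrite divr_ge0 ?pnorm_ge0.
rewrite [xb + _]addrC addrK -(ler_pM2l Np) -{1}[pnorm (u, v)]gtr0_norm // -enormZ.
have -> : pnorm (u, v) *: (h.1 - (pnorm h / pnorm (u, v)) *: u) =
    (pnorm (u, v) *: h - pnorm h *: (u, v)).1.
  by rewrite /= scalerBr scalerA mulrC divfK.
apply: le_trans (enorm_fst _) _; apply: le_trans H _.
rewrite le_eqVlt; apply/orP; left; apply/eqP; field.
by rewrite N0.
Qed.

Lemma env_dir_lipschitz v : dir_lipschitz env zb (u, v).
Proof.
have [e e0 [L L0 [Hfin HL]]] := cone_lipschitz.
have [d d0 Hd] := cone_of_pair v.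
exists e, d, L; split => //; split.
  move=> _ [h Hh <-]; apply: Hfin; first exact: Hd Hh.
  by rewrite addrAC subrr add0r; case: Hh.
move=> _ _ [h Hh <-] [h' Hh' <-].
have he : pnorm (zb + h - zb) < e by rewrite addrAC subrr add0r; case: Hh.
have h'e : pnorm (zb + h' - zb) < e by rewrite addrAC subrr add0r; case: Hh'.
have C := Hd _ _ Hh; have C' := Hd _ _ Hh'.
have K1 := HL _ _ (C : cone (zb + h).1) (C' : cone (zb + h').1) he h'e.
have K2 := HL _ _ (C' : cone (zb + h').1) (C : cone (zb + h).1) h'e he.
rewrite pnormB in K1.
rewrite ler_norml; apply/andP; split; lra.
Qed.

(** Subtracting [<xi, .>] makes the minimizer stationary, jointly in the parameter
    and the feasible point. Varying the second parameter determines [xi.2]; for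
    the first parameter and the feasible point together the bounded multiplier
    rule applies, with a Lipschitz constant that grows with the norm of [xi]. *)
Lemma frechet_subdiff_multipliers : exists2 r : R, 0 < r & exists2 K : R, 0 < K &
  forall z (w : 'rV[R]_m) (xi : Z),
    (exists2 s : R, 0 < s & forall x, enorm (x - z.1) < s -> cone x) ->
    pnorm (z - zb) < r -> enorm (w - yb) < r ->
    Sgamma f g gamma z w -> frechet_subdiff env z xi ->
    [/\ xi.2 = gamma^-1 *: (z.2 - w) &
    exists lam : 'I_p -> R, [/\ forall i, 0 <= lam i <= K * (1 + pnorm xi),
      forall i, g (z.1, w) 0 i != 0 -> lam i = 0 &
      forall h : Z, pdot (Df (z.1, w)) h + gamma^-1 * dot (w - z.2) h.2
        - dot xi.1 h.1 + \sum_i lam i * pdot (Dg i (z.1, w)) h = 0]].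
Proof.
have [r1 r10 [L1 L10 H1]] := moreau_obj_lipschitz fD gamma0 zb yb.
exists (Num.min (eps / 2) (r1 / 2)); first by rewrite lt_min !divr_gt0.
exists ((2 * L1 + 1) * kap).
  by rewrite mulr_gt0 // addr_gt0 // mulr_gt0.
move=> z w xi [s s0 Cs]; rewrite !lt_min => /andP[ze zr] /andP[we wr] Sw [_ Fxi].
have ze1 : enorm (z.1 - xb) < eps / 2 by apply: le_lt_trans ze; exact: (enorm_fst (z - zb)).
have envz := moreau_argmin Sw.
have Fxi' e : 0 < e -> exists2 r : R, 0 < r & forall (z' : Z) w',
    pnorm (z' - z) < r -> feas g z'.1 w' ->
    phi z w + pdot xi (z' - z) - e * pnorm (z' - z) <= phi z' w'.
  move=> e0; have /near_pnormP [r r0 Hr] := Fxi e e0.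
  exists r => // z' w' z'r Fw'.
  have := le_trans (Hr z' z'r) (moreau_le f gamma Fw').
  by rewrite envz -EFinD lee_fin addrA.
have dotnE (c : R) (a b : 'rV[R]_m) : enorm (b + c *: a) ^+ 2 =
    enorm b ^+ 2 + c * (2 * dot b a) + c ^+ 2 * enorm a ^+ 2.
  by rewrite enorm_sqrD dotZr enormZ exprMn real_normK ?num_real //; ring.
split.
  (* Vary the second parameter, keeping the minimizer. *)
  apply/eqP; rewrite -subr_eq0; apply/eqP/enorm_row_eq0.
  set b := xi.2 - _; apply/eqP; rewrite -sqrf_eq0 enorm_sqr; apply/eqP/le_anti.
  rewrite dotaa_ge0 andbT -oppr_ge0.
  apply: (@ge0_of_eps _ _ (enorm b + (2 * gamma)^-1 * enorm b ^+ 2)).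
    by rewrite addr_ge0 ?enorm_ge0 // mulr_ge0 ?sqr_ge0 // invr_ge0 mulr_ge0 // ltW.
  move=> e /andP[e0 e1]; have [r r0 Hr] := Fxi' e e0.
  have q0 : 0 < Num.min r e by rewrite lt_min r0.
  have B0 : 0 <= enorm b + 1 by rewrite addr_ge0 ?enorm_ge0.
  have [t /andP[t0 t1]] := small_step q0 B0; rewrite lt_min => /andP[tr te].
  have zz : z + t *: (0, b) - z = (0, t *: b) :> Z.
    by rewrite addrAC subrr add0r; congr (_, _); rewrite /= scaler0.
  have tb0 : 0 <= t * enorm b by rewrite mulr_ge0 ?enorm_ge0 // ltW.
  have := Hr (z + t *: (0, b)) w; rewrite zz pnorm_snd0 enormZ (gtr0_norm t0).
  have E1 : (z + t *: (0, b) : Z).1 = z.1 by rewrite /= scaler0 addr0.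
  have E2 : (z + t *: (0, b) : Z).2 = z.2 + t *: b by [].
  rewrite E1 => /(_ _ Sw.1) => H; have {H} : _ := H _.
  rewrite /moreau_obj E1 E2 /pdot /= dot0r add0r dotZr.
  have -> : w - (z.2 + t *: b) = (w - z.2) + (- t) *: b.
    by rewrite opprD addrA scaleNr.
  rewrite dotnE sqrrN.
  have tr' : t * enorm b < r by move: tr; rewrite mulrDr mulr1; lra.
  move=> /(_ tr') H.
  have te' : t <= e by move: te tb0; rewrite mulrDr mulr1; lra.
  have bb : dot b b = dot xi.2 b - gamma^-1 * dot (z.2 - w) b.
    by rewrite {1}/b dotBl dotZl.
  have wz : dot (w - z.2) b = - dot (z.2 - w) b by rewrite -dotNl opprB.
  rewrite wz in H.
  have gE : (2 * gamma)^-1 = gamma^-1 / 2 by rewrite invfM mulrC.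
  rewrite -(pmulr_rge0 _ t0) bb.
  have c0 : 0 <= (2 * gamma)^-1 * enorm b ^+ 2.
    by rewrite mulr_ge0 ?sqr_ge0 // invr_ge0 mulr_ge0 // ltW.
  have c1 : t * (t * ((2 * gamma)^-1 * enorm b ^+ 2)) <=
            t * (e * ((2 * gamma)^-1 * enorm b ^+ 2)).
    by rewrite ler_wpM2l ?(ltW t0) // ler_wpM2r.
  move: H c1; rewrite gE; set Q := enorm b ^+ 2; set G := gamma^-1.
  set A := dot xi.2 b; set B := dot (z.2 - w) b; set f0 := f _.
  set W := enorm _ ^+ 2; set N := enorm b => H c1; lra.
(* Vary the first parameter and the feasible point. *)
pose Psi (q : Z) := phi (q.1, z.2) q.2 - dot xi.1 q.1.
pose q0 : Z := ((Df (z.1, w)).1 - xi.1, (Df (z.1, w)).2 + gamma^-1 *: (w - z.2)).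
have rr : 0 < r1 / 2 by rewrite divr_gt0.
have zE : (z.1, z.2) = z by case: z {ze zr Sw Fxi envz Fxi' Psi q0 ze1 Cs}.
have L0 : 0 <= 2 * L1 + pnorm xi by rewrite addr_ge0 ?pnorm_ge0 ?mulr_ge0 // ltW.
have [||||lam [lam0 lamg lamE]] := @bounded_multiplier_rule _ _ _ _ g Dg gD Psi
   (z.1, w) q0 (2 * L1 + pnorm xi) kap L0 (ltW kap0) Sw.1.
- (* [q0] is the gradient of [Psi] at the minimizer *)
  move=> e e0; have e20 : 0 < e / 2 by rewrite divr_gt0.
  have [r r0 Hr] := smooth_diff fD (z.1, w) e20.
  exists (Num.min r (gamma * e)); first by rewrite lt_min r0 mulr_gt0.
  move=> [x' w']; rewrite lt_min => /andP[q_r q_e].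
  have := Hr (x', w') q_r; rewrite /Psi /moreau_obj /q0 /pdot /=.
  set N := pnorm _ in q_r q_e *; rewrite !ler_norml.
  have N0 : 0 <= N by exact: pnorm_ge0.
  have -> : w' - z.2 = (w - z.2) + 1 *: (w' - w).
    by apply/rowP => j; rewrite !mxE; ring.
  rewrite dotnE expr1n !mul1r !(dotDl, dotBl, dotNl, dotZl).
  rewrite -!(dotDl, dotBl, dotNl, dotZl) dotBr.
  have gE : (2 * gamma)^-1 = gamma^-1 / 2 by rewrite invfM mulrC.
  rewrite gE.
  have dN : enorm (w' - w) <= N by exact: (enorm_snd ((x', w') - (z.1, w))).
  have dN2 : gamma^-1 * enorm (w' - w) ^+ 2 <= e * N.
    rewrite expr2 mulrA; apply: ler_pM => //; rewrite ?enorm_ge0 //.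
      by rewrite mulr_ge0 ?enorm_ge0 // invr_ge0 ltW.
    by rewrite mulrC ler_pdivrMr // mulrC; apply: le_trans dN (ltW q_e).
  have dN3 : 0 <= gamma^-1 * enorm (w' - w) ^+ 2.
    by rewrite mulr_ge0 ?sqr_ge0 // invr_ge0 ltW.
  rewrite !(dotDl, dotBl, dotNl, dotZl) !(dotDr, dotBr, dotNr, dotZr).
  by move=> /andP[h1 h2]; apply/andP; split; lra.
- (* the Lipschitz constant is uniform up to the norm of the subgradient *)
  exists (r1 / 2) => // q q' qr q'r.
  have near (q1 : Z) : pnorm (q1 - (z.1, w)) < r1 / 2 ->
      pnorm ((q1.1, z.2) - zb) < r1 /\ enorm (q1.2 - yb) < r1.
    move=> q1r; split.
      have -> : (q1.1, z.2) - zb = (q1.1 - z.1, 0) + (z - zb).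
        by congr (_, _); rewrite /= ?add0r // addrA subrK.
      apply: le_lt_trans (pnormD _ _) _; rewrite pnorm_fst0 [ltRHS]splitr ltrD //.
      by apply: le_lt_trans q1r; exact: (enorm_fst (q1 - (z.1, w))).
    have -> : q1.2 - yb = (q1.2 - w) + (w - yb) by rewrite addrA subrK.
    apply: le_lt_trans (enormD _ _) _; rewrite [ltRHS]splitr ltrD //.
    by apply: le_lt_trans q1r; exact: (enorm_snd (q1 - (z.1, w))).
  have [a1 a2] := near q qr; have [b1 b2] := near q' q'r.
  have := @H1 (q.1, z.2) (q'.1, z.2) q.2 q'.2 a1 b1 a2 b2.
  have -> : (q.1, z.2) - (q'.1, z.2) = (q.1 - q'.1, 0) :> Z.
    by congr (_, _); rewrite /= subrr.
  rewrite pnorm_fst0 => K1.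
  have -> : Psi q - Psi q' = (phi (q.1, z.2) q.2 - phi (q'.1, z.2) q'.2)
       - dot xi.1 (q.1 - q'.1) by rewrite /Psi dotBr; ring.
  apply: le_trans (ler_normB _ _) _; rewrite [leRHS]mulrDl.
  apply: lerD; last first.
    apply: le_trans (dot_le_enorm _ _) _; rewrite ler_pM ?enorm_ge0 //.
      exact: enorm_fst.
    exact: (enorm_fst (q - q')).
  apply: le_trans K1 _.
  have h : enorm (q.1 - q'.1) + enorm (q.2 - q'.2) <= pnorm (q - q') + pnorm (q - q').
    exact: lerD (enorm_fst (q - q')) (enorm_snd (q - q')).
  by have := ler_wpM2l (ltW L10) h; lra.
- (* a point of the graph is a competitor in the envelope at its own parameter *)
  move=> e e0; have [r r0 Hr] := Fxi' e e0; exists r => // q gq qr.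
  have E : (q.1, z.2) - z = (q.1 - z.1, 0) by congr (_, _); rewrite /= subrr.
  have q1 : enorm (q.1 - z.1) <= pnorm (q - (z.1, w)) by exact: (enorm_fst (q - (z.1, w))).
  have := Hr (q.1, z.2) q.2; rewrite E pnorm_fst0 => /(_ (le_lt_trans q1 qr)).
  have Fq : feas g q.1 q.2 by case: (q) gq.
  move=> /(_ Fq); rewrite /pdot dot0r addr0 /= dotBr /Psi /= zE => K1.
  have := ler_wpM2l (ltW e0) q1; lra.
- (* the parameters near [z.1] stay in the cone *)
  exists (Num.min s (eps / 2)); first by rewrite lt_min s0 divr_gt0.
  move=> q; rewrite lt_min => /andP[qs qe].
  have q1 : enorm (q.1 - z.1) < s.
    by apply: le_lt_trans qs; exact: (enorm_fst (q - (z.1, w))).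
  have q2 : enorm (q.1 - z.1) < eps / 2.
    by apply: le_lt_trans qe; exact: (enorm_fst (q - (z.1, w))).
  have q3 : enorm (q.2 - w) < eps / 2.
    by apply: le_lt_trans qe; exact: (enorm_snd (q - (z.1, w))).
  have x1 : enorm (q.1 - xb) < eps.
    have -> : q.1 - xb = (q.1 - z.1) + (z.1 - xb) by rewrite addrA subrK.
    by apply: le_lt_trans (enormD _ _) _; rewrite [ltRHS]splitr ltrD.
  have y1 : enorm (q.2 - yb) < eps.
    have -> : q.2 - yb = (q.2 - w) + (w - yb) by rewrite addrA subrK.
    by apply: le_lt_trans (enormD _ _) _; rewrite [ltRHS]splitr ltrD.
  have [y Fy Hy] := EB (Cs _ q1) x1 y1.
  exists (q.1, y) => //; rewrite (_ : _ - q = (0, y - q.2)).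
    by rewrite pnorm_snd0; case: (q) Hy.
  by case: (q) => ? ? /=; congr (_, _); rewrite /= subrr.
exists lam; split => //.
  move=> i; have /andP[-> lamK] := lam0 i; apply: le_trans lamK _.
  rewrite mulrAC ler_wpM2r ?(ltW kap0) //.
  have := pnorm_ge0 xi => P0; have := mulr_ge0 (ltW L10) P0; lra.
move=> h; rewrite -[RHS](lamE h); congr (_ + _).
rewrite /pdot /q0 /= [dot (_ - xi.1) _]dotBl [dot (_ + gamma^-1 *: _) _]dotDl dotZl; ring.
Qed.

Variable v : 'rV[R]_m.
Hypothesis f_gradient : forall x w w',
  f (x, w) + dot (Df (x, w)).2 (w' - w) - rho / 2 * enorm (w' - w) ^+ 2 <= f (x, w').
Hypothesis cmpN : forall i, g zb 0 i = 0 ->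
  comparable_from_nearby (component g i) (Dg i) xb yb u.
Hypothesis cmpR : forall i, g zb 0 i = 0 ->
  comparable_from_reference (component g i) (Dg i) xb yb u.

(** * Estimates of the value by multipliers *)

(** Multipliers of the lower-level problem, as functions of the index: the form
    in which the Farkas lemma produces them. *)
Definition kkt (lam : 'I_p -> R) : Prop :=
  [/\ forall i, 0 <= lam i, forall i, g zb 0 i != 0 -> lam i = 0 &
      forall b, dot (Df zb).2 b + \sum_i lam i * dot (Dg i zb).2 b = 0].

Definition lagrangian_slope (lam : 'I_p -> R) : R :=
  dot (Df zb).1 u + \sum_i lam i * dot (Dg i zb).1 u.

Let half_rho : rho / 2 <= (2 * gamma)^-1.
Proof.
have -> : (2 * gamma)^-1 = 1 / gamma / 2 by rewrite invfM mul1r mulrC.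
by rewrite ler_wpM2r // ltW.
Qed.

Let gammaE : gamma^-1 = 2 * (2 * gamma)^-1.
Proof. by rewrite invfM mulrA divff ?mul1r // pnatr_eq0. Qed.

Let half_gamma0 : 0 < (2 * gamma)^-1.
Proof. by rewrite invr_gt0 mulr_gt0. Qed.

Let moreau_objE x w b : phi (x, yb + b) w = f (x, w) +
  (2 * gamma)^-1 * (enorm (w - yb) ^+ 2 - 2 * dot (w - yb) b + enorm b ^+ 2).
Proof.
rewrite /moreau_obj /=; congr (_ + _ * _).
have -> : w - (yb + b) = (w - yb) + - b by rewrite opprD addrA.
by rewrite enorm_sqrD dotNr enormN; ring.
Qed.

(** At the nearby minimizer [w], pair its stationarity condition with [yb - w]:
    weak convexity bounds the term of [f], the comparison estimates bound the
    terms of the constraints, and the remaining multiple of the squared norm of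
    [yb - w] is nonpositive because [rho < 1 / gamma]. *)
Lemma upper_estimate e : 0 < e -> exists2 r : R, 0 < r &
  forall t a b w (lam : 'I_p -> R), 0 < t < r -> enorm (a - u) < r ->
    enorm (b - v) < r -> enorm (w - yb) < r ->
    (forall i, 0 <= lam i) ->
    (forall i, g (xb + t *: a, w) 0 i != 0 -> lam i = 0) ->
    (forall h, dot (Df (xb + t *: a, w)).2 h
        + gamma^-1 * dot (w - (yb + t *: b)) h
        + \sum_i lam i * dot (Dg i (xb + t *: a, w)).2 h = 0) ->
    phi (xb + t *: a, yb + t *: b) w - f zb <=
      t * (dot (Df zb).1 u + 2 * e + \sum_i lam i * (dot (Dg i zb).1 u + e)).
Proof.
move=> e0.
have [r1 r10 H1] := smooth_expand xb yb u 0 fD e0.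
have [r2 r20 H2] := inactive_near gD zb.
have [r3 r30 H3] : exists2 r : R, 0 < r & forall i t a w, 0 < t < r ->
    enorm (a - u) < r -> enorm (w - yb) < r -> g zb 0 i = 0 ->
    0 <= g (xb + t *: a, w) 0 i ->
    dot (Dg i (xb + t *: a, w)).2 (yb - w) <= t * (dot (Dg i zb).1 u + e).
  apply: (@common_radius _ _ (fun i r => forall t a w, 0 < t < r ->
    enorm (a - u) < r -> enorm (w - yb) < r -> g zb 0 i = 0 ->
    0 <= g (xb + t *: a, w) 0 i ->
    dot (Dg i (xb + t *: a, w)).2 (yb - w) <= t * (dot (Dg i zb).1 u + e))).
    move=> i r r' rr' H t a w /andP[t0 tr] ar wr.
    by apply: H; rewrite ?t0 ?(lt_le_trans tr) ?(lt_le_trans ar) ?(lt_le_trans wr).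
  move=> i; have [gi|gi] := eqVneq (g zb 0 i) 0.
    by have [r r0 H] := cmpN gi e0; exists r => // t a w tr ar wr _; exact: H.
  by exists 1 => // t a w _ _ _ E; rewrite E eqxx in gi.
have V0 : 0 <= enorm v + 1 by rewrite addr_ge0 ?enorm_ge0.
have [c1 /andP[c10 _] c1N] := small_step e0
  (mulr_ge0 (ltW half_gamma0) (mulr_ge0 V0 V0)).
have U0 : 0 <= enorm u + 1 by rewrite addr_ge0 ?enorm_ge0.
have r220 : 0 < r2 / 2 by rewrite divr_gt0.
have [c2 /andP[c20 _] c2N] := small_step r220 U0.
pose r := Num.min (Num.min 1 r1) (Num.min (Num.min (r2 / 2) r3) (Num.min c1 c2)).
exists r; first by rewrite /r !lt_min ltr01 r10 r220 r30 c10 c20.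
move=> t a b w lam /andP[t0]; rewrite /r !lt_min.
move=> /and3P[/andP[_ t1] /andP[_ t3] /andP[tc1 tc2]].
move=> /and3P[/andP[a_1 a1] /andP[_ a3] _] /and3P[/andP[b_1 _] _ _].
move=> /and3P[/andP[_ w1] /andP[w2 w3] _] lam0 lamg stat.
set x := xb + t *: a.
have an : enorm a <= enorm u + 1.
  by have := enormD (a - u) u; rewrite subrK; lra.
have bn : enorm b <= enorm v + 1.
  by have := enormD (b - v) v; rewrite subrK; lra.
have near : pnorm ((x, w) - zb) < r2.
  apply: le_lt_trans (pnorm_le_add _) _ => /=.
  rewrite addrAC subrr add0r enormZ (gtr0_norm t0) [ltRHS]splitr ltrD //.
  by apply: le_lt_trans c2N; rewrite ler_pM ?enorm_ge0 ?(ltW t0) ?(ltW tc2).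
have lamD i : lam i * dot (Dg i (x, w)).2 (yb - w) <=
    t * (lam i * (dot (Dg i zb).1 u + e)).
  have [gi|gi] := eqVneq (g zb 0 i) 0; last first.
    have gi' : g zb 0 i < 0 by rewrite lt_neqAle gi; exact: g_zb.
    by rewrite lamg ?mul0r ?mulr0 // lt_eqF // H2.
  have [gw|gw] := eqVneq (g (x, w) 0 i) 0; last by rewrite lamg // !mul0r mulr0.
  by rewrite mulrCA ler_wpM2l // H3 ?t0 // gw.
have sumD : \sum_i lam i * dot (Dg i (x, w)).2 (yb - w) <=
    t * \sum_i lam i * (dot (Dg i zb).1 u + e).
  by rewrite mulr_sumr; apply: ler_sum.
have := H1 t a yb; rewrite t0 t1 subrr enorm0 => /(_ isT a1 r10).
rewrite scaler0 addr0 /pdot /= dot0r addr0 ler_norml => /andP[_ K1].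
have K2 := f_gradient x w yb.
have K3 := stat (yb - w).
have wyE : w - (yb + t *: b) = - (yb - w) - t *: b.
  by apply/rowP => j; rewrite !mxE; ring.
rewrite wyE dotBl dotNl dotZl -enorm_sqr gammaE in K3.
rewrite moreau_objE enormZ (gtr0_norm t0) exprMn dotZr.
have -> : enorm (w - yb) = enorm (yb - w) by rewrite enormB.
have -> : dot (w - yb) b = - dot b (yb - w) by rewrite dotC -dotNr opprB.
have Q0 : 0 <= enorm (yb - w) ^+ 2 by exact: sqr_ge0.
have K4 := ler_wpM2r Q0 half_rho.
have K5 : (2 * gamma)^-1 * (t ^+ 2 * enorm b ^+ 2) <= t * e.
  have -> : (2 * gamma)^-1 * (t ^+ 2 * enorm b ^+ 2) =
    t * (t * ((2 * gamma)^-1 * (enorm b * enorm b))) by ring.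
  rewrite ler_wpM2l ?(ltW t0) //; apply: ltW; apply: le_lt_trans c1N.
  apply: ler_pM; rewrite ?(ltW t0) ?(ltW tc1) //.
    by rewrite mulr_ge0 ?(ltW half_gamma0) // mulr_ge0 ?enorm_ge0.
  by rewrite ler_wpM2l ?(ltW half_gamma0) // ler_pM ?enorm_ge0.
move: K1 K2 K3 K4 K5 sumD; rewrite -/x -/zb; clearbody x.
move: (enorm (yb - w) ^+ 2) (dot b (yb - w)) (f (x, w)) (f (x, yb)) (f zb).
move: (enorm b ^+ 2) ((2 * gamma)^-1) (\sum_i lam i * (dot (Dg i zb).1 u + e)).
move: (dot (Df (x, w)).2 (yb - w)) (\sum_i lam i * dot (Dg i (x, w)).2 (yb - w)).
move: (dot (Df zb).1 u) => A1 A2 A3 A4 A5 A6 A7 A8 A9 A10 A11 K1 K2 K3 K4 K5 K6.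
lra.
Qed.

(** The same argument with the roles exchanged: stationarity at the reference
    point, for any of its multipliers, paired with [w - yb]. *)
Lemma lower_estimate (mu : 'I_p -> R) e : kkt mu -> 0 < e -> exists2 r : R, 0 < r &
  forall t a b w, 0 < t < r -> enorm (a - u) < r ->
    enorm (b - v) < r -> enorm (w - yb) < r -> feas g (xb + t *: a) w ->
    t * (dot (Df zb).1 u - 2 * e + \sum_i mu i * (dot (Dg i zb).1 u - e)) <=
    phi (xb + t *: a, yb + t *: b) w - f zb.
Proof.
move=> [mu0 mug muD] e0.
have [r1 r10 H1] := smooth_expand xb yb u 0 fD e0.
have [r3 r30 H3] : exists2 r : R, 0 < r & forall i t a w, 0 < t < r ->
    enorm (a - u) < r -> enorm (w - yb) < r -> g zb 0 i = 0 ->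
    g (xb + t *: a, w) 0 i <= 0 ->
    dot (Dg i zb).2 (w - yb) <= t * (e - dot (Dg i zb).1 u).
  apply: (@common_radius _ _ (fun i r => forall t a w, 0 < t < r ->
    enorm (a - u) < r -> enorm (w - yb) < r -> g zb 0 i = 0 ->
    g (xb + t *: a, w) 0 i <= 0 ->
    dot (Dg i zb).2 (w - yb) <= t * (e - dot (Dg i zb).1 u))).
    move=> i r r' rr' H t a w /andP[t0 tr] ar wr.
    by apply: H; rewrite ?t0 ?(lt_le_trans tr) ?(lt_le_trans ar) ?(lt_le_trans wr).
  move=> i; have [gi|gi] := eqVneq (g zb 0 i) 0.
    by have [r r0 H] := cmpR gi e0; exists r => // t a w tr ar wr _; exact: H.
  by exists 1 => // t a w _ _ _ E; rewrite E eqxx in gi.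
have V0 : 0 <= enorm v + 1 by rewrite addr_ge0 ?enorm_ge0.
have g2 : 0 <= 2 * (2 * gamma)^-1 by rewrite mulr_ge0 // ltW.
have [c1 /andP[c10 _] c1N] := small_step e0 (mulr_ge0 g2 V0).
pose r := Num.min (Num.min 1 r1) (Num.min r3 c1).
exists r; first by rewrite /r !lt_min ltr01 r10 r30 c10.
move=> t a b w /andP[t0]; rewrite /r !lt_min.
move=> /andP[/andP[_ t1] /andP[t3 tc1]].
move=> /andP[/andP[_ a1] /andP[a3 _]] /andP[/andP[b_1 _] _].
move=> /andP[/andP[_ w1] /andP[w3 wc]] Fw.
set x := xb + t *: a.
have bn : enorm b <= enorm v + 1.
  by have := enormD (b - v) v; rewrite subrK; lra.
have muDi i : mu i * dot (Dg i zb).2 (w - yb) <= t * (mu i * (e - dot (Dg i zb).1 u)).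
  have [gi|gi] := eqVneq (g zb 0 i) 0; last by rewrite mug // !mul0r mulr0.
  by rewrite mulrCA ler_wpM2l // (H3 i t a w) ?t0 //; exact: Fw.
have sumD : \sum_i mu i * dot (Dg i zb).2 (w - yb) <=
    - (t * \sum_i mu i * (dot (Dg i zb).1 u - e)).
  rewrite mulr_sumr -sumrN; apply: ler_sum => i _.
  by apply: le_trans (muDi i) _; rewrite -mulrN -mulrN opprB.
have := H1 t a w; rewrite t0 t1 => /(_ isT a1 w1).
rewrite scaler0 addr0 /pdot /= dot0r addr0 ler_norml => /andP[K1 _].
have K2 := f_gradient xb yb w.
have K3 := muD (w - yb).
rewrite moreau_objE enormZ (gtr0_norm t0) exprMn dotZr.
have Q0 : 0 <= enorm (w - yb) ^+ 2 by exact: sqr_ge0.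
have K4 := ler_wpM2r Q0 half_rho.
have K5 : (2 * gamma)^-1 * (2 * dot (w - yb) b) <= e.
  rewrite mulrCA mulrA; apply: le_trans (_ : c1 * (2 * (2 * gamma)^-1 * (enorm v + 1)) <= _); last exact: ltW.
  rewrite mulrCA ler_wpM2l //; apply: le_trans (cauchy_schwarz _ _) _.
  by rewrite ler_pM ?enorm_ge0 // ltW.
have K6 := ler_wpM2l (ltW t0) K5.
have K7 : 0 <= (2 * gamma)^-1 * (t ^+ 2 * enorm b ^+ 2).
  by rewrite mulr_ge0 ?(ltW half_gamma0) // mulr_ge0 ?sqr_ge0.
move: K1 K2 K3 K4 K6 K7 sumD; rewrite -/x -/zb; clearbody x.
move: (enorm (w - yb) ^+ 2) (dot (w - yb) b) (f (x, w)) (f (xb, w)) (f zb).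
move: (enorm b ^+ 2) ((2 * gamma)^-1) (\sum_i mu i * (dot (Dg i zb).1 u - e)).
move: (dot (Df zb).2 (w - yb)) (\sum_i mu i * dot (Dg i zb).2 (w - yb)).
move: (dot (Df zb).1 u) => A1 A2 A3 A4 A5 A6 A7 A8 A9 A10 A11 K1 K2 K3 K4 K5' K6' K7'.
lra.
Qed.

(** Linear programming duality. If no such direction existed, the Farkas lemma
    would give a direction [tau] along which multipliers can be moved from [lam]
    with unit increase of the slope of the Lagrangian. *)
Lemma optimal_multiplier_direction (lam : 'I_p -> R) : kkt lam ->
  (forall mu, kkt mu -> lagrangian_slope mu <= lagrangian_slope lam) ->
  exists d, (forall i, g zb 0 i = 0 -> pdot (Dg i zb) (u, d) <= 0) /\
    forall i, lam i * pdot (Dg i zb) (u, d) = 0.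
Proof.
move=> [lam0 lamg lamD] lam_max.
pose V := ('rV[R]_m * R^o)%type.
pose L i (q : V) : R := dot (Dg i zb).1 u * q.2 + dot (Dg i zb).2 q.1.
pose al (j : 'I_(p + p)) (q : V) : R := match split j with
  | inl i => if g zb 0 i == 0 then L i q else 0
  | inr i => if lam i == 0 then 0 else - L i q end.
have lL i : scalar (L i).
  by move=> c q q' /=; rewrite /L /= dotDr dotZr /GRing.scale /=; ring.
have lal j : scalar (al j).
  move=> c q q' /=; rewrite /al; case: split => i; case: ifP => _ /=;
    rewrite ?(lL i c) /=; ring.
have lc : scalar (fun q : V => q.2 : R) by move=> c q q'.
have [H|] := pselect (forall q : V, (forall j, al j q <= 0) -> q.2 <= 0).
  have [nu nu0 nuE] := farkas lal lc H.
  pose tau i := (if g zb 0 i == 0 then nu (lshift p i) else 0) -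
                (if lam i == 0 then 0 else nu (rshift p i)).
  have tauE b (s : R) : s = \sum_i tau i * L i (b, s : R^o).
    rewrite {1}(nuE (b, s : R^o) : s = _) big_split_ord /= -big_split /=.
    apply: eq_bigr => i _; rewrite /al (unsplitK (inl i)) (unsplitK (inr i)) /tau.
    by case: ifP => _; case: ifP => _; ring.
  have tau_pos i : 0 < lam i \/ 0 <= tau i.
    rewrite /tau; case: (eqVneq (lam i) 0) => [_|l0].
      by right; rewrite subr0; case: ifP.
    by left; rewrite lt_neqAle eq_sym l0 lam0.
  have [r r0 Hr] : exists2 r : R, 0 < r & forall i s, 0 <= s <= r -> 0 <= lam i + s * tau i.
    apply: (@common_radius _ _ (fun i r => forall s, 0 <= s <= r -> 0 <= lam i + s * tau i)).
      by move=> i r r' rr' H' s /andP[s0 sr]; apply: H'; rewrite s0 (le_trans sr).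
    move=> i; have [li|ti] := tau_pos i; last first.
      by exists 1 => // s /andP[s0 _]; rewrite addr_ge0 // mulr_ge0.
    have [s /andP[s0 s1] sN] := small_step li (normr_ge0 (tau i)).
    exists s => // s' /andP[s'0 s's].
    have h : s' * `|tau i| <= s * `|tau i| by rewrite ler_wpM2r.
    have := ler_norm (- tau i); rewrite normrN => h'.
    have := ler_wpM2l s'0 h'; lra.
  pose mu i := lam i + r * tau i.
  have muE (X : 'I_p -> R) :
      \sum_i mu i * X i = \sum_i lam i * X i + r * \sum_i tau i * X i.
    by rewrite mulr_sumr -big_split /=; apply: eq_bigr => i _; rewrite /mu; ring.
  have mu_kkt : kkt mu.
    split=> [i|i gi|b].
    - by apply: Hr; rewrite lexx ltW.
    - by rewrite /mu /tau lamg // (negbTE gi) eqxx subrr mulr0 addr0.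
    - rewrite muE addrA lamD add0r.
      have -> : \sum_i tau i * dot (Dg i zb).2 b = 0; last by rewrite mulr0.
      rewrite [RHS](tauE b 0); apply: eq_bigr => i _.
      by rewrite /L /= mulr0 add0r.
  have := lam_max mu mu_kkt; rewrite /lagrangian_slope lerD2l muE.
  have -> : \sum_i tau i * dot (Dg i zb).1 u = 1.
    rewrite [RHS](tauE 0 1); apply: eq_bigr => i _.
    by rewrite /L /= dot0r mulr1 addr0.
  lra.
move=> /existsNP [[d s] /not_implyP [Hv /negP]]; rewrite -ltNge /= => s0.
have LE i : L i (d, s : R^o) = s * pdot (Dg i zb) (u, s^-1 *: d).
  by rewrite /L /pdot /= dotZr mulrDr mulrA divff ?gt_eqF // mul1r mulrC.
exists (s^-1 *: d); have dir i : g zb 0 i = 0 -> pdot (Dg i zb) (u, s^-1 *: d) <= 0.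
  move=> gi; have := Hv (lshift p i); rewrite /al (unsplitK (inl i)) gi eqxx LE.
  by rewrite pmulr_rle0.
split => // i; have [->|li] := eqVneq (lam i) 0; first by rewrite mul0r.
have gi : g zb 0 i = 0.
  by apply/eqP; apply: contraNT li => /lamg ->; rewrite eqxx.
have := Hv (rshift p i); rewrite /al (unsplitK (inr i)) (negbTE li) LE.
rewrite oppr_le0 pmulr_rge0 // => h.
have -> : pdot (Dg i zb) (u, s^-1 *: d) = 0 by apply/le_anti; rewrite h dir.
by rewrite mulr0.
Qed.

(** * Directional subgradients of the envelope *)

(** The multipliers at the minimizers along the sequence are bounded and have a
    limit [lam], which represents the subgradient. Along the same sequence the
    value is at most the slope of the Lagrangian for [lam] (upper estimate) and
    at least the slope for every other multiplier (lower estimate), up to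
    [o(t)]. So [lam] maximizes that slope among all multipliers, and duality
    provides the direction. *)
Lemma dir_subdiff_multiplier xi : dir_subdiff env zb (u, v) xi ->
  exists lam, [/\ kkt lam,
    forall h : Z, pdot xi h =
      dot (Df zb).1 h.1 + \sum_i lam i * dot (Dg i zb).1 h.1 &
    exists d, (forall i, g zb 0 i = 0 -> pdot (Dg i zb) (u, d) <= 0) /\
      forall i, lam i * pdot (Dg i zb) (u, d) = 0].
Proof.
move=> [t [d_ [xi_ [[t0 tlim] dlim _ xilim sub]]]].
pose x_ k : 'rV[R]_n := xb + t k *: (d_ k).1.
pose z_ k : Z := (x_ k, yb + t k *: (d_ k).2).
have near_seq (r : R) : 0 < r -> \forall k \near \oo,
    [/\ t k < r, enorm ((d_ k).1 - u) < r, enorm ((d_ k).2 - v) < r &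
        pnorm (xi_ k - xi) < r].
  move=> r0.
  have h1 : \forall k \near \oo, t k < r.
    apply: filterS (cvgr0_norm_lt _ tlim _ r0) => k.
    by rewrite gtr0_norm.
  have h2 : \forall k \near \oo, pnorm (d_ k - (u, v)) < r.
    exact: dlim _ (near_pnorm_lt _ r0).
  have h3 : \forall k \near \oo, pnorm (xi_ k - xi) < r.
    exact: xilim _ (near_pnorm_lt _ r0).
  near=> k.
  have dk : pnorm (d_ k - (u, v)) < r by near: k.
  split; [by near: k | | | by near: k].
    by apply: le_lt_trans dk; exact: (enorm_fst (d_ k - (u, v))).
  by apply: le_lt_trans dk; exact: (enorm_snd (d_ k - (u, v))).
have near_z (r : R) : 0 < r -> \forall k \near \oo,
    pnorm (z_ k - zb) < r /\ enorm (x_ k - xb) < r.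
  move=> r0; pose N := pnorm (u, v) + 2.
  have N0 : 0 <= N by rewrite addr_ge0 ?pnorm_ge0.
  have [c /andP[c0 c1] cN] := small_step r0 N0.
  apply: filterS (near_seq c c0) => k [tk a1 a2 _].
  have E : z_ k - zb = t k *: d_ k.
    by rewrite /z_ /x_; case: (d_ k) => a b; congr (_, _) => /=; rewrite addrAC subrr add0r.
  have zr : pnorm (z_ k - zb) < r.
    rewrite E pnormZ (gtr0_norm (t0 k)); apply: le_lt_trans cN.
    apply: ler_pM; rewrite ?pnorm_ge0 ?(ltW (t0 k)) ?(ltW tk) //.
    have := pnormD (d_ k - (u, v)) (u, v); rewrite subrK.
    have := pnorm_le_add (d_ k - (u, v)) => /=; rewrite /N; lra.
  by split => //; apply: le_lt_trans zr; exact: (enorm_fst (z_ k - zb)).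
have near_cone : \forall k \near \oo,
    exists2 s : R, 0 < s & forall x, enorm (x - x_ k) < s -> cone x.
  have d20 : 0 < del / 2 by rewrite divr_gt0.
  apply: filterS (near_seq _ d20) => k [_ ak _ _].
  exists (t k * (del / 2)) => [|x xk]; first by rewrite mulr_gt0.
  exists (t k); first exact: ltW.
  have -> : x - xb - t k *: u = (x - x_ k) + t k *: ((d_ k).1 - u).
    by apply/rowP => j; rewrite !mxE; ring.
  apply: le_trans (enormD _ _) _; rewrite enormZ (gtr0_norm (t0 k)).
  have := ltW (t0 k) => t0'; have := ler_wpM2l t0' (ltW ak); lra.
have sol_near (r : R) : 0 < r -> \forall k \near \oo,
    exists2 w, Sgamma f g gamma (z_ k) w & enorm (w - yb) < r.
  move=> r0.
  have [e e0 He] := cone_solution r0.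
  apply: filterS2 near_cone (near_z e e0) => k [s s0 Hs] [zk _].
  by apply: He => //; apply: Hs; rewrite subrr enorm0.
have [k|w_ Hw_] := @choice nat 'rV[R]_m (fun k w =>
    (exists w', Sgamma f g gamma (z_ k) w') -> Sgamma f g gamma (z_ k) w).
  by have [[w Sw]|nw] := pselect (exists w, Sgamma f g gamma (z_ k) w);
    [exists w | exists 0 => /nw].
have near_w (r : R) : 0 < r -> \forall k \near \oo,
    Sgamma f g gamma (z_ k) (w_ k) /\ enorm (w_ k - yb) < r.
  move=> r0; apply: filterS (sol_near r r0) => k [w Sw wr].
  have Swk : Sgamma f g gamma (z_ k) (w_ k) by apply: Hw_; exists w.
  split => //.
  by rewrite -(Sgamma_unique gamma0 rho_gamma feas_convex f_semiconvex Sw Swk).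
have [r r0 [K K0 HK]] := frechet_subdiff_multipliers.
pose P k (lam : 'I_p -> R) := [/\ forall i, 0 <= lam i <= K * (1 + pnorm (xi_ k)),
      forall i, g (x_ k, w_ k) 0 i != 0 -> lam i = 0 &
      forall h : Z, pdot (Df (x_ k, w_ k)) h + gamma^-1 * dot (w_ k - (z_ k).2) h.2
        - dot (xi_ k).1 h.1 + \sum_i lam i * pdot (Dg i (x_ k, w_ k)) h = 0].
have near_P : \forall k \near \oo,
    (xi_ k).2 = gamma^-1 *: ((z_ k).2 - w_ k) /\ exists lam, P k lam.
  apply: filterS3 near_cone (near_z r r0) (near_w r r0) => k Ck [zk _] [Sk wk].
  have sub' : frechet_subdiff env (z_ k) (xi_ k).
    have -> : z_ k = zb + t k *: d_ k by rewrite /z_ /x_; case: (d_ k).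
    exact: sub.
  by have [? ?] := HK (z_ k) (w_ k) (xi_ k) Ck zk wk Sk sub'.
have [k|lam_ Hlam_] := @choice nat 'rV[R]_p (fun k lam =>
    (exists lam', P k lam') -> P k (fun i => lam 0 i)).
  have [[lam Pl]|nl] := pselect (exists lam, P k lam); last by exists 0 => /nl.
  exists (\row_i lam i) => _; suff -> : (fun i => (\row_j lam j) 0 i) = lam by [].
  by apply/funext => i; rewrite mxE.
have lam_bd : \forall k \near \oo, enorm (lam_ k) <= p%:R * (K * (2 + pnorm xi)).
  apply: filterS2 near_P (near_seq 1 ltr01) => k [_ /Hlam_ [lk _ _]] [_ _ _ xk].
  apply: le_trans (enorm_le_sum _) _.
  apply: le_trans (_ : \sum_(i < p) K * (2 + pnorm xi) <= _); last first.
    by rewrite sumr_const card_ord -[leLHS]mulr_natl.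
  apply: ler_sum => i _; have /andP[l0 l1] := lk i; rewrite ger0_norm //.
  apply: le_trans l1 _; rewrite ler_wpM2l ?(ltW K0) //.
  by have := pnormD (xi_ k - xi) xi; rewrite subrK; lra.
have [U [lam [PU sU laml]]] := bounded_ultra lam_bd.
have lam_cvg i : (fun k => lam_ k 0 i) @ U --> lam 0 i.
  apply: cvg_eps => e e0; apply: filterS (laml e e0) => k; apply: le_lt_trans.
  have := le_trans (coord_le_norm (lam_ k - lam) i) (norm_le_enorm _).
  by rewrite !mxE.
have q_near (e : R) : 0 < e -> \forall k \near U, pnorm ((x_ k, w_ k) - zb) < e.
  move=> e0; have e20 : 0 < e / 2 by rewrite divr_gt0.
  apply: sU; apply: filterS2 (near_z _ e20) (near_w _ e20) => k [_ xk] [_ wk].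
  by apply: le_lt_trans (pnorm_le_add _) _; rewrite /= [ltRHS]splitr ltrD.
have zw_cvg b : (fun k => gamma^-1 * dot (w_ k - (z_ k).2) b) @ U --> (0 : R).
  apply: cvg_eps => e e0; apply: sU.
  have B0 : 0 <= gamma^-1 * (2 * enorm b).
    by rewrite mulr_ge0 ?invr_ge0 ?(ltW gamma0) // mulr_ge0 ?enorm_ge0.
  have [c /andP[c0 _] cN] := small_step e0 B0.
  apply: filterS2 (near_z _ c0) (near_w _ c0) => k [zk _] [_ wk].
  rewrite subr0 normrM (gtr0_norm (_ : 0 < gamma^-1)) ?invr_gt0 //.
  apply: le_lt_trans cN; rewrite mulrCA ler_wpM2l ?invr_ge0 ?(ltW gamma0) //.
  apply: le_trans (dot_le_enorm _ _) _; rewrite mulrA [c * 2]mulrC.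
  rewrite ler_wpM2r ?enorm_ge0 //.
  have -> : w_ k - (z_ k).2 = (w_ k - yb) - ((z_ k).2 - yb).
    by rewrite opprB addrA subrK.
  apply: le_trans (enormD _ _) _; rewrite enormN.
  have := enorm_snd (z_ k - zb) => /= h; lra.
have xi_cvg (h : Z) : (fun k => pdot (xi_ k) h) @ U --> pdot xi h.
  apply: cvg_eps => e e0; apply: sU.
  have [c /andP[c0 _] cN] := small_step e0 (pnorm_ge0 h).
  apply: filterS (near_seq c c0) => k [_ _ _ xk]; rewrite -pdotBl.
  apply: le_lt_trans (pdot_le _ _) _; apply: le_lt_trans cN.
  by rewrite ler_wpM2r ?pnorm_ge0 // ltW.
have nearU_P : \forall k \near U, (xi_ k).2 = gamma^-1 *: ((z_ k).2 - w_ k) /\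
    P k (fun i => lam_ k 0 i).
  by apply: sU; apply: filterS near_P => k [-> /Hlam_ Pk].
have xi2 b : pdot xi (0, b) = 0.
  apply: (@cvg_eq_near _ _ _ PU
    (fun k => pdot (xi_ k) (0, b) + gamma^-1 * dot (w_ k - (z_ k).2) b)).
    by rewrite -[pdot xi _]addr0; apply: cvgD; [exact: xi_cvg | exact: zw_cvg].
  apply: filterS nearU_P => k [E _].
  by rewrite /pdot E dot0r add0r dotZl -mulrDr -dotDl addrA subrK subrr dot0l mulr0.
have stat (h : Z) : pdot (Df zb) h + 0 - pdot xi (h.1, 0)
    + \sum_i lam 0 i * pdot (Dg i zb) h = 0.
  apply: (@cvg_eq_near _ _ _ PU (fun k => pdot (Df (x_ k, w_ k)) h
     + gamma^-1 * dot (w_ k - (z_ k).2) h.2 - pdot (xi_ k) (h.1, 0)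
     + \sum_i lam_ k 0 i * pdot (Dg i (x_ k, w_ k)) h)).
    apply: cvgD; last first.
      apply: cvg_sumr => i; apply: cvgM; first exact: lam_cvg.
      exact: smooth_cvg (gD i) q_near.
    apply: cvgB; last exact: xi_cvg.
    by apply: cvgD; [exact: smooth_cvg fD q_near | exact: zw_cvg].
  apply: filterS nearU_P => k [_ [_ _ S]].
  by rewrite {2}/pdot /= dot0r addr0 S.
have lam0 i : 0 <= lam 0 i.
  apply: (cvgr_to_ge (lam_cvg i)); apply: filterS nearU_P => k [_ [lk _ _]].
  by have /andP[] := lk i.
have lamg i : g zb 0 i != 0 -> lam 0 i = 0.
  move=> gi; have [s s0 Hs] := inactive_near gD zb.
  apply: (cvg_eq_near PU (lam_cvg i)).
  apply: filterS2 nearU_P (q_near s s0) => k [_ [_ lk _]] qk.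
  apply: lk; rewrite lt_eqF // Hs // lt_neqAle gi.
  exact: g_zb.
have lam_kkt : kkt (fun i => lam 0 i).
  split => // b; have := stat (0, b); rewrite /= pdot0r subr0 addr0.
  rewrite /pdot /= dot0r add0r => E; rewrite -[RHS]E; congr (_ + _).
  by apply: eq_bigr => i _; rewrite dot0r add0r.
exists (fun i => lam 0 i); split => //.
  move=> h; have := stat (h.1, 0); rewrite /= addr0 addrAC => /eqP.
  rewrite subr_eq0 => /eqP E.
  have -> : h = (h.1, 0) + (0, h.2) by case: h {E} => a b; congr (_, _); rewrite /= ?addr0 ?add0r.
  rewrite pdotDr xi2 addr0 -E /= addr0 {1}/pdot /= dot0r addr0; congr (_ + _).
  by apply: eq_bigr => i _; rewrite /pdot /= dot0r addr0.
apply: (optimal_multiplier_direction lam_kkt) => mu mu_kkt.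
(* Compare the two estimates of the value along the sequence. *)
rewrite -subr_ge0.
pose SL := \sum_i lam 0 i; pose SM := \sum_i mu i.
have SL0 : 0 <= SL by exact: sumr_ge0.
have SM0 : 0 <= SM by case: mu_kkt => mu0 _ _; exact: sumr_ge0.
have C0 : 0 <= 4 + SL + SM by rewrite !addr_ge0.
apply: (ge0_of_eps C0) => e /andP[e0 _].
have [r1 r10 H1] := upper_estimate e0.
have [r2 r20 H2] := lower_estimate mu_kkt e0.
have r120 : 0 < Num.min r1 r2 by rewrite lt_min r10.
have lim_cvg : (fun k => \sum_i lam_ k 0 i * (dot (Dg i zb).1 u + e)) @ U -->
    \sum_i lam 0 i * (dot (Dg i zb).1 u + e).
  apply: cvg_sumr => i; apply: cvgM; first exact: lam_cvg.
  exact: cvg_cst.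
have : dot (Df zb).1 u - 2 * e + \sum_i mu i * (dot (Dg i zb).1 u - e)
    - (dot (Df zb).1 u + 2 * e) <= \sum_i lam 0 i * (dot (Dg i zb).1 u + e).
  apply: (cvgr_to_ge lim_cvg).
  apply: filterS3 nearU_P (sU _ (near_seq _ r120)) (sU _ (near_w _ r120)).
  move=> k [_ [lk gk Sk]] [tk ak bk _] [Swk wk].
  move: tk ak bk wk; rewrite !lt_min.
  move=> /andP[t1 t2] /andP[a1 a2] /andP[b1 b2] /andP[w1 w2].
  have K1 := H1 (t k) (d_ k).1 (d_ k).2 (w_ k) (fun i => lam_ k 0 i).
  have {}K1 := K1 (introT andP (conj (t0 k) t1)) a1 b1 w1 _ gk.
  have {}K1 : moreau_obj f gamma (z_ k) (w_ k) - f zb <= t k *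
      (dot (Df zb).1 u + 2 * e + \sum_i lam_ k 0 i * (dot (Dg i zb).1 u + e)).
    apply: K1 => [i|h]; first by have /andP[] := lk i.
    have := Sk (0, h); rewrite /= dot0r subr0 {1}/pdot /= dot0r add0r => E.
    rewrite -[RHS]E; congr (_ + _); apply: eq_bigr => i _.
    by rewrite /pdot /= dot0r add0r.
  have K2 := H2 (t k) (d_ k).1 (d_ k).2 (w_ k) (introT andP (conj (t0 k) t2)) a2 b2 w2 Swk.1.
  have := le_trans K2 K1; rewrite ler_pM2l // => K3.
  lra.
rewrite /lagrangian_slope.
have -> : \sum_i mu i * (dot (Dg i zb).1 u - e) =
    \sum_i mu i * dot (Dg i zb).1 u - e * SM.
  by rewrite mulr_sumr -sumrB; apply: eq_bigr => i _; ring.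
have -> : \sum_i lam 0 i * (dot (Dg i zb).1 u + e) =
    \sum_i lam 0 i * dot (Dg i zb).1 u + e * SL.
  by rewrite mulr_sumr -big_split /=; apply: eq_bigr => i _; ring.
rewrite -/zb; lra.
Unshelve. all: by end_near.
Qed.

(** The error bound corrects points along the linearized direction [d'] to
    feasible ones at a cost of [o(t)], and these are competitors in the envelope;
    the regularizing term is of order [t ^ 2] whatever [d] is. *)
Lemma upper_dd_le d d' : (forall i, g zb 0 i = 0 -> pdot (Dg i zb) (u, d') <= 0) ->
  (upper_dd env zb (u, d) <= (pdot (Df zb) (u, d'))%:E)%E.
Proof.
move=> dir.
set A := pdot (Df zb) (u, d'); set N := pnorm (u, d').
have N0 : 0 <= N by exact: pnorm_ge0.
have fzb : env zb = (f zb)%:E.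
  by rewrite (moreau_argmin S_zb) /moreau_obj subrr enorm0 expr0n mulr0 addr0.
have [rL rL0 [L L0 HL]] := smooth_lipschitz fD zb.
suff H (e : R) : 0 < e -> (upper_dd env zb (u, d) <= (A + e)%:E)%E.
  by apply/lee_addgt0Pr => e e0; rewrite -EFinD; exact: H.
move=> e0.
have e20 : 0 < e / 2 by rewrite divr_gt0.
have C10 : 0 <= N * (1 + L * kap).
  by rewrite mulr_ge0 // addr_ge0 // mulr_ge0 // ltW.
have [e1 /andP[e10 _] e1N] := small_step e20 C10.
have [r1 r10 H1] := smooth_diff fD zb e10.
have [r2 r20 H2] := gplus_expand gD g_zb e10.
pose M := kap * (e1 * N) + enorm (d' - d).
have M0 : 0 <= M by rewrite addr_ge0 ?enorm_ge0 // !mulr_ge0 // ltW.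
have c0 : 0 < (2 * gamma)^-1 by rewrite invr_gt0 mulr_gt0.
have C20 : 0 <= (2 * gamma)^-1 * (M * M) by rewrite mulr_ge0 ?(ltW c0) ?mulr_ge0.
have [t1 /andP[t10 _] t1C] := small_step e20 C20.
pose B := N + kap * (e1 * N) + 1 + enorm u + enorm d'.
have K0 : 0 <= kap * (e1 * N) by rewrite !mulr_ge0 // ltW.
have B0 : 0 <= B by rewrite !addr_ge0 ?enorm_ge0.
have r0 : 0 < Num.min eps (Num.min rL (Num.min r1 r2)).
  by rewrite !lt_min eps0 rL0 r10.
have [t2 /andP[t20 _] t2B] := small_step r0 B0.
pose rt := Num.min t1 t2; have rt0 : 0 < rt by rewrite lt_min t10.
apply: ereal_inf_le; exists (ereal_sup (diff_quot env zb (u, d) @` [set t : R | 0 < t < rt])).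
  exists [set t : R | 0 < t < rt] => //.
  near=> t => /=; apply/andP; split.
    by near: t; exact: nbhs_right_gt.
  by near: t; exact: nbhs_right_lt.
apply: ge_ereal_sup => _ [t /= /andP[t0 +] <-]; rewrite lt_min => /andP[tt1 tt2].
have t0' := ltW t0.
have tB : t * B < Num.min eps (Num.min rL (Num.min r1 r2)).
  by apply: le_lt_trans t2B; rewrite ler_wpM2r // ltW.
have tlt (c : R) : 0 <= c -> c <= B -> [/\ t * c < eps, t * c < rL, t * c < r1 & t * c < r2].
  move=> c00 cB; have := le_lt_trans (ler_wpM2l t0' cB) tB.
  by rewrite !lt_min => /and4P[? ? ? ?].
have U0 := enorm_ge0 u; have D0 := enorm_ge0 d'.
pose b := yb + t *: d'; pose q : Z := (xb + t *: u, b).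
have qz : q - zb = t *: (u, d').
  by congr (_, _); rewrite /= addrAC subrr add0r.
have qN : pnorm (q - zb) = t * N by rewrite qz pnormZ gtr0_norm.
have [_ NL N1 N2] : [/\ t * N < eps, t * N < rL, t * N < r1 & t * N < r2].
  by apply: tlt => //; rewrite /B; lra.
have [ue _ _ _] : [/\ t * enorm u < eps, t * enorm u < rL, t * enorm u < r1 & t * enorm u < r2].
  by apply: tlt => //; rewrite /B; lra.
have [de _ _ _] : [/\ t * enorm d' < eps, t * enorm d' < rL, t * enorm d' < r1 & t * enorm d' < r2].
  by apply: tlt => //; rewrite /B; lra.
have [_ NKL _ _] : [/\ t * (N + kap * (e1 * N)) < eps, t * (N + kap * (e1 * N)) < rL,
    t * (N + kap * (e1 * N)) < r1 & t * (N + kap * (e1 * N)) < r2].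
  by apply: tlt; [exact: addr_ge0 | rewrite /B; lra].
have gq : gplus g q <= t * (e1 * N).
  have := H2 q; rewrite qN => /(_ N2) /le_trans; apply.
  rewrite big1 ?add0r; first by rewrite mulrCA.
  move=> i _; apply/max_idPr; case: eqVneq => // gi.
  by rewrite qz pdotZr pmulr_rle0 // dir.
have [w Fw Hw] : exists2 w, feas g (xb + t *: u) w & enorm (w - b) <= kap * gplus g q.
  have xt : xb + t *: u - xb = t *: u by rewrite [xb + _]addrC addrK.
  apply: EB.
  - by exists t => //; rewrite xt subrr enorm0 mulr_ge0 // ltW.
  - by rewrite xt enormZ gtr0_norm.
  - by rewrite /b addrAC subrr add0r enormZ gtr0_norm.
have wb : enorm (w - b) <= t * (kap * (e1 * N)).
  by apply: le_trans Hw _; rewrite mulrCA ler_wpM2l // ltW.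
pose q' : Z := (xb + t *: u, w).
have q'q : q' - q = (0, w - b) by congr (_, _); rewrite /= subrr.
have q'r : pnorm (q' - zb) < rL.
  have -> : q' - zb = (q' - q) + (q - zb) by rewrite addrA subrK.
  apply: le_lt_trans (pnormD _ _) _; rewrite q'q pnorm_snd0 qN.
  by apply: le_lt_trans NKL; rewrite mulrDr addrC lerD2l.
have K1 : f q' - f q <= L * (t * (kap * (e1 * N))).
  have qr : pnorm (q - zb) < rL by rewrite qN.
  apply: le_trans (ler_norm _) _; apply: le_trans (HL _ _ q'r qr) _.
  by rewrite q'q pnorm_snd0 ler_wpM2l // ltW.
have K2 : f q - f zb <= t * A + e1 * (t * N).
  have := H1 q; rewrite qN => /(_ N1); rewrite qz pdotZr ler_norml => /andP[_].
  by rewrite -/A; lra.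
have K3 : enorm (w - (yb + t *: d)) <= t * M.
  have -> : w - (yb + t *: d) = (w - b) + t *: (d' - d).
    by apply/rowP => j; rewrite /b !mxE; ring.
  by apply: le_trans (enormD _ _) _; rewrite enormZ (gtr0_norm t0) /M mulrDr lerD2r.
have K4 : (2 * gamma)^-1 * enorm (w - (yb + t *: d)) ^+ 2 <= t * (e / 2).
  apply: le_trans (_ : (2 * gamma)^-1 * ((t * M) * (t * M)) <= _).
    by rewrite ler_wpM2l ?(ltW c0) // expr2 ler_pM ?enorm_ge0.
  have -> : (2 * gamma)^-1 * (t * M * (t * M)) = t * (t * ((2 * gamma)^-1 * (M * M))).
    by ring.
  rewrite ler_wpM2l //; apply: ltW; apply: le_lt_trans t1C.
  by rewrite ler_wpM2r // ltW.
have zE : zb + t *: (u, d) = (xb + t *: u, yb + t *: d) by [].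
have envle := @moreau_le _ _ _ _ f g gamma (zb + t *: (u, d)) w Fw.
rewrite /diff_quot fzb; apply: (@le_trans _ _
    (((moreau_obj f gamma (zb + t *: (u, d)) w)%:E - (f zb)%:E) * (t^-1)%:E)%E).
  apply: lee_wpmul2r; first by rewrite lee_fin invr_ge0.
  exact: leeB.
rewrite -EFinB -EFinM lee_fin ler_pdivrMr //.
rewrite /moreau_obj zE /= -/q'.
have K5 : t * (e1 * (N * (1 + L * kap))) <= t * (e / 2).
  by rewrite ler_wpM2l // ltW.
lra.
Unshelve. all: by end_near.
Qed.

End DirectionalEnvelope.

Lemma error_bound_cone (R : realType) n m p
    (g : 'rV[R]_n * 'rV[R]_m -> 'rV[R]_p) xb yb u : error_bound g xb yb u ->
  exists kap eps del : R, [/\ 0 < kap, 0 < eps, 0 < del &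
    forall x b, cone xb u del x -> enorm (x - xb) < eps -> enorm (b - yb) < eps ->
      exists2 w, feas g x w & enorm (w - b) <= kap * gplus g (x, b)].
Proof.
move=> [kap [eps [del [kap0 eps0 del0 EB]]]]; exists kap, eps, del; split => //.
move=> x b [s s0 Hs] xe be; have := EB (x - xb) s b xe s0 Hs be.
by rewrite addrC subrK.
Qed.

(** * Semiconvex functions *)

Section EuclideanLimits.
Context {R : realType} {n m : nat}.
Local Notation Z := ('rV[R]_n * 'rV[R]_m)%type.

Lemma pdot_cvg (a b : nat -> Z) (x y : Z) :
  a @ \oo --> x -> b @ \oo --> y -> (fun k => pdot (a k) (b k)) @ \oo --> pdot x y.
Proof.
move=> ax bY; have fstc (e : nat -> Z) (w : Z) i : e @ \oo --> w ->
    (fun k => (e k).1 0 i) @ \oo --> w.1 0 i.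
  move=> ew; apply: (continuous_cvg _ (@coord_continuous R 1 n 0 i w.1)).
  exact: (continuous_cvg _ (@cvg_fst _ _ _ _ _) ew).
have sndc (e : nat -> Z) (w : Z) i : e @ \oo --> w ->
    (fun k => (e k).2 0 i) @ \oo --> w.2 0 i.
  move=> ew; apply: (continuous_cvg _ (@coord_continuous R 1 m 0 i w.2)).
  exact: (continuous_cvg _ (@cvg_snd _ _ _ _ _) ew).
apply: cvgD; apply: cvg_sumr => i; apply: cvgM; by [exact: fstc | exact: sndc].
Qed.

Lemma pnorm_cvg (a : nat -> Z) (x : Z) :
  a @ \oo --> x -> (fun k => pnorm (a k)) @ \oo --> pnorm x.
Proof.
by move=> ax; apply: (cvg_comp _ _ (pdot_cvg ax ax)); exact: sqrt_continuous.
Qed.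

End EuclideanLimits.

Section SemiconvexFunction.
Context {R : realType} {n m : nat}.
Local Notation Z := ('rV[R]_n * 'rV[R]_m)%type.
Implicit Types (z w d xi : Z) (e t s : R).
Variables (psi : Z -> \bar R) (V : Z -> R) (zb : Z) (r c : R).
Hypotheses (r0 : 0 < r) (c0 : 0 <= c).
Hypothesis psiV : forall z, pnorm (z - zb) < r -> psi z = (V z)%:E.
Hypothesis V_semiconvex : forall z w t, pnorm (z - zb) < r ->
  pnorm (w - zb) < r -> 0 <= t <= 1 ->
  V (t *: z + (1 - t) *: w) <= t * V z + (1 - t) * V w
       + c / 2 * (t * (1 - t) * pnorm (z - w) ^+ 2).
Hypothesis V_bounded : forall z, pnorm (z - zb) < r -> `|V z - V zb| <= 1.

Let segE z w t : t *: z + (1 - t) *: w = w + t *: (z - w).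
Proof. by rewrite scalerBl scale1r scalerBr addrCA addrA addrAC. Qed.

Let addK z w : z + w - z = w. Proof. by rewrite [z + w]addrC addrK. Qed.

Let zb_r : pnorm (zb - zb) < r. Proof. by rewrite subrr pnorm0. Qed.

(** Extend the segment from [z] to [w] by a fixed length beyond [w]; the values
    at its end are bounded, which bounds the slope between [z] and [w]. *)
Lemma semiconvex_lipschitz : exists2 s : R, 0 < s <= r & exists2 L : R, 0 < L &
  forall z w, pnorm (z - zb) < s -> pnorm (w - zb) < s ->
    `|V z - V w| <= L * pnorm (z - w).
Proof.
have r40 : 0 < r / 4 by rewrite divr_gt0.
exists (r / 4); first by rewrite r40 /=; lra.
pose L := (2 + c / 2 * (r * r)) / (r / 4).
have L0 : 0 < L by rewrite divr_gt0 // ltr_pwDl // !mulr_ge0 ?invr_ge0 // ltW.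
exists L => // z w zr wr.
suff main z' w' : pnorm (z' - zb) < r / 4 -> pnorm (w' - zb) < r / 4 ->
    V w' - V z' <= L * pnorm (z' - w').
  have := main _ _ zr wr; have := main _ _ wr zr; rewrite (pnormB w z) => h1 h2.
  by rewrite ler_norml; apply/andP; split; lra.
move=> {z w zr wr} zr wr; set N := pnorm (z' - w').
have N0 : 0 <= N by exact: pnorm_ge0.
have [NE|Nn] := eqVneq N 0.
  have -> : w' = z'.
    have := norm_le_pnorm (z' - w'); rewrite -/N NE normr_le0 subr_eq0.
    by move=> /eqP.
  by rewrite subrr mulr_ge0 // ltW.
have Np : 0 < N by rewrite lt_neqAle eq_sym Nn.
have D0 : 0 < N + r / 4 by rewrite addr_gt0.
pose y := w' + (r / 4 / N) *: (w' - z').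
have yw : pnorm (y - w') = r / 4.
  rewrite /y addrAC subrr add0r pnormZ (pnormB w') -/N ger0_norm ?divfK //.
  by rewrite divr_ge0 // ltW.
have yr : pnorm (y - zb) < r.
  have -> : y - zb = (y - w') + (w' - zb) by rewrite addrA subrK.
  apply: le_lt_trans (pnormD _ _) _; lra.
have zr' : pnorm (z' - zb) < r by lra.
pose t := N / (N + r / 4).
have t01 : 0 <= t <= 1.
  by rewrite divr_ge0 ?(ltW D0) //= ler_pdivrMr // mul1r lerDl ltW.
have wE : w' = t *: y + (1 - t) *: z'.
  rewrite segE; have -> : y - z' = (1 + r / 4 / N) *: (w' - z').
    by rewrite /y scalerDl scale1r addrAC.
  rewrite scalerA (_ : t * _ = 1) ?scale1r; first by rewrite addrC subrK.
  by rewrite /t; field; rewrite !gt_eqF //; lra.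
have := V_semiconvex yr zr' t01; rewrite -wE.
have /andP[t0 t1] := t01.
have := V_bounded yr; have := V_bounded zr'; rewrite !ler_norml.
move=> /andP[h1 h2] /andP[h3 h4] h5.
have yz : pnorm (y - z') <= r.
  have -> : y - z' = (y - w') + (w' - z') by rewrite addrA subrK.
  apply: le_trans (pnormD _ _) _; rewrite yw pnormB -/N.
  have : N <= pnorm (z' - zb) + pnorm (w' - zb).
    have -> : N = pnorm ((z' - zb) - (w' - zb)) by rewrite opprB addrA subrK.
    by apply: le_trans (pnormD _ _) _; rewrite pnormN.
  lra.
have h6 : c / 2 * (t * (1 - t) * pnorm (y - z') ^+ 2) <= t * (c / 2 * (r * r)).
  have h7 : (1 - t) * pnorm (y - z') ^+ 2 <= r * r.
    rewrite expr2; apply: le_trans (_ : 1 * (r * r) <= _); last by rewrite mul1r.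
    by rewrite ler_pM ?mulr_ge0 ?pnorm_ge0 ?subr_ge0 // ?gerBl // ler_pM ?pnorm_ge0.
  rewrite (_ : c / 2 * (t * (1 - t) * pnorm (y - z') ^+ 2) = t * (c / 2 * ((1 - t) * pnorm (y - z') ^+ 2))); last by ring.
  by rewrite ler_wpM2l // ler_wpM2l // divr_ge0.
have h8 : t * (V y - V z') <= t * 2 by rewrite ler_wpM2l //; lra.
have tL : t * (2 + c / 2 * (r * r)) <= L * N.
  have K0 : 0 <= 2 + c / 2 * (r * r).
    by rewrite addr_ge0 // mulr_ge0 ?mulr_ge0 ?invr_ge0 // ltW.
  rewrite /t /L mulrAC [N * _]mulrC [leRHS]mulrAC.
  by rewrite ler_wpM2l ?mulr_ge0 // lef_pV2 ?posrE // lerDr.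
lra.
Qed.

Lemma semiconvex_dir_lipschitz d : dir_lipschitz psi zb d.
Proof.
have [s /andP[s0 sr] [L L0 HL]] := semiconvex_lipschitz.
exists s, 1, L; split => //; have near h : dir_nbhd pnorm s 1 d h ->
    pnorm (zb + h - zb) < s by move=> [hs _]; rewrite addrAC subrr add0r.
split=> [_ [h /near hs <-]|_ _ [h /near hs <-] [h' /near hs' <-]].
  by rewrite psiV // (lt_le_trans hs).
by rewrite !psiV ?(lt_le_trans hs) ?(lt_le_trans hs') //=; exact: HL.
Qed.

(** The subgradient inequality holds on a short piece of the segment, and
    semiconvexity carries it to the end. *)
Lemma semiconvex_frechet z w xi : pnorm (z - zb) < r -> pnorm (w - zb) < r ->
  frechet_subdiff psi z xi ->
  V z + pdot xi (w - z) - c / 2 * pnorm (w - z) ^+ 2 <= V w.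
Proof.
move=> zr wr [_ Hxi]; set N := pnorm (w - z); rewrite -subr_ge0.
have N0 : 0 <= N by exact: pnorm_ge0.
apply: (@ge0_of_eps _ _ N N0) => e /andP[e0 _].
have [s s0 Hs] := (near_pnormP _ _).1 (Hxi e e0).
have [t /andP[t0 t1] ts] := small_step s0 N0.
have t01 : 0 <= t <= 1 by rewrite ltW.
have zt : z + t *: (w - z) - z = t *: (w - z) by rewrite addrAC subrr add0r.
have ztr : pnorm (z + t *: (w - z) - zb) < r.
  have -> : z + t *: (w - z) - zb = t *: (w - zb) + (1 - t) *: (z - zb).
    rewrite (segE (w - zb)) opprB addrA subrK addrAC //.
  apply: le_lt_trans (pnormD _ _) _; rewrite !pnormZ !ger0_norm ?subr_ge0 ?(ltW t0) //.
  have := ltr_pM2l t0 (pnorm (w - zb)) r; rewrite wr => h1.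
  have : (1 - t) * pnorm (z - zb) <= (1 - t) * r by rewrite ler_wpM2l ?subr_ge0 // ltW.
  lra.
have := Hs (z + t *: (w - z)); rewrite zt pnormZ (gtr0_norm t0) -/N pdotZr.
move=> /(_ ts); rewrite (psiV zr) (psiV ztr) -EFinD lee_fin => h1.
have := V_semiconvex wr zr t01; rewrite segE -/N => h2.
have h3 : 0 <= t * (t * (c / 2 * N ^+ 2)).
  by rewrite !mulr_ge0 ?invr_ge0 ?sqr_ge0 // ltW.
rewrite -(pmulr_rge0 _ t0); lra.
Qed.

Let path (t : nat -> R) (d_ : nat -> Z) d : tends0 t -> d_ @ \oo --> d ->
  (fun k => zb + t k *: d_ k) @ \oo --> zb.
Proof.
move=> [_ t0] dd; rewrite -[X in _ --> X]addr0 -(scale0r d).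
by apply: cvgD; [exact: cvg_cst | exact: cvgZ].
Qed.

Let path_near (t : nat -> R) (d_ : nat -> Z) d s : tends0 t -> d_ @ \oo --> d ->
  0 < s -> \forall k \near \oo, pnorm (zb + t k *: d_ k - zb) < s.
Proof. by move=> t0 dd s0; exact: (path t0 dd) _ (near_pnorm_lt zb s0). Qed.

Lemma semiconvex_dir_subdiff d xi z : dir_subdiff psi zb d xi ->
  pnorm (z - zb) < r ->
  V zb + pdot xi (z - zb) - c / 2 * pnorm (z - zb) ^+ 2 <= V z.
Proof.
move=> [t [d_ [xi_ [t0 dd psic xic H]]]] zr; have zc := path t0 dd.
have Vc : (fun k => V (zb + t k *: d_ k)) @ \oo --> V zb.
  rewrite psiV // in psic; apply: cvg_trans (fine_cvg psic).
  apply: near_eq_cvg; apply: filterS (path_near t0 dd r0) => k kr.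
  by rewrite /= psiV.
have zzc : (fun k => z - (zb + t k *: d_ k)) @ \oo --> z - zb.
  by apply: cvgB => //; exact: cvg_cst.
have Nc := pnorm_cvg zzc.
have L : (fun k => V (zb + t k *: d_ k) + pdot (xi_ k) (z - (zb + t k *: d_ k))
    - c / 2 * (pnorm (z - (zb + t k *: d_ k)) * pnorm (z - (zb + t k *: d_ k))))
    @ \oo --> V zb + pdot xi (z - zb) - c / 2 * (pnorm (z - zb) * pnorm (z - zb)).
  apply: cvgB; first by apply: cvgD => //; exact: pdot_cvg.
  by apply: cvgM; [exact: cvg_cst | exact: cvgM].
rewrite expr2; apply: (cvgr_to_le L).
apply: filterS (path_near t0 dd r0) => k kr /=.
by rewrite -expr2; exact: (semiconvex_frechet kr zr (H k)).
Qed.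

(** The difference quotients along [d] are bounded below by the quadratic
    minorant. They are bounded above by the quotients at a later time, by
    semiconvexity, and these are at most the slope of the subgradient there,
    which tends to [pdot xi d]. *)
Lemma semiconvex_graph_deriv d xi eta : dir_subdiff psi zb d xi ->
  graph_deriv psi zb d eta -> pdot xi d = eta.
Proof.
move=> Sxi [s [e_ [s0 ee sE]]].
pose Q j := (V (zb + s j *: e_ j) - V zb) / s j.
have Qc : Q @ \oo --> eta.
  apply: cvg_trans (fine_cvg sE); apply: near_eq_cvg.
  apply: filterS (path_near s0 ee r0) => j jr.
  by rewrite /= /diff_quot (psiV jr) psiV // -EFinB -EFinM.
have Ne := pnorm_cvg ee; have sc : s @ \oo --> 0 by case: s0.
have sp j : 0 < s j by case: s0.
apply/le_anti/andP; split.
  have Lc : (fun j => pdot xi (e_ j) - c / 2 * (s j * (pnorm (e_ j) * pnorm (e_ j))))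
      @ \oo --> pdot xi d - c / 2 * (0 * (pnorm d * pnorm d)).
    apply: cvgB; first by apply: pdot_cvg => //; exact: cvg_cst.
    by apply: cvgM; [exact: cvg_cst | apply: cvgM => //; exact: cvgM].
  rewrite mul0r mulr0 subr0 in Lc; apply: ler_cvg_to Lc Qc _.
  apply: filterS (path_near s0 ee r0) => j jr.
  have := semiconvex_dir_subdiff Sxi jr.
  rewrite addK pdotZr pnormZ (gtr0_norm (sp j)) => h.
  rewrite /Q ler_pdivlMr //; lra.
have [S /andP[S0 Sr] [L L0 HL]] := semiconvex_lipschitz.
move: Sxi => [t [d_ [xi_ [t0 dd _ xic H]]]].
have tc : t @ \oo --> 0 by case: t0.
have tp k : 0 < t k by case: t0.
have ddc : (fun k => d - d_ k) @ \oo --> d - d by apply: cvgB => //; exact: cvg_cst.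
have Nd := pnorm_cvg dd.
have Uc : (fun k => pdot (xi_ k) (d_ k) + c * (t k * (pnorm (d_ k) * pnorm (d_ k)))
    + L * pnorm (d - d_ k)) @ \oo -->
    pdot xi d + c * (0 * (pnorm d * pnorm d)) + L * pnorm (d - d).
  apply: cvgD; last by apply: cvgM; [exact: cvg_cst | exact: pnorm_cvg].
  apply: cvgD; first exact: pdot_cvg.
  by apply: cvgM; [exact: cvg_cst | apply: cvgM => //; exact: cvgM].
rewrite mul0r mulr0 addr0 subrr pnorm0 mulr0 addr0 in Uc.
apply: (cvgr_to_ge Uc); apply: filterS (path_near t0 dd r0) => k kr.
have ek : (fun j => e_ j - d_ k) @ \oo --> d - d_ k.
  by apply: cvgB => //; exact: cvg_cst.
have Ek : (fun j => pdot (xi_ k) (d_ k) + c * (t k * (pnorm (d_ k) * pnorm (d_ k)))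
    + L * pnorm (e_ j - d_ k)) @ \oo --> pdot (xi_ k) (d_ k)
    + c * (t k * (pnorm (d_ k) * pnorm (d_ k))) + L * pnorm (d - d_ k).
  by apply: cvgD; [exact: cvg_cst | apply: cvgM; [exact: cvg_cst | exact: pnorm_cvg]].
apply: ler_cvg_to Qc Ek _.
have dk : (fun=> d_ k) @ \oo --> d_ k by exact: cvg_cst.
have st : \forall j \near \oo, s j < t k by exact: (cvgr_lt _ sc _ (tp k)).
apply: filterS3 st (path_near s0 ee S0) (path_near s0 dk S0) => j sjt jr jkr.
have szk : s j *: d_ k = (s j / t k) *: (t k *: d_ k).
  by rewrite scalerA divfK // gt_eqF.
have q01 : 0 <= s j / t k <= 1.
  by rewrite divr_ge0 ?(ltW (sp j)) ?(ltW (tp k)) //= ler_pdivrMr // mul1r ltW.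
have tN : pnorm (t k *: d_ k) = t k * pnorm (d_ k).
  by rewrite pnormZ gtr0_norm.
have := V_semiconvex kr zb_r q01; rewrite segE addK -szk tN => h1.
have := semiconvex_frechet kr zb_r (H k); rewrite pnormB -(opprB _ zb) addK.
rewrite pdotNr pdotZr tN => h2.
have : V (zb + s j *: e_ j) - V (zb + s j *: d_ k) <= L * (s j * pnorm (e_ j - d_ k)).
  have -> : s j * pnorm (e_ j - d_ k) =
      pnorm (zb + s j *: e_ j - (zb + s j *: d_ k)).
    by rewrite opprD addrACA subrr add0r -scalerBr pnormZ gtr0_norm.
  exact: le_trans (ler_norm _) (HL _ _ jr jkr).
move=> h3; rewrite /Q ler_pdivrMr //.
have qt : s j / t k * t k = s j by rewrite divfK // gt_eqF.
move: h1 h2 h3 qt q01; set q := s j / t k.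
move: (V _) (V _) (V _) (V _) (pnorm _) (pnorm _) (pdot _ _) => A B C D N M P.
move=> h1 h2 h3 qt /andP[q0 q1].
have h4 := ler_wpM2l q0 h2.
have h5 : 0 <= c / 2 * (q * q * (t k * M) ^+ 2).
  by apply: mulr_ge0; [rewrite divr_ge0 | apply: mulr_ge0; [exact: mulr_ge0 | exact: sqr_ge0]].
rewrite -qt in h3 *; lra.
Qed.

End SemiconvexFunction.

(** * Jointly semiconvex lower level *)

Section ConvexCombinations.
Context {R : realType} {V : lmodType R}.

(** Induction on the number of points: with [s] the weight of the last one, the
    remaining combination is rescaled by [(1 - s)^-1]. *)
Lemma convex_star (C : V -> Prop) (z : V) (k : nat) (a : 'I_k -> V) (c : 'I_k -> R) :
  (forall x y (t : R), 0 <= t <= 1 -> C x -> C y -> C (t *: x + (1 - t) *: y)) ->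
  C z -> (forall j, C (z + a j)) -> (forall j, 0 <= c j) -> \sum_j c j <= 1 ->
  C (z + \sum_j c j *: a j).
Proof.
move=> convC Cz; elim: k a c => [|k IH] a c Ca c0 c1; first by rewrite big_ord0 addr0.
rewrite big_ord_recr /=; set s := c ord_max.
rewrite big_ord_recr /= -/s in c1.
have S0 : 0 <= \sum_(j < k) c (widen_ord (leqnSn k) j) by exact: sumr_ge0.
have s0 : 0 <= s by exact: c0.
have [s1|s1] := eqVneq s 1.
  rewrite big1 => [|j _]; first by rewrite add0r s1 scale1r.
  have : \sum_(j < k) c (widen_ord (leqnSn k) j) == 0 by apply/eqP; lra.
  rewrite psumr_eq0 // => /allP /(_ j); rewrite mem_index_enum => /(_ isT) /eqP ->.
  by rewrite scale0r.
have s1' : 0 < 1 - s by rewrite subr_gt0 lt_neqAle s1; lra.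
have Cw := IH (fun j => a (widen_ord (leqnSn k) j))
  (fun j => (1 - s)^-1 * c (widen_ord (leqnSn k) j)).
have {}Cw : C (z + \sum_(j < k) ((1 - s)^-1 * c (widen_ord (leqnSn k) j)) *:
      a (widen_ord (leqnSn k) j)).
  apply: Cw => [j|j|].
  - exact: Ca.
  - by rewrite mulr_ge0 // invr_ge0 ltW.
  - by rewrite -mulr_sumr mulrC ler_pdivrMr //; lra.
have s01 : 0 <= s <= 1 by rewrite s0; lra.
have := convC _ _ s s01 (Ca ord_max) Cw.
rewrite !scalerDr scaler_sumr addrACA -scalerDl [s + _]addrC subrK scale1r.
congr (C (z + _)); rewrite addrC; congr (_ + _); apply: eq_bigr => j _.
by rewrite scalerA mulrA divff ?mul1r // gt_eqF.
Qed.

End ConvexCombinations.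

Section JointlySemiconvex.
Context {R : realType} {n m p : nat}.
Local Notation Z := ('rV[R]_n * 'rV[R]_m)%type.
Implicit Types (z w h : Z) (e r t s : R) (x : 'rV[R]_n) (y b : 'rV[R]_m).
Variables (f : Z -> R) (g : Z -> 'rV[R]_p) (gamma rho : R).
Variables (Df : Z -> Z) (Dg : 'I_p -> Z -> Z).
Hypotheses (fD : smooth f Df) (gD : forall i, smooth (component g i) (Dg i)).
Local Notation env := (moreau f g gamma).
Local Notation phi := (moreau_obj f gamma).
Hypotheses (gamma0 : 0 < gamma) (rho0 : 0 < rho) (gamma_rho : gamma * rho < 1).
Hypothesis graph_convex : forall z w t, 0 <= t <= 1 ->
  nonpos (g z) -> nonpos (g w) -> nonpos (g (t *: z + (1 - t) *: w)).
Hypothesis f_jointly_semiconvex : forall z w t, 0 <= t <= 1 ->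
  nonpos (g z) -> nonpos (g w) ->
  f (t *: z + (1 - t) *: w) <= t * f z + (1 - t) * f w
     + rho / 2 * (t * (1 - t) * pnorm (z - w) ^+ 2).
Variables (xb : 'rV[R]_n) (yb : 'rV[R]_m).
Let zb : Z := (xb, yb).
Hypothesis S_zb : Sgamma f g gamma zb yb.
Hypothesis feas_nonempty : exists2 r : R, 0 < r &
  forall x, enorm (x - xb) < r -> exists y, feas g x y.

Let g_zb : nonpos (g zb). Proof. by case: S_zb. Qed.

Let rho_gamma : rho < 1 / gamma.
Proof. by rewrite ltr_pdivlMr // mulrC. Qed.

Let pair_comb x y y' t : t *: (x, y) + (1 - t) *: (x, y') =
  (x, t *: y + (1 - t) *: y') :> Z.
Proof. by congr (_, _); rewrite /= -scalerDl [t + _]addrC subrK scale1r. Qed.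

Let feas_convex x y1 y2 t : 0 <= t <= 1 ->
  feas g x y1 -> feas g x y2 -> feas g x (t *: y1 + (1 - t) *: y2).
Proof. by move=> t01 F1 F2; rewrite /feas /= -pair_comb; exact: graph_convex. Qed.

Let f_semiconvex x y1 y2 t : 0 <= t <= 1 ->
  feas g x y1 -> feas g x y2 ->
  f (x, t *: y1 + (1 - t) *: y2) <= t * f (x, y1) + (1 - t) * f (x, y2)
     + rho / 2 * (t * (1 - t) * enorm (y1 - y2) ^+ 2).
Proof.
move=> t01 F1 F2; have := f_jointly_semiconvex t01 F1 F2; rewrite pair_comb.
have -> : (x, y1) - (x, y2) = (0, y1 - y2) :> Z by congr (_, _); rewrite /= subrr.
by rewrite pnorm_snd0.
Qed.

(** A set-valued map with convex graph is lower semicontinuous in the interior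
    of its domain: combine the given point of the graph with points over the
    vertices of a cross-polytope. *)
Lemma feas_lsc r : 0 < r -> exists2 e : R, 0 < e & forall x, setT x ->
  enorm (x - zb.1) < e -> exists2 y, feas g x y & enorm (y - zb.2) < r.
Proof.
move=> r0; have [r1 r10 Hr1] := feas_nonempty.
pose c := r1 / 2; have c0 : 0 < c by rewrite divr_gt0.
pose sg (b : bool) : R := if b then c else - c.
have delta_norm j : enorm (delta_mx 0 j : 'rV[R]_n) = 1.
  by rewrite /enorm dot_delta mxE !eqxx sqrtr1.
have [jb|Y HY] := @choice ('I_n * bool)%type 'rV[R]_m
    (fun jb y => feas g (xb + sg jb.2 *: delta_mx 0 jb.1) y).
  apply: Hr1; rewrite addrAC subrr add0r enormZ delta_norm mulr1.
  rewrite /sg; case: jb.2; rewrite ?normrN gtr0_norm // /c; lra.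
pose M := \sum_(j : 'I_n) (enorm (Y (j, true) - yb) + enorm (Y (j, false) - yb)).
have M0 : 0 <= M by apply: sumr_ge0 => j _; rewrite addr_ge0 ?enorm_ge0.
have YM j (c' : bool) : enorm (Y (j, c') - yb) <= M.
  rewrite /M (bigD1 j) //=; apply: le_trans
    (_ : enorm (Y (j, true) - yb) + enorm (Y (j, false) - yb) <= _).
    by case: c'; rewrite ?lerDl ?lerDr ?enorm_ge0.
  by rewrite lerDl; apply: sumr_ge0 => i _; rewrite addr_ge0 ?enorm_ge0.
have q0 : 0 < Num.min 1 r by rewrite lt_min ltr01.
have B0 : 0 <= c^-1 * n%:R * (1 + M).
  by rewrite !mulr_ge0 ?addr_ge0 // invr_ge0 ltW.
have [e /andP[e0 _] eB] := small_step q0 B0.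
exists e => // x _ xe; pose h := x - xb.
have sum_h : \sum_j `|h 0 j| <= n%:R * e.
  apply: le_trans (_ : \sum_(j < n) e <= _); last by rewrite sumr_const card_ord -[leLHS]mulr_natl.
  apply: ler_sum => j _; apply: le_trans (ltW xe).
  exact: le_trans (coord_le_norm _ _) (norm_le_enorm _).
pose k j : R := c^-1 * `|h 0 j|.
have k0 j : 0 <= k j by rewrite mulr_ge0 // invr_ge0 ltW.
have ksum : \sum_j k j <= c^-1 * n%:R * e.
  by rewrite -mulr_sumr -mulrA ler_wpM2l // invr_ge0 ltW.
have en : 0 <= c^-1 * n%:R * e by rewrite !mulr_ge0 ?(ltW e0) // invr_ge0 ltW.
have [eB1 eBr] : c^-1 * n%:R * e < 1 /\ c^-1 * n%:R * e * M < r.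
  move: eB; rewrite lt_min mulrC -mulrA [_ * e]mulrC mulrA => /andP[].
  rewrite mulrDr mulr1 => h1 h2.
  have := mulr_ge0 en M0 => h3; split; lra.
pose a j : Z := (sg (0 <= h 0 j) *: delta_mx 0 j, Y (j, 0 <= h 0 j) - yb).
have Ca j : nonpos (g (zb + a j)).
  have -> : zb + a j = (xb + sg (0 <= h 0 j) *: delta_mx 0 j, Y (j, 0 <= h 0 j)).
    by congr (_, _); rewrite /= addrC subrK.
  exact: (HY (j, 0 <= h 0 j)).
have convC z w t : 0 <= t <= 1 -> nonpos (g z) -> nonpos (g w) ->
    nonpos (g (t *: z + (1 - t) *: w)) by exact: graph_convex.
have k1 : \sum_j k j <= 1 by lra.
have := convex_star convC g_zb Ca k0 k1.
set q := zb + _ => gq.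
have q1 : q.1 = x.
  rewrite /q /= (big_morph (fun z : Z => z.1) (id1 := 0) (op1 := +%R)) //.
  rewrite (eq_bigr (fun j => h 0 j *: delta_mx 0 j)); last first.
    move=> j _ /=; rewrite scalerA; congr (_ *: _); rewrite /k /sg.
    have [hj|hj] := leP 0 (h 0 j).
      by rewrite ger0_norm // mulrAC mulVf ?mul1r // gt_eqF.
    by rewrite ltr0_norm //; field; rewrite gt_eqF.
  by rewrite -row_sum_delta /h addrC subrK.
have q2 : q.2 - yb = \sum_j k j *: (Y (j, 0 <= h 0 j) - yb).
  rewrite /q /= (big_morph (fun z : Z => z.2) (id1 := 0) (op1 := +%R)) //.
  by rewrite addrAC subrr add0r.
have Fq : feas g q.1 q.2 by case: (q) gq.
exists q.2; first by rewrite q1 in Fq.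
rewrite /= q2; apply: le_lt_trans eBr.
apply: le_trans (_ : \sum_j k j * M <= _); last by rewrite -mulr_suml ler_wpM2r.
elim/big_ind2: _ => [|u1 s1 u2 s2 H1 H2|j _].
- by rewrite enorm0.
- by apply: le_trans (enormD _ _) _; exact: lerD.
- by rewrite enormZ ger0_norm // ler_wpM2l.
Qed.

Lemma env_solution r : 0 < r -> exists2 e : R, 0 < e & forall z,
  pnorm (z - zb) < e -> exists2 w, Sgamma f g gamma z w & enorm (w - yb) < r.
Proof.
move=> r0; have [e e0 He] := Sgamma_localized fD gD gamma0 rho_gamma feas_convex
  f_semiconvex (S_zb : Sgamma f g gamma zb zb.2) feas_lsc r0.
by exists e => // z; exact: He.
Qed.

Let V z := fine (env z).

Let modulus := rho / (1 - gamma * rho).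

Let modulus0 : 0 < modulus.
Proof. by rewrite divr_gt0 // subr_gt0. Qed.

Let rho_modulus : rho <= modulus.
Proof.
rewrite ler_pdivlMr ?subr_gt0 // ler_piMr ?(ltW rho0) //.
by rewrite lerBlDr lerDl mulr_ge0 // ltW.
Qed.

(* The quadratic form left after minimizing over the lower-level variable. *)
Let quadratic_bound (a b : 'rV[R]_m) :
  rho * enorm a ^+ 2 - gamma^-1 * enorm (a - b) ^+ 2 <= modulus * enorm b ^+ 2.
Proof.
have k0 : 0 < 1 - gamma * rho by rewrite subr_gt0.
have := dotaa_ge0 ((1 - gamma * rho) *: a - b).
rewrite !enorm_sqr !(dotBl, dotBr, dotZl, dotZr) (dotC b a) => H.
have K0 : 0 < gamma * (1 - gamma * rho) by rewrite mulr_gt0.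
rewrite -(ler_pM2l K0) -subr_ge0; apply: le_trans H _.
rewrite le_eqVlt; apply/orP; left; apply/eqP; rewrite /modulus; field.
by rewrite !gt_eqF.
Qed.

(** Combine minimizers at both points. The regularizing term is jointly convex
    but not strongly so; completing the square in the lower-level variable leaves
    the modulus [rho / (1 - gamma * rho)]. *)
Lemma env_semiconvex : exists2 r : R, 0 < r &
  (forall z, pnorm (z - zb) < r -> env z = (V z)%:E) /\
  (forall z w t, pnorm (z - zb) < r -> pnorm (w - zb) < r -> 0 <= t <= 1 ->
     V (t *: z + (1 - t) *: w) <= t * V z + (1 - t) * V w
       + modulus / 2 * (t * (1 - t) * pnorm (z - w) ^+ 2)).
Proof.
have [r r0 Hr] := env_solution ltr01; exists r => //; split.
  by move=> z /Hr [w Sw _]; rewrite /V (moreau_argmin Sw).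
move=> z w t zr wr t01; have /andP[t0 t1] := t01.
have [a Sa _] := Hr z zr; have [b Sb _] := Hr w wr.
have zwr : pnorm (t *: z + (1 - t) *: w - zb) < r.
  have -> : t *: z + (1 - t) *: w - zb = t *: (z - zb) + (1 - t) *: (w - zb).
    by rewrite !scalerBr addrACA -opprD -scalerDl [t + _]addrC subrK scale1r.
  apply: le_lt_trans (pnormD _ _) _; rewrite !pnormZ !ger0_norm ?subr_ge0 //.
  have [->|tn] := eqVneq t 0; first by rewrite mul0r add0r subr0 mul1r.
  have tp : 0 < t by rewrite lt_neqAle eq_sym tn.
  have := ltr_pM2l tp (pnorm (z - zb)) r; rewrite zr => h1.
  have : (1 - t) * pnorm (w - zb) <= (1 - t) * r by rewrite ler_wpM2l ?subr_ge0 // ltW.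
  lra.
have [c Sc _] := Hr _ zwr.
rewrite /V (moreau_argmin Sa) (moreau_argmin Sb) (moreau_argmin Sc) /=.
have gza : nonpos (g (z.1, a)) by case: Sa.
have gwb : nonpos (g (w.1, b)) by case: Sb.
have combE : t *: (z.1, a) + (1 - t) *: (w.1, b) =
  ((t *: z + (1 - t) *: w).1, t *: a + (1 - t) *: b) :> Z by [].
have := graph_convex t01 gza gwb; rewrite combE => Fab.
have := f_jointly_semiconvex t01 gza gwb; rewrite combE => fab.
apply: le_trans (Sc.2 _ Fab) _; rewrite /moreau_obj.
have -> : t *: a + (1 - t) *: b - (t *: z + (1 - t) *: w).2 =
    t *: (a - z.2) + (1 - t) *: (b - w.2).
  by apply/rowP => j; rewrite /= !mxE; ring.
rewrite enorm_conv.
have E1 : pnorm ((z.1, a) - (w.1, b)) ^+ 2 = enorm (z.1 - w.1) ^+ 2 + enorm (a - b) ^+ 2.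
  by rewrite pnorm_sqr.
have E2 : pnorm (z - w) ^+ 2 = enorm (z.1 - w.1) ^+ 2 + enorm (z.2 - w.2) ^+ 2.
  by rewrite pnorm_sqr.
have E3 : a - z.2 - (b - w.2) = (a - b) - (z.2 - w.2).
  by apply/rowP => j; rewrite !mxE; ring.
rewrite E3 E2; rewrite E1 in fab.
have K := quadratic_bound (a - b) (z.2 - w.2).
have K2 : rho * enorm (z.1 - w.1) ^+ 2 <= modulus * enorm (z.1 - w.1) ^+ 2.
  by rewrite ler_wpM2r ?sqr_ge0.
have tt : 0 <= t * (1 - t) by rewrite mulr_ge0 ?subr_ge0.
have K3 := ler_wpM2l tt K; have K4 := ler_wpM2l tt K2.
have gE : (2 * gamma)^-1 = gamma^-1 / 2 by rewrite invfM mulrC.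
rewrite gE; move: fab K3 K4.
move: (f _) (f _) (f _) => A B C; move: (enorm _ ^+ 2) (enorm _ ^+ 2) => D E.
move: (enorm _ ^+ 2) (enorm _ ^+ 2) (enorm _ ^+ 2) => F G H; lra.
Qed.

Lemma env_regular : exists2 r : R, 0 < r &
  [/\ forall z, pnorm (z - zb) < r -> env z = (V z)%:E,
      forall z w t, pnorm (z - zb) < r -> pnorm (w - zb) < r -> 0 <= t <= 1 ->
        V (t *: z + (1 - t) *: w) <= t * V z + (1 - t) * V w
          + modulus / 2 * (t * (1 - t) * pnorm (z - w) ^+ 2) &
      forall z, pnorm (z - zb) < r -> `|V z - V zb| <= 1].
Proof.
have [r1 r10 [H1 H2]] := env_semiconvex.
have [r2 r20 H3] := moreau_obj_cont fD gamma0 zb yb (@ltr01 R).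
have [r3 r30 H4] := env_solution r20.
exists (Num.min r1 (Num.min r2 r3)); first by rewrite !lt_min r10 r20.
split=> [z|z w t|z]; rewrite ?lt_min.
- by move=> /andP[zr _]; exact: H1.
- by move=> /andP[zr _] /andP[wr _]; exact: H2.
move=> /and3P[_ zr2 zr3]; have [w Sw wr] := H4 z zr3.
by rewrite /V (moreau_argmin Sw) (moreau_argmin S_zb) /= ltW // H3.
Qed.

Lemma env_semiconvex_dir_lipschitz d : dir_lipschitz env zb d.
Proof.
have [r r0 [H1 H2 H3]] := env_regular.
exact: (semiconvex_dir_lipschitz r0 (ltW modulus0) H1 H2 H3).
Qed.

Let V_zb : V zb = f zb.
Proof.
by rewrite /V (moreau_argmin S_zb) /= /moreau_obj subrr enorm0 expr0n mulr0 addr0.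
Qed.

Variables (d xi : Z) (eta : R).
Hypothesis xi_subgradient : dir_subdiff env zb d xi.

Let minorant : exists2 r : R, 0 < r & forall z, pnorm (z - zb) < r ->
  env z = (V z)%:E /\
  f zb + pdot xi (z - zb) - modulus / 2 * pnorm (z - zb) ^+ 2 <= V z.
Proof.
have [r r0 [H1 H2 H3]] := env_regular; exists r => // z zr.
split; first exact: H1.
by rewrite -V_zb; exact: (semiconvex_dir_subdiff r0 (ltW modulus0) H1 H2 xi_subgradient zr).
Qed.

(** Moving [y] alone changes the envelope at most quadratically around a
    minimizer, so that a subgradient has no component along [y]. *)
Lemma env_subgradient_snd : xi.2 = 0.
Proof.
have main b : 0 <= - dot xi.2 b.
  set K := (modulus / 2 + (2 * gamma)^-1) * enorm b ^+ 2.
  have K0 : 0 <= K.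
    apply: mulr_ge0; last exact: sqr_ge0.
    apply: addr_ge0; first by rewrite divr_ge0 // ltW.
    by rewrite invr_ge0 mulr_ge0 // ltW.
  apply: (@ge0_of_eps _ _ _ K0) => e /andP[e0 _].
  have [r r0 Hr] := minorant.
  have q0 : 0 < Num.min r e by rewrite lt_min r0.
  have B0 : 0 <= enorm b + 1 by rewrite addr_ge0 ?enorm_ge0.
  have [t /andP[t0 _]] := small_step q0 B0.
  rewrite lt_min mulrDr mulr1 => /andP[tr te].
  have tb : 0 <= t * enorm b by rewrite mulr_ge0 ?enorm_ge0 // ltW.
  pose z : Z := zb + (0, t *: b).
  have zE : z - zb = (0, t *: b) by rewrite /z [zb + _]addrC addrK.
  have zN : pnorm (z - zb) = t * enorm b by rewrite zE pnorm_snd0 enormZ gtr0_norm.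
  have [|Vz] := Hr z; first by rewrite zN; lra.
  rewrite zN zE /pdot /= dot0r add0r dotZr => h1.
  have z1 : z.1 = xb by rewrite /z /= addr0.
  have Fy : feas g z.1 yb by rewrite z1; case: S_zb.
  have := moreau_le f gamma Fy; rewrite Vz lee_fin /moreau_obj z1.
  have -> : yb - z.2 = - (t *: b) by rewrite /z /= opprD addrA subrr add0r.
  rewrite enormN enormZ gtr0_norm // => h2.
  have h3 : 0 <= t * (- dot xi.2 b + t * K).
    move: h1 h2; rewrite -/zb /K; move: (f zb) (V z) (enorm b) => A B C h1 h2.
    lra.
  rewrite pmulr_rge0 // in h3.
  have : t * K <= e * K by rewrite ler_wpM2r //; lra.
  lra.
apply: enorm_row_eq0; rewrite /enorm.
have := main xi.2; have := dotaa_ge0 xi.2 => h1 h2.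
have -> : dot xi.2 xi.2 = 0 by lra.
exact: sqrtr0.
Qed.

(** On the graph of the lower-level feasible set [f] majorizes the envelope,
    and coincides with it at the reference point. A subgradient of the envelope
    therefore makes [f - <xi, .>] stationary on that set. *)
Lemma env_subgradient_multiplier : MSCQ g zb ->
  graph_deriv env zb d eta -> pdot (Df zb) d = eta ->
  exists lam : 'I_p -> R, [/\ kkt g Df Dg xb yb lam,
    forall h : Z, pdot xi h =
      dot (Df zb).1 h.1 + \sum_i lam i * dot (Dg i zb).1 h.1 &
    \sum_i lam i * pdot (Dg i zb) d = 0].
Proof.
move=> mscq eta_deriv df_eta; have [r r0 Hr] := minorant.
have [k k0 eb] := MSCQ_error_bound mscq.
have [r1 r10 [L L0 HL]] := smooth_lipschitz fD zb.
pose Psi w := f w - pdot xi w.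
have LL : 0 <= L + pnorm xi by rewrite addr_ge0 ?pnorm_ge0 // ltW.
have [||||lam [lam0 lamc lamE]] :=
  bounded_multiplier_rule (Psi := Psi) (q := Df zb - xi) gD LL (ltW k0) S_zb.1.
- move=> e e0; have [r2 r20 H2] := smooth_diff fD zb e0; exists r2 => // w wr.
  apply: le_trans (H2 w wr); rewrite /Psi pdotBl (pdotBr xi).
  by rewrite le_eqVlt; apply/orP; left; apply/eqP; congr (`|_|); ring.
- exists r1 => // a b ar br; rewrite /Psi.
  have -> : f a - pdot xi a - (f b - pdot xi b) = f a - f b - pdot xi (a - b).
    by rewrite pdotBr; ring.
  apply: le_trans (ler_normB _ _) _; rewrite mulrDl lerD ?HL //.
  exact: pdot_le.
- move=> e e0; have c0 : 0 <= modulus / 2 by rewrite divr_ge0 // ltW.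
  have [s /andP[s0 _] sc] := small_step e0 c0.
  exists (Num.min r s); first by rewrite lt_min r0.
  move=> w gw; rewrite lt_min => /andP[wr ws].
  have [Vw h1] := Hr w wr.
  have Fw : feas g w.1 w.2 by case: (w) gw.
  have := moreau_le f gamma Fw; rewrite Vw lee_fin /moreau_obj subrr enorm0.
  rewrite expr0n mulr0 addr0 -surjective_pairing => h2.
  have h3 : modulus / 2 * pnorm (w - zb) ^+ 2 <= e * pnorm (w - zb).
    rewrite expr2 mulrA ler_wpM2r ?pnorm_ge0 //.
    have : pnorm (w - zb) * (modulus / 2) <= s * (modulus / 2).
      by rewrite ler_wpM2r // ltW.
    rewrite [_ * (_ / _)]mulrC; lra.
  move: h1; rewrite /Psi pdotBr; lra.
- exact: eb.
have xi2 := env_subgradient_snd.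
have {}lamE h : pdot (Df zb) h + \sum_i lam i * pdot (Dg i zb) h = dot xi.1 h.1.
  by have := lamE h; rewrite pdotBl {2}/pdot xi2 dot0l addr0; lra.
exists lam; split.
- split=> [i||b]; [by have /andP[] := lam0 i | exact: lamc |].
  have := lamE (0, b); rewrite /= dot0r /pdot /= dot0r add0r => E.
  apply: etrans E; congr (_ + _).
  by apply: eq_bigr => i _; rewrite dot0r add0r.
- move=> h; have := lamE (h.1, 0); rewrite /pdot /= xi2 dot0l dot0r !addr0 => E.
  by apply: etrans (esym E) _; congr (_ + _); apply: eq_bigr => i _; rewrite dot0r addr0.
have [s s0 [H1 H2 H3]] := env_regular.
have := semiconvex_graph_deriv s0 (ltW modulus0) H1 H2 H3 xi_subgradient eta_deriv.
have := lamE d; rewrite {3}/pdot xi2 dot0l addr0 df_eta; lra.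
Qed.

End JointlySemiconvex.

(** * Convexity notions as inequalities *)

Section ConvexityUnfolded.
Context {R : realType}.
Implicit Types (t rho : R).

Lemma convex_setP (E : lmodType R) (A : set E) : @convex_set R E A <->
  forall (a b : E) t, 0 <= t <= 1 -> A a -> A b -> A (t *: a + (1 - t) *: b).
Proof.
split=> [cA a b t /andP[t0 t1] Aa Ab|H a b t /set_mem Aa /set_mem Ab].
  by apply/set_mem; apply: (cA a b (Itv01 t0 t1)); exact: mem_set.
by apply: mem_set; apply: H => //; rewrite ge0 le1.
Qed.

Lemma weakly_convexP k rho (h : 'rV[R]_k -> R) : weakly_convex rho h ->
  forall y1 y2 t, 0 <= t <= 1 ->
  h (t *: y1 + (1 - t) *: y2) <= t * h y1 + (1 - t) * h y2
     + rho / 2 * (t * (1 - t) * enorm (y1 - y2) ^+ 2).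
Proof.
move=> hc y1 y2 t /andP[t0 t1].
have := hc (Itv01 t0 t1) y1 y2 (in_setT _) (in_setT _).
move=> H; have {H} : h (t *: y1 + (1 - t) *: y2) + rho / 2 * enorm (t *: y1 + (1 - t) *: y2) ^+ 2
    <= t * (h y1 + rho / 2 * enorm y1 ^+ 2) + (1 - t) * (h y2 + rho / 2 * enorm y2 ^+ 2).
  exact: H.
rewrite enorm_conv; lra.
Qed.

Lemma quasi_convexP k (h : 'rV[R]_k -> R) : quasi_convex h ->
  forall y1 y2 c t, 0 <= t <= 1 -> h y1 <= c -> h y2 <= c ->
  h (t *: y1 + (1 - t) *: y2) <= c.
Proof. by move=> hq y1 y2 c t; exact: (convex_setP _).1 (hq c) y1 y2 t. Qed.

Lemma pweakly_convexP n m rho (D : set ('rV[R]_n * 'rV[R]_m)) h :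
  pweakly_convex_on rho D h -> forall z1 z2 t, 0 <= t <= 1 -> D z1 -> D z2 ->
  D (t *: z1 + (1 - t) *: z2) /\
  h (t *: z1 + (1 - t) *: z2) <= t * h z1 + (1 - t) * h z2
     + rho / 2 * (t * (1 - t) * pnorm (z1 - z2) ^+ 2).
Proof.
move=> hc z1 z2 t /andP[t0 t1] D1 D2.
have H := hc z1 z2 (Itv01 t0 t1); set z := t *: z1 + (1 - t) *: z2.
have {H} : ((h z + rho / 2 * pnorm z ^+ 2)%:E + indicator_fun D z <=
   t%:E * ((h z1 + rho / 2 * pnorm z1 ^+ 2)%:E + indicator_fun D z1)
   + (1 - t)%:E * ((h z2 + rho / 2 * pnorm z2 ^+ 2)%:E + indicator_fun D z2))%E.
  exact: H.
rewrite /indicator_fun (mem_set D1) (mem_set D2) !adde0 -!EFinM -EFinD.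
have [/set_mem Dz|_] := ifP; last by rewrite leNgt ltry.
rewrite adde0 lee_fin => H; split => //; move: H.
have -> : pnorm z ^+ 2 = t * pnorm z1 ^+ 2
    + (1 - t) * pnorm z2 ^+ 2 - t * (1 - t) * pnorm (z1 - z2) ^+ 2.
  by rewrite /z !pnorm_sqr /= !enorm_conv; ring.
lra.
Qed.

Section Sections.
Context {n m : nat}.
Local Notation Z := ('rV[R]_n * 'rV[R]_m)%type.

Lemma weakly_convex_gradient rho (f : Z -> R) Df : 0 <= rho -> smooth f Df ->
  (forall x, weakly_convex rho (fun y => f (x, y))) -> forall x w w',
  f (x, w) + dot (Df (x, w)).2 (w' - w) - rho / 2 * enorm (w' - w) ^+ 2 <= f (x, w').
Proof.
move=> rho0 fD fc x w w'; set K := rho / 2 * _.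
have K0 : 0 <= K by rewrite mulr_ge0 ?sqr_ge0 // divr_ge0.
have := @slope_le _ _ _ f Df (x, w) (0, w' - w) (f (x, w') - f (x, w) + K) fD.
rewrite {1}/pdot dot0r add0r /= => H.
suff : dot (Df (x, w)).2 (w' - w) <= f (x, w') - f (x, w) + K by lra.
apply: H => t /andP[t0 t1]; have t01 : 0 <= t <= 1 by rewrite ltW.
have -> : (x, w) + t *: (0, w' - w) = (x, t *: w' + (1 - t) *: w) :> Z.
  congr (_, _) => /=; first by rewrite scaler0 addr0.
  by rewrite scalerBl scale1r scalerBr addrCA.
have := weakly_convexP (fc x) w' w t01.
have : t * (1 - t) * K <= t * K.
  by rewrite ler_wpM2r // ler_piMr ?(ltW t0) // lerBlDr lerDl ltW.
rewrite /K; move: (enorm _ ^+ 2) => N; lra.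
Qed.

End Sections.
End ConvexityUnfolded.

(** * Multiplier sets *)

Section MultiplierSets.
Context {R : realType} {n m p : nat}.
Local Notation Z := ('rV[R]_n * 'rV[R]_m)%type.
Implicit Types (z h : Z) (lam : 'rV[R]_p) (u : 'rV[R]_n) (d b : 'rV[R]_m).

Lemma is_diff_sum k (h dh : 'I_k -> Z -> R) z : (forall i, is_diff z (h i) (dh i)) ->
  is_diff z (fun w => \sum_i h i w) (fun z => \sum_i dh i z).
Proof.
elim: k h dh => [|k IH] h dh H.
  under eq_fun do rewrite big_ord0; under [X in is_diff _ _ X]eq_fun do rewrite big_ord0.
  exact: is_diff_cst.
under eq_fun do rewrite big_ord_recl.
under [X in is_diff _ _ X]eq_fun do rewrite big_ord_recl.
exact: is_diffD (H ord0) (IH _ _ (fun i => H (lift ord0 i))).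
Qed.

Lemma pdot_inj z z' : (forall h, pdot z h = pdot z' h) -> z = z'.
Proof.
move=> H; have := H (z - z') => /eqP; rewrite -subr_eq0 -pdotBl => /eqP E.
have : `|z - z'| <= 0.
  by apply: le_trans (norm_le_pnorm _) _; rewrite /pnorm E sqrtr0.
by rewrite normr_le0 subr_eq0 => /eqP.
Qed.

Variables (f : Z -> R) (g : Z -> 'rV[R]_p).
Hypotheses (f_C1 : C1 f) (g_C1 : C1 g).
Local Notation Dg i := (grad (component g i)).

Lemma component_slope i z h : 'd g z h 0 i = pdot (Dg i z) h.
Proof.
rewrite -(component_diffE i h (g_C1.1 z)); exact: diff_grad.
Qed.

Lemma dot_diff lam z h : dot lam ('d g z h) = \sum_i lam 0 i * pdot (Dg i z) h.
Proof. by apply: eq_bigr => i _; rewrite component_slope. Qed.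

Lemma dot_jacTx z lam u : dot (jacTx g z lam) u = \sum_i lam 0 i * dot (Dg i z).1 u.
Proof. by rewrite /jacTx dot_suml; apply: eq_bigr => i _; rewrite dotZl. Qed.

Lemma dot_jacTy z lam b : dot (jacTy g z lam) b = \sum_i lam 0 i * dot (Dg i z).2 b.
Proof. by rewrite /jacTy dot_suml; apply: eq_bigr => i _; rewrite dotZl. Qed.

Lemma lagrangian_diff lam z h :
  'd (lagrangian f g lam) z h = 'd f z h + \sum_i lam 0 i * pdot (Dg i z) h.
Proof.
have dc i : is_diff z (fun w => lam 0 i *: component g i w)
    (fun h => lam 0 i *: 'd (component g i) z h).
  exact: is_diffZ (differentiableP ((component_C1 i g_C1).1 z)).
have LE : lagrangian f g lam = (fun w : Z => f w + \sum_i lam 0 i *: component g i w).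
  by apply/funext => w; congr (_ + _); apply: eq_bigr => i _; rewrite mulrC.
have : is_diff z (lagrangian f g lam)
    (fun h : Z => 'd f z h + \sum_i lam 0 i *: 'd (component g i) z h).
  by rewrite LE; exact: is_diffD (differentiableP (f_C1.1 z)) (is_diff_sum dc).
case=> _ ->; congr (_ + _); apply: eq_bigr => i _; congr (_ * _).
exact: diff_grad.
Qed.

Lemma gradx_lagrangian lam z u :
  dot (gradx (lagrangian f g lam) z) u = dot (grad f z).1 u + \sum_i lam 0 i * dot (Dg i z).1 u.
Proof.
rewrite -dot_jacTx -dotDl; congr (dot _ u); apply/rowP => j; rewrite !mxE.
rewrite lagrangian_diff /jacTx summxE; congr (_ + _); apply: eq_bigr => i _.
by rewrite /pdot dot0r addr0 mxE dot_delta.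
Qed.

Lemma grady_lagrangian lam z b :
  dot (grady (lagrangian f g lam) z) b = dot (grad f z).2 b + \sum_i lam 0 i * dot (Dg i z).2 b.
Proof.
rewrite -dot_jacTy -dotDl; congr (dot _ b); apply/rowP => j; rewrite !mxE.
rewrite lagrangian_diff /jacTy summxE; congr (_ + _); apply: eq_bigr => i _.
by rewrite /pdot dot0r add0r mxE dot_delta.
Qed.

Variables (xb : 'rV[R]_n) (yb : 'rV[R]_m).
Local Notation zb := ((xb, yb) : Z).
Hypothesis g_zb : nonpos (g zb).

Lemma complementary_slackness lam : nonneg lam ->
  dot lam (g zb) = 0 <-> forall i, g zb 0 i != 0 -> lam 0 i = 0.
Proof.
move=> lam0; split=> [E i gi|H]; last first.
  apply: big1 => i _; have [->|/H ->] := eqVneq (g zb 0 i) 0; by rewrite ?mulr0 ?mul0r.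
have : \sum_j lam 0 j * - g zb 0 j == 0.
  by under eq_bigr do rewrite mulrN; rewrite sumrN oppr_eq0; apply/eqP.
rewrite psumr_eq0 => [/allP /(_ i)|j _]; last by rewrite mulr_ge0 ?oppr_ge0.
by rewrite mem_index_enum mulf_eq0 oppr_eq0 (negPf gi) orbF => /(_ isT) /eqP.
Qed.

Lemma multipliersP lam : multipliers f g zb lam <-> kkt g (grad f) (fun i => Dg i) xb yb (lam 0).
Proof.
have st : grady (lagrangian f g lam) zb = 0 <->
    forall b, dot (grad f zb).2 b + \sum_i lam 0 i * dot (Dg i zb).2 b = 0.
  split=> [E b|E]; first by rewrite -grady_lagrangian E dot0l.
  by apply/rowP => j; rewrite -dot_delta grady_lagrangian E mxE.
split=> [[l0 /st sl]|[l0 lc /st sl]].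
  by rewrite dotC => /(complementary_slackness l0) lc; split.
by split => //; rewrite dotC; apply/(complementary_slackness l0).
Qed.

Lemma lin_dirsP u d : lin_dirs g zb u d <->
  forall i, g zb 0 i = 0 -> pdot (Dg i zb) (u, d) <= 0.
Proof. by split=> H i /H; rewrite component_slope. Qed.

Lemma mult_gradsI (lam : 'I_p -> R) (xi : Z) u d : kkt g (grad f) (fun i => Dg i) xb yb lam ->
  (forall h : Z, pdot xi h =
     dot (grad f zb).1 h.1 + \sum_i lam i * dot (Dg i zb).1 h.1) ->
  \sum_i lam i * pdot (Dg i zb) (u, d) = 0 -> mult_grads f g zb u d xi.
Proof.
move=> lam_kkt xiE lam_ud; pose l : 'rV[R]_p := \row_i lam i.
have lE : l 0 = lam by apply/funext => i; rewrite mxE.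
exists l; first split; first by apply/multipliersP; rewrite lE.
  by rewrite dot_diff; apply: etrans lam_ud; apply: eq_bigr => i _; rewrite lE.
apply: pdot_inj => h; rewrite xiE /pdot /= dot0l addr0 dotDl dot_jacTx.
by congr (_ + _); apply: eq_bigr => i _; rewrite lE.
Qed.

Lemma mult_grads_convex u d : @convex_set R Z (mult_grads f g zb u d).
Proof.
apply/convex_setP => a b t /andP[t0 t1] [l [lM lud] <-] [k [kM kud] <-].
have /multipliersP := lM; have /multipliersP := kM.
move=> [k0 kc ks] [l0 lc ls].
pose lam i := t * l 0 i + (1 - t) * k 0 i.
have sumE (F : 'I_p -> R) : \sum_i lam i * F i =
    t * (\sum_i l 0 i * F i) + (1 - t) * (\sum_i k 0 i * F i).
  by rewrite !mulr_sumr -big_split; apply: eq_bigr => i _; rewrite /lam /=; ring.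
apply: (@mult_gradsI lam).
- split=> [i|i gi|b'].
  + by rewrite addr_ge0 ?mulr_ge0 ?subr_ge0.
  + by rewrite /lam lc // kc // !mulr0 addr0.
  + rewrite sumE; have := ls b'; have := ks b'.
    move: (dot _ _) (\sum_i _) (\sum_i _) => A B C h1 h2.
    have -> : C = - A by lra.
    have -> : B = - A by lra.
    ring.
- move=> h; rewrite sumE /pdot /= !(dotDl, dotZl) !dot_jacTx dot0l; ring.
- by rewrite sumE -!dot_diff lud kud !mulr0 addr0.
Qed.

End MultiplierSets.

(** * Weakly convex lower level *)

Section ConvexHulls.
Context {R : realType} {V : lmodType R}.
Implicit Types A B : set V.

Lemma co_min A B : A `<=` B -> convex_set B -> co A `<=` B.
Proof. by move=> AB cB; exact: smallest_sub. Qed.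

Lemma co_mono A B : A `<=` B -> co A `<=` co B.
Proof. by move=> AB a Aa C [cC BC]; apply: Aa; split => // b /AB /BC. Qed.

End ConvexHulls.

Section QuasiNormalityTools.
Context {R : realType} {n m p q : nat}.
Local Notation Z := ('rV[R]_n * 'rV[R]_m)%type.
Variables (f : Z -> R) (g : Z -> 'rV[R]_p) (G : Z -> 'rV[R]_q) (gamma : R).
Implicit Types (z dz : Z) (A : set Z).

(** For [alpha <> 0] the multiplier condition on [alpha] forces the slope of
    [f] to be an element of the graphical derivative of the envelope, which the
    comparison of the two sets may therefore use. *)
Lemma condQ_sub z dz A A' :
  (forall eta a, graph_deriv (moreau f g gamma) z dz eta -> 'd f z dz = eta ->
     A a -> A' a) ->
  condQ f g G gamma z dz A' -> condQ f g G gamma z dz A.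
Proof.
move=> AA' QA' [al [nug [nuG [H1 [a Aa aE] H3 [eta etaD etaE] H5]]]].
apply: QA'; exists al, nug, nuG; split => //; last by exists eta.
exists a => //; move: Aa; rewrite /scale_set; case: eqVneq => // al0 [b Ab <-].
exists b => //; apply: AA' etaD _ Ab.
by move: etaE => /eqP; rewrite mulf_eq0 (negPf al0) subr_eq0 => /eqP.
Qed.

Lemma VP_feasible_Sgamma xb yb : VP_feasible f g G gamma (xb, yb) ->
  Sgamma f g gamma (xb, yb) yb.
Proof.
case=> fv gz _; split => // w Fw.
have fle : ((f (xb, yb))%:E <= moreau f g gamma (xb, yb))%E.
  by move: fv; case: (moreau _ _ _ _) => [r||] //=; rewrite ?lee_fin ?subr_le0 ?leey.
have := le_trans fle (moreau_le f gamma (Fw : feas g (xb, yb).1 w)).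
by rewrite lee_fin {2}/moreau_obj subrr enorm0 expr0n mulr0 addr0.
Qed.

End QuasiNormalityTools.

Section ConstraintQualifications.
Context {R : realType} {n m p : nat}.
Local Notation Z := ('rV[R]_n * 'rV[R]_m)%type.
Variables (g : Z -> 'rV[R]_p) (xb : 'rV[R]_n) (yb : 'rV[R]_m) (u : 'rV[R]_n).
Hypothesis g_C1 : C1 g.
Local Notation zb := ((xb, yb) : Z).
Local Notation Dg i := (grad (component g i)).
Hypothesis g_zb : nonpos (g zb).

Lemma MFCQ_multiplier : MFCQ g zb -> forall lam : 'I_p -> R,
  (forall i, 0 <= lam i) -> (forall i, g zb 0 i != 0 -> lam i = 0) ->
  (forall b, \sum_i lam i * dot (Dg i zb).2 b = 0) -> forall i, lam i = 0.
Proof.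
move=> mf lam lam0 lamc lamE i; pose l : 'rV[R]_p := \row_i lam i.
have lE j : l 0 j = lam j by rewrite mxE.
suff l0 : l = 0 by rewrite -lE l0 mxE.
have l_ge0 : nonneg l by move=> j; rewrite lE.
apply: mf => //; last first.
  by apply/(complementary_slackness g_zb l_ge0) => j gj; rewrite lE lamc.
apply/rowP => j; rewrite -dot_delta dot_jacTy mxE -[RHS](lamE (delta_mx 0 j)).
by apply: eq_bigr => k _; rewrite lE.
Qed.

(** Otherwise a unit vector would be a nontrivial multiplier. *)
Lemma MFCQ_gradient i : MFCQ g zb -> g zb 0 i = 0 -> (Dg i zb).2 != 0.
Proof.
move=> mf gi; apply/eqP => Di; have : (i == i)%:R = 0 :> R; last first.
  by rewrite eqxx => /eqP; rewrite oner_eq0.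
apply: (MFCQ_multiplier mf (lam := fun j => (j == i)%:R)) => [j|j gj|b].
- exact: ler0n.
- by move: gj; case: (eqVneq j i) => // ->; rewrite gi eqxx.
- apply: big1 => k _; have [->|_] := eqVneq k i; last exact: mul0r.
  by rewrite Di dot0l mulr0.
Qed.

(** Multipliers that are complementary and stationary in [y] have the same
    slope along all [(u, v')]; for linearized directions of both [u] and [-u]
    this slope is nonpositive and nonnegative, hence it vanishes and the
    directional qualification condition applies to every multiplier. *)
Lemma FOSCMS_MFCQ :
  (forall u', u' = u \/ u' = - u -> lin_dirs g zb u' !=set0 /\
     forall v', lin_dirs g zb u' v' -> FOSCMS g zb ('d g zb (u', v'))) ->
  MFCQ g zb.
Proof.
move=> H lam ljac l0 lg.
have [[v1 lin1] fos] := H u (or_introl erefl).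
have [[v2 lin2] _] := H (- u) (or_intror erefl).
have lc := (complementary_slackness g_zb l0).1 lg.
have slopeE a b : dot lam ('d g zb (a, b)) = dot (jacTx g zb lam) a.
  rewrite dot_diff // dot_jacTx -[RHS]addr0 -[X in _ = _ + X](dot0l b) -ljac dot_jacTy.
  by rewrite -big_split; apply: eq_bigr => i _; rewrite /pdot mulrDr.
have le0 a b : lin_dirs g zb a b -> dot (jacTx g zb lam) a <= 0.
  move=> /(lin_dirsP g_C1) lin; rewrite -(slopeE a b) dot_diff //.
  apply: sumr_le0 => i _; have [gi|/lc ->] := eqVneq (g zb 0 i) 0; last by rewrite mul0r.
  by rewrite mulr_ge0_le0 // lin.
apply: (fos v1 lin1) => //; rewrite slopeE; apply/le_anti.
by rewrite (le0 _ _ lin1) /= -oppr_le0 -dotNr; exact: le0 lin2.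
Qed.

(** Constant rank of the family consisting of the one gradient [i]. *)
Lemma RCR_gradient i : RCR g zb -> g zb 0 i = 0 -> (Dg i zb).2 != 0 \/
  exists2 r : R, 0 < r & forall z, pnorm (z - zb) < r -> (Dg i z).2 = 0.
Proof.
(* The rank argument, for an arbitrary map in place of the partial gradient. *)
have key (F : (Z -> R) -> Z -> 'rV[R]_m) z : F (component g i) zb = 0 ->
    \dim <<[seq F (component g j) z | j in [set i]%SET]>>%VS =
    \dim <<[seq F (component g j) zb | j in [set i]%SET]>>%VS ->
    F (component g i) z = 0.
  move=> D0; rewrite /image_mem enum_set1 /= !span_seq1 !dim_vline D0 eqxx.
  by case: eqVneq.
move=> [r r0 H] gi.
have [D0|Dn] := eqVneq (grady (component g i) zb) 0; [right|by left].
exists r; first exact: r0.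
move=> z zr; have zbr : pnorm (zb - zb) < r by rewrite subrr pnorm0.
have Ki j : j \in [set i]%SET -> active g zb j by rewrite inE => /eqP ->.
exact: key D0 (H [set i]%SET Ki z zb zr zbr).
Qed.

End ConstraintQualifications.

Section WeaklyConvexLowerLevel.
Context {R : realType} {n m p : nat}.
Local Notation Z := ('rV[R]_n * 'rV[R]_m)%type.
Implicit Types (xi : Z) (d : 'rV[R]_m).
Variables (f : Z -> R) (g : Z -> 'rV[R]_p) (gamma rho : R).
Variables (xb u : 'rV[R]_n) (yb v : 'rV[R]_m).
Hypotheses (f_C1 : C1 f) (g_C1 : C1 g) (gamma0 : 0 < gamma) (rho0 : 0 <= rho).
Hypothesis f_wc : forall x, weakly_convex rho (fun y => f (x, y)).
Hypothesis gamma_rho : 0 < rho -> gamma < 1 / (2 * rho).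
Hypothesis g_qc : forall x i, quasi_convex (fun y => g (x, y) 0 i).
Local Notation zb := ((xb, yb) : Z).
Local Notation env := (moreau f g gamma).
Local Notation Dg i := (grad (component g i)).
Hypothesis S_zb : Sgamma f g gamma zb yb.
Variables kap eps del : R.
Hypotheses (kap0 : 0 < kap) (eps0 : 0 < eps) (del0 : 0 < del).
Hypothesis EB : forall x b, cone xb u del x -> enorm (x - xb) < eps ->
  enorm (b - yb) < eps ->
  exists2 w, feas g x w & enorm (w - b) <= kap * gplus g (x, b).
Hypothesis regular_gradients : forall i, g zb 0 i = 0 -> (Dg i zb).2 != 0 \/
  exists2 r : R, 0 < r & forall z, pnorm (z - zb) < r -> (Dg i z).2 = 0.

Let fD : smooth f (grad f) := C1_smooth f_C1.

Let gD i : smooth (component g i) (Dg i) := C1_smooth (component_C1 i g_C1).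

Let g_zb : nonpos (g zb). Proof. by case: S_zb. Qed.

Let rho_gamma : rho < 1 / gamma.
Proof.
have [->|rn] := eqVneq rho 0; first by rewrite divr_gt0.
have rp : 0 < rho by rewrite lt_neqAle eq_sym rn.
have := gamma_rho rp; rewrite !ltr_pdivlMr ?mulr_gt0 // => h.
have := mulr_gt0 gamma0 rp; lra.
Qed.

Let feas_convex x y1 y2 t : 0 <= t <= 1 -> feas g x y1 -> feas g x y2 ->
  feas g x (t *: y1 + (1 - t) *: y2).
Proof. by move=> t01 F1 F2 i; exact: (quasi_convexP (@g_qc x i) t01 (F1 i) (F2 i)). Qed.

Let f_semiconvex x y1 y2 t : 0 <= t <= 1 -> feas g x y1 -> feas g x y2 ->
  f (x, t *: y1 + (1 - t) *: y2) <= t * f (x, y1) + (1 - t) * f (x, y2)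
     + rho / 2 * (t * (1 - t) * enorm (y1 - y2) ^+ 2).
Proof. by move=> t01 _ _; exact: weakly_convexP (@f_wc x) _ _ _ t01. Qed.

Let component_qc i x w w' t : 0 <= t <= 1 ->
  component g i (x, w') <= component g i (x, w) ->
  component g i (x, w + t *: (w' - w)) <= component g i (x, w).
Proof.
move=> t01 h; have := quasi_convexP (@g_qc x i) t01 h (lexx (g (x, w) 0 i)).
by rewrite scalerBl scale1r addrCA -scalerBr.
Qed.

Let cmpN i : g zb 0 i = 0 -> comparable_from_nearby (component g i) (Dg i) xb yb u.
Proof.
move=> gi; have [Dn|D0] := regular_gradients gi.
  exact: (nonvanishing_from_nearby u (gD i) gi (@component_qc i) Dn).
exact: (vanishing_from_nearby u (gD i) gi D0).
Qed.

Let cmpR i : g zb 0 i = 0 -> comparable_from_reference (component g i) (Dg i) xb yb u.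
Proof.
move=> gi; have [Dn|D0] := regular_gradients gi.
  exact: (nonvanishing_from_reference u (gD i) gi (@component_qc i) Dn).
exact: (vanishing_from_reference u (gD i) gi D0).
Qed.

Lemma weakly_convex_dir_lipschitz : dir_lipschitz env zb (u, v).
Proof.
exact: (env_dir_lipschitz fD gD gamma0 rho_gamma feas_convex f_semiconvex S_zb
          kap0 eps0 del0 EB).
Qed.

Variable xi : Z.
Hypothesis xi_subgradient : dir_subdiff env zb (u, v) xi.

Let multiplier := dir_subdiff_multiplier fD gD gamma0 rho_gamma feas_convex
  f_semiconvex S_zb kap0 eps0 del0 EB (weakly_convex_gradient rho0 fD f_wc)
  cmpN cmpR xi_subgradient.

Let slopeE (lam : 'I_p -> R) d : kkt g (grad f) (fun i => Dg i) xb yb lam ->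
  pdot (grad f zb) (u, d) + \sum_i lam i * pdot (Dg i zb) (u, d) =
  dot (grad f zb).1 u + \sum_i lam i * dot (Dg i zb).1 u.
Proof.
move=> [_ _ st]; have := st d; have -> : \sum_i lam i * pdot (Dg i zb) (u, d) =
    \sum_i lam i * dot (Dg i zb).1 u + \sum_i lam i * dot (Dg i zb).2 d.
  by rewrite -big_split; apply: eq_bigr => i _; rewrite /pdot mulrDr.
rewrite /pdot /=; move: (\sum_i _) (\sum_i _) => A B; lra.
Qed.

(** Complementarity of [lam] with the linearized direction [d] turns the slope of
    [f] along [(u, d)] into the slope of the Lagrangian for [lam], which lies
    between the minimum and the maximum over all multipliers. *)
Lemma subgradient_tcrit : exists2 d, tcrit f g zb u d & mult_grads f g zb u d xi.
Proof.
have [lam [lam_kkt xiE [d [lin lam_d]]]] := multiplier.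
have lam_d0 : \sum_i lam i * pdot (Dg i zb) (u, d) = 0 by apply: big1 => i _.
exists d; last exact: (mult_gradsI f_C1 g_C1 g_zb lam_kkt xiE lam_d0).
pose l : 'rV[R]_p := \row_i lam i.
have lE : l 0 = lam by apply/funext => i; rewrite mxE.
have lM : multipliers f g zb l by apply/(multipliersP f_C1 g_C1 g_zb); rewrite lE.
have dfE : 'd f zb (u, d) = dot (gradx (lagrangian f g l) zb) u.
  rewrite (gradx_lagrangian f_C1 g_C1) lE -(slopeE d lam_kkt) lam_d0 addr0.
  exact: diff_grad.
split; last exact/(lin_dirsP g_C1).
  by apply: ereal_inf_lbound; exists l => //; rewrite dfE.
by apply: ereal_sup_ubound; exists l => //; rewrite dfE.
Qed.

(** For critical [d], the slope of [f] is at most the upper derivative of the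
    envelope, hence at most the slope of the Lagrangian for [lam]; so the
    nonpositive terms of [lam] along [(u, d)] have a nonnegative sum, and
    vanish. *)
Lemma subgradient_crit d : crit f g gamma zb u d -> mult_grads f g zb u d xi.
Proof.
move=> [_ upper /(lin_dirsP g_C1) lin].
have [lam [lam_kkt xiE [d' [lin' lam_d']]]] := multiplier.
apply: (mult_gradsI f_C1 g_C1 g_zb lam_kkt xiE).
have := le_trans upper (upper_dd_le fD gD gamma0 S_zb kap0 eps0 del0 EB d lin').
rewrite lee_fin diff_grad => h.
have h1 := slopeE d lam_kkt; have h2 := slopeE d' lam_kkt.
have h3 : \sum_i lam i * pdot (Dg i zb) (u, d') = 0 by apply: big1 => i _.
have h4 : \sum_i lam i * pdot (Dg i zb) (u, d) <= 0.
  case: lam_kkt => lam0 lamc _; apply: sumr_le0 => i _.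
  have [gi|/lamc ->] := eqVneq (g zb 0 i) 0; last by rewrite mul0r.
  by rewrite mulr_ge0_le0 // lin.
move: h1 h2 h3 h4 h; move: (\sum_i _) (\sum_i _) (\sum_i _) => A B C; lra.
Qed.

End WeaklyConvexLowerLevel.

(** * Directional quasi-normality *)

Section JointlyWeaklyConvexLowerLevel.
Context {R : realType} {n m p : nat}.
Local Notation Z := ('rV[R]_n * 'rV[R]_m)%type.
Variables (f : Z -> R) (g : Z -> 'rV[R]_p) (gamma rho : R).
Variables (xb u : 'rV[R]_n) (yb v : 'rV[R]_m).
Local Notation zb := ((xb, yb) : Z).
Local Notation env := (moreau f g gamma).
Local Notation Dg i := (grad (component g i)).
Hypotheses (f_C1 : C1 f) (g_C1 : C1 g) (gamma0 : 0 < gamma) (rho0 : 0 < rho).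
Hypothesis gamma_rho : gamma < 1 / rho.
Hypothesis f_wc : pweakly_convex_on rho (gph_feas g) f.
Hypothesis feas_near : \forall x \near xb, feas g x !=set0.
Hypothesis S_zb : Sgamma f g gamma zb yb.

Let fD : smooth f (grad f) := C1_smooth f_C1.

Let gD i : smooth (component g i) (Dg i) := C1_smooth (component_C1 i g_C1).

Let g_zb : nonpos (g zb). Proof. by case: S_zb. Qed.

Let gamma_rho1 : gamma * rho < 1. Proof. by rewrite -ltr_pdivlMr. Qed.

Let graph_convex (z w : Z) (t : R) : 0 <= t <= 1 ->
  nonpos (g z) -> nonpos (g w) -> nonpos (g (t *: z + (1 - t) *: w)).
Proof. by move=> t01 gz gw; exact: (pweakly_convexP f_wc t01 gz gw).1. Qed.

Let f_semiconvex (z w : Z) (t : R) : 0 <= t <= 1 ->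
  nonpos (g z) -> nonpos (g w) ->
  f (t *: z + (1 - t) *: w) <= t * f z + (1 - t) * f w
     + rho / 2 * (t * (1 - t) * pnorm (z - w) ^+ 2).
Proof. by move=> t01 gz gw; exact: (pweakly_convexP f_wc t01 gz gw).2. Qed.

Let feas_nonempty : exists2 r : R, 0 < r &
  forall x, enorm (x - xb) < r -> exists y, feas g x y.
Proof. exact: (near_enormP _ _).1 feas_near. Qed.

Lemma jointly_weakly_convex_dir_lipschitz : dir_lipschitz env zb (u, v).
Proof.
exact: (env_semiconvex_dir_lipschitz fD gD gamma0 rho0 gamma_rho1 graph_convex
          f_semiconvex S_zb feas_nonempty).
Qed.

Lemma jointly_weakly_convex_subgradient eta xi : MSCQ g zb ->
  graph_deriv env zb (u, v) eta -> 'd f zb (u, v) = eta ->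
  dir_subdiff env zb (u, v) xi -> mult_grads f g zb u v xi.
Proof.
move=> mscq eta_deriv; rewrite diff_grad => df_eta xi_sub.
have [lam [lam_kkt xiE lam_uv]] := env_subgradient_multiplier fD gD gamma0 rho0
  gamma_rho1 graph_convex f_semiconvex S_zb feas_nonempty xi_sub mscq eta_deriv df_eta.
exact: (mult_gradsI f_C1 g_C1 g_zb lam_kkt xiE lam_uv).
Qed.

End JointlyWeaklyConvexLowerLevel.

Unset Implicit Arguments.

Theorem theorem5p5 (R : realType) (n m p q : nat)
  (F f : 'rV[R]_n * 'rV[R]_m -> R)
  (G : 'rV[R]_n * 'rV[R]_m -> 'rV[R]_q)
  (g : 'rV[R]_n * 'rV[R]_m -> 'rV[R]_p)
  (F_C1 : C1 F) (f_C1 : C1 f) (G_C1 : C1 G) (g_C1 : C1 g)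
  (f_wc : forall x, exists2 rho : R,
     0 <= rho & weakly_convex rho (fun y => f (x, y)))
  (g_qc : forall x i, quasi_convex (fun y => g (x, y) 0 i))
  (gamma : R) (gamma_gt0 : 0 < gamma)
  (xb : 'rV[R]_n) (yb : 'rV[R]_m)
  (feasible : VP_feasible f g G gamma (xb, yb))
  (u : 'rV[R]_n) (v : 'rV[R]_m) :
  [/\ (* (i) *)
      forall rho_f : R, 0 <= rho_f ->
        (forall x, weakly_convex rho_f (fun y => f (x, y))) ->
        (0 < rho_f -> gamma < 1 / (2 * rho_f)) ->
        (MFCQ g (xb, yb) \/
         [/\ MSCQ g (xb, yb),
             robinson_stable g (xb, yb) u &
             forall u', u' = u \/ u' = - u ->
               lin_dirs g (xb, yb) u' !=set0 /\
               forall v', lin_dirs g (xb, yb) u' v' ->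
                 FOSCMS g (xb, yb) ('d g (xb, yb) (u', v'))]) ->
        (condQ f g G gamma (xb, yb) (u, v)
           (co (\bigcup_(d in tcrit f g (xb, yb) u `|`
                   (tcrit f g (xb, yb) 0 `&` [set d | enorm d = 1]))
                mult_grads f g (xb, yb) u d)) ->
         dir_quasi_normality f g G gamma (xb, yb) (u, v)) /\
        (inner_calm_star f g gamma (xb, yb) (u, v) ->
         condQ f g G gamma (xb, yb) (u, v)
           (co (\bigcup_(d in tcrit f g (xb, yb) u)
                mult_grads f g (xb, yb) u d)) ->
         dir_quasi_normality f g G gamma (xb, yb) (u, v)),
      (* (ii) *)
      forall rho_f : R, 0 < rho_f ->
        pweakly_convex_on rho_f (gph_feas g) f ->
        gamma < 1 / rho_f ->
        (\forall x \near xb, feas g x !=set0) ->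
        MSCQ g (xb, yb) ->
        condQ f g G gamma (xb, yb) (u, v) (mult_grads f g (xb, yb) u v) ->
        dir_quasi_normality f g G gamma (xb, yb) (u, v) &
      (* (iii) *)
      forall rho_f : R, 0 <= rho_f ->
        (forall x, weakly_convex rho_f (fun y => f (x, y))) ->
        (0 < rho_f -> gamma < 1 / (2 * rho_f)) ->
        sol f g xb yb ->
        RCR g (xb, yb) ->
        robinson_stable g (xb, yb) u ->
        (exists2 d, crit f g gamma (xb, yb) u d &
           condQ f g G gamma (xb, yb) (u, v) (mult_grads f g (xb, yb) u d)) ->
        dir_quasi_normality f g G gamma (xb, yb) (u, v)].
Proof.
have S_zb := VP_feasible_Sgamma feasible.
have g_zb : nonpos (g (xb, yb)) by case: S_zb.
have gD i : smooth (component g i) (grad (component g i)).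
  exact: C1_smooth (component_C1 i g_C1).
split.
- move=> rho rho0 wc gamma_rho reg.
  have mf : MFCQ g (xb, yb).
    by case: reg => [//|[_ _ H]]; exact: (FOSCMS_MFCQ g_C1 g_zb H).
  have [kap [eps [del [kap0 eps0 del0 EB]]]] := error_bound_cone
    (MFCQ_error_bound gD u g_zb (MFCQ_multiplier g_zb mf)).
  have Dg0 i : g (xb, yb) 0 i = 0 -> (grad (component g i) (xb, yb)).2 != 0 \/
      exists2 r : R, 0 < r & forall z, pnorm (z - (xb, yb)) < r ->
        (grad (component g i) z).2 = 0.
    by move=> gi; left; exact: (MFCQ_gradient g_zb mf gi).
  have lip : dir_lipschitz (moreau f g gamma) (xb, yb) (u, v).
    exact: (weakly_convex_dir_lipschitz v f_C1 g_C1 gamma_gt0 rho0 wc gamma_rho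
      g_qc S_zb kap0 eps0 del0 EB).
  have sub xi : dir_subdiff (moreau f g gamma) (xb, yb) (u, v) xi ->
      exists2 d, tcrit f g (xb, yb) u d & mult_grads f g (xb, yb) u d xi.
    exact: (subgradient_tcrit f_C1 g_C1 gamma_gt0 rho0 wc gamma_rho g_qc S_zb kap0 eps0 del0 EB Dg0).
  split=> [QA|_ QA]; split => //; apply: condQ_sub QA => eta a _ _;
    apply: co_mono => xi /sub [d dcrit dxi]; exists d => //; by left.
- move=> rho rho0 wc gamma_rho fn mscq QA.
  split; last exact: (jointly_weakly_convex_dir_lipschitz u v f_C1 g_C1 gamma_gt0 rho0
    gamma_rho wc fn S_zb).
  apply: condQ_sub QA => eta a eta_deriv df_eta.
  apply: co_min; last exact: mult_grads_convex.
  move=> xi; exact: (jointly_weakly_convex_subgradient f_C1 g_C1 gamma_gt0 rho0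
    gamma_rho wc fn S_zb mscq eta_deriv df_eta).
- move=> rho rho0 wc gamma_rho _ rcr rs [d dcrit QA].
  have [kap [eps [del [kap0 eps0 del0 EB]]]] :=
    error_bound_cone (robinson_error_bound rs).
  have Dg0 i (gi : g (xb, yb) 0 i = 0) := RCR_gradient rcr gi.
  split; last exact: (weakly_convex_dir_lipschitz v f_C1 g_C1 gamma_gt0 rho0 wc gamma_rho
    g_qc S_zb kap0 eps0 del0 EB).
  apply: condQ_sub QA => eta a _ _; apply: co_min; last exact: mult_grads_convex.
  move=> xi xi_sub; exact: (subgradient_crit f_C1 g_C1 gamma_gt0 rho0 wc gamma_rho
    g_qc S_zb kap0 eps0 del0 EB Dg0 xi_sub dcrit).
Qed.
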